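(* Let $0\le a<2$, and let $R(t)=c_R\,(t+t_0)^{1/2}$ with constants $c_R>0$, $t_0>0$. There exist constants $\varepsilon>0$ and $C>0$ such that for every initial datum $f_0$ with $0\le f_0\in L^\infty_w(\mathbb{R}^3)$ and $\|f_0\|_{L^\infty_w}<\varepsilon$, the massless Boltzmann equation with hard potential $$\partial_t f(t,p) = R(t)^{-3-a}\int_{\mathbb{R}^3}\int_{\mathbb{S}^2}\frac{\varrho^{2+a}}{|p||q|}\bigl(f(t,p') f(t,q') - f(t,p) f(t,q)\bigr)\, d\omega\, dq,\qquad f(0)=f_0,$$ has a unique non-negative solution $f\in C^1([0,\infty);L^1(\mathbb{R}^3)\cap L^1_{1}(\mathbb{R}^3))$ satisfying $$\sup_{0\leq t<\infty} \|f(t)\|_{L^\infty_w}\leq C\varepsilon.$$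
   Context: Setting: the spatially homogeneous relativistic Boltzmann equation for massless particles in the FLRW spacetime with metric $g=-dt^2+R^2((dx^1)^2+(dx^2)^2+(dx^3)^2)$ and scale factor $R(t)=c_R(t+t_0)^{1/2}$, $c_R,t_0>0$. The unknown is the distribution function $f=f(t,p)$, $t\ge 0$, $p=(p_1,p_2,p_3)\in\mathbb{R}^3$ (covariant momentum components); the scattering kernel is $\sigma(h,\omega)=h^{a}$ with $0\le a<2$, where the relative momentum is $h=R^{-1}\varrho$, and substituting this gives the equation in the claim. Notation: for $p,q\in\mathbb{R}^3$, $|p|$ and $p\cdot q$ are the Euclidean norm and inner product, $dq$ is Lebesgue measure on $\mathbb{R}^3$, $d\omega$ is the surface measure on the unit sphere $\mathbb{S}^2\subset\mathbb{R}^3$, and $$\varrho=\sqrt{2(|p||q|-p\cdot q)}.$$ The post-collision momenta, functions of $(p,q,\omega)$, are $$p'=\frac{p+q}{2}+\frac{1}{2}\left(\varrho\,\omega+\frac{((p+q)\cdot\omega)(p+q)}{|p|+|q|+\varrho}\right),\qquad q'=\frac{p+q}{2}-\frac{1}{2}\left(\varrho\,\omega+\frac{((p+q)\cdot\omega)(p+q)}{|p|+|q|+\varrho}\right).$$ Function spaces: for $r\in\mathbb{R}$, $L^1_r(\mathbb{R}^3)$ is the space of functions with finite norm $\|f\|_{L^1_r}=\int_{\mathbb{R}^3}|f(p)|\,|p|^r\,dp$ (so $L^1=L^1_0$), and $L^\infty_w(\mathbb{R}^3)$ is the space of functions with finite norm $\|f\|_{L^\infty_w}=\sup_{p\in\mathbb{R}^3}|w(p)f(p)|$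 with weight $w(p)=|p|e^{|p|}$ (functions equal almost everywhere are identified, so the supremum is an essential supremum). *)

(* Defs.v *)
From HB Require Import structures.
From mathcomp Require Import all_boot all_order all_algebra.
From mathcomp Require Import all_classical all_reals all_analysis.
From mathcomp Require Import measurable_realfun ring.

Set Implicit Arguments.
Unset Strict Implicit.
Unset Printing Implicit Defensive.
Import Order.TTheory GRing.Theory Num.Theory.
Import numFieldNormedType.Exports.
Local Open Scope classical_set_scope.
Local Open Scope ring_scope.

(* [measurableTypeR R] is [R] with the Borel sigma-algebra on which
   [lebesgue_measure] lives.  The norm [`|p|] inherited from the product type
   is the sup norm; the Euclidean norm is [enorm] below. *)
Notation vec2 R := (measurableTypeR R * measurableTypeR R)%type.
Notation vec3 R := (vec2 R * measurableTypeR R)%type.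

Section Lebesgue.
Context {R : realType}.

Definition leb2 : set (vec2 R) -> \bar R :=
  (lebesgue_measure \x lebesgue_measure)%E.

HB.instance Definition _ := Measure.on leb2.

(* The library proves products of sigma-finite measures sigma-finite, but
   that instance is shadowed by the one for products of subprobabilities. *)
Let sigma_finite_leb2 : sigma_finite setT leb2.
Proof.
have /sigma_finiteP[F [TF ndF Foo]] := sigma_finiteT (@lebesgue_measure R).
exists (fun n => F n `*` F n).
  rewrite -setXTT TF predeqE => -[x y]; split.
    move=> [/= [n _ Fnx] [k _ Gky]]; exists (maxn n k) => //; split.
    - by move: x Fnx; exact/subsetPset/ndF/leq_maxl.
    - by move: y Gky; exact/subsetPset/ndF/leq_maxr.
  by move=> [n _ []/= ? ?]; split; exists n.
move=> k; have [? ?] := Foo k.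
split; first exact: measurableX.
by rewrite /leb2 product_measure1E// lte_mul_pinfty// ge0_fin_numE.
Qed.

HB.instance Definition _ :=
  Measure_isSigmaFinite.Build _ _ _ leb2 sigma_finite_leb2.

Definition leb3 : set (vec3 R) -> \bar R := (leb2 \x lebesgue_measure)%E.

HB.instance Definition _ := Measure.on leb3.

Let sigma_finite_leb3 : sigma_finite setT leb3.
Proof.
have /sigma_finiteP[F [TF ndF Foo]] := sigma_finiteT leb2.
have /sigma_finiteP[G [TG ndG Goo]] := sigma_finiteT (@lebesgue_measure R).
exists (fun n => F n `*` G n).
  rewrite -setXTT TF TG predeqE => -[x y]; split.
    move=> [/= [n _ Fnx] [k _ Gky]]; exists (maxn n k) => //; split.
    - by move: x Fnx; exact/subsetPset/ndF/leq_maxl.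
    - by move: y Gky; exact/subsetPset/ndG/leq_maxr.
  by move=> [n _ []/= ? ?]; split; exists n.
move=> k; have [? ?] := Foo k; have [? ?] := Goo k.
split; first exact: measurableX.
by rewrite /leb3 product_measure1E// lte_mul_pinfty// ge0_fin_numE.
Qed.

HB.instance Definition _ :=
  Measure_isSigmaFinite.Build _ _ _ leb3 sigma_finite_leb3.

End Lebesgue.

Section Sphere.
Context {R : realType}.

(* Chart of the unit sphere by height and longitude [(z, phi)].  Its partial
   derivatives are orthogonal, of norms 1 / sqrt (1 - z^2) and sqrt (1 - z^2),
   so the area element is dz dphi (put z = cos theta to get
   sin theta dtheta dphi). *)
Definition sphere_chart (x : vec2 R) : vec3 R :=
  (Num.sqrt (1 - x.1 ^+ 2) * cos x.2, Num.sqrt (1 - x.1 ^+ 2) * sin x.2, x.1).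

Definition chart_domain : set (vec2 R) := `[-1, 1] `*` `[0, 2 * pi].

Lemma measurable_chart_domain : measurable chart_domain.
Proof. by apply: measurableX. Qed.

Lemma measurable_sphere_chart : measurable_fun setT sphere_chart.
Proof.
have mcomp (f : R -> R) (g : vec2 R -> R) : continuous f ->
    measurable_fun setT g -> measurable_fun setT (f \o g).
  move=> cf mg; apply: measurableT_comp => //.
  exact: continuous_measurable_fun.
have m1 : measurable_fun setT (fst : vec2 R -> R) by exact: measurable_fst.
have m2 : measurable_fun setT (snd : vec2 R -> R) by exact: measurable_snd.
have mz : measurable_fun setT (fun x : vec2 R => Num.sqrt (1 - x.1 ^+ 2) : R).
  apply: (mcomp Num.sqrt (fun x => 1 - x.1 ^+ 2)); first exact: sqrt_continuous.
  by apply: measurable_funB => //; exact: measurable_funX.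
have mc : measurable_fun setT (fun x : vec2 R => cos x.2 : R).
  exact: (mcomp cos snd (@continuous_cos R) m2).
have ms : measurable_fun setT (fun x : vec2 R => sin x.2 : R).
  exact: (mcomp sin snd (@continuous_sin R) m2).
apply/measurable_fun_pair; last exact: m1.
apply/measurable_fun_pair.
- exact: (measurable_funM mz mc).
- exact: (measurable_funM mz ms).
Qed.

(* Surface measure of the unit sphere, as a measure on [vec3 R] carried by
   the sphere. *)
Definition sphere_measure : set (vec3 R) -> \bar R :=
  pushforward (mrestr leb2 measurable_chart_domain) sphere_chart.

Let sphere_measure0 : sphere_measure set0 = 0%E.
Proof. by rewrite /sphere_measure /pushforward preimage_set0 measure0. Qed.

Let sphere_measure_ge0 A : (0 <= sphere_measure A)%E.
Proof. by rewrite /sphere_measure /pushforward measure_ge0. Qed.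

Let sphere_measure_sigma_additive : semi_sigma_additive sphere_measure.
Proof.
move=> F mF tF mUF; rewrite /sphere_measure /pushforward preimage_bigcup.
apply: measure_semi_sigma_additive.
- move=> n; rewrite -[X in measurable X]setTI.
  exact: measurable_sphere_chart.
- apply/trivIsetP => /= i j _ _ ij; rewrite -preimage_setI.
  by move/trivIsetP : tF => /(_ _ _ _ _ ij) ->//; rewrite preimage_set0.
- rewrite -preimage_bigcup -[X in measurable X]setTI.
  exact: measurable_sphere_chart.
Qed.

HB.instance Definition _ := isMeasure.Build _ _ _ sphere_measure
  sphere_measure0 sphere_measure_ge0 sphere_measure_sigma_additive.

Lemma sphere_measureT : sphere_measure setT = (4 * pi)%:E.
Proof.
rewrite /sphere_measure /pushforward preimage_setT /mrestr setTI /leb2.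
rewrite product_measure1E//= !lebesgue_measure_itv/= !lte_fin.
rewrite mulr_gt0 ?pi_gt0// gtrN// -!EFinB -EFinM.
by congr EFin; ring.
Qed.

Let sphere_measure_fin : fin_num_fun sphere_measure.
Proof.
by apply: lty_fin_num_fun; rewrite [X in (X < _)%E]sphere_measureT ltry.
Qed.

HB.instance Definition _ :=
  Measure_isFinite.Build _ _ _ sphere_measure sphere_measure_fin.

End Sphere.

Section Collision.
Context {R : realType}.
Implicit Types (p q w : vec3 R) (a : R) (f : vec3 R -> R).

Definition dot p q : R := p.1.1 * q.1.1 + p.1.2 * q.1.2 + p.2 * q.2.

Definition enorm p : R := Num.sqrt (dot p p).

Definition varrho p q : R := Num.sqrt (2 * (enorm p * enorm q - dot p q)).

Definition deflection p q w : vec3 R :=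
  varrho p q *: w
  + (dot (p + q) w / (enorm p + enorm q + varrho p q)) *: (p + q).

Definition post_p p q w : vec3 R :=
  2^-1 *: (p + q) + 2^-1 *: deflection p q w.

Definition post_q p q w : vec3 R :=
  2^-1 *: (p + q) - 2^-1 *: deflection p q w.

Definition scale_factor (cR t0 t : R) : R := cR * (t + t0) `^ 2^-1.

Definition collision_integrand a f p q w : R :=
  varrho p q `^ (2 + a) / (enorm p * enorm q)
  * (f (post_p p q w) * f (post_q p q w) - f p * f q).

Definition collision a f p : R :=
  (\int[leb3]_q \int[sphere_measure]_w collision_integrand a f p q w)%R.

(* Absolute convergence of the integral defining [collision]: [\int] is a
   total operator, whose value on a non-integrable function is meaningless. *)
Definition collision_converges a f p : Prop :=
  (leb3 \x sphere_measure)%E.-integrable setT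
    (fun x => (collision_integrand a f p x.1 x.2)%:E).

End Collision.

Section Spaces.
Context {R : realType}.
Implicit Types (f : vec3 R -> R) (u v : R -> vec3 R -> R).

(* Elements of the function spaces are represented by measurable functions;
   equality and sign are understood almost everywhere. *)
Definition L1_norm (r : R) f : \bar R :=
  (\int[leb3]_p (`|f p| * enorm p `^ r)%:E)%E.

Definition weight (p : vec3 R) : R := enorm p * expR (enorm p).

Definition Linfw_norm f : \bar R :=
  Lnorm leb3 +oo%E (fun p => (weight p * f p)%:E).

Definition in_Linfw f : Prop :=
  measurable_fun setT f /\ (Linfw_norm f < +oo)%E.

Definition ae_nonneg f : Prop := \forall p \ae leb3, 0 <= f p.

Definition X_norm f : \bar R := (L1_norm 0 f + L1_norm 1 f)%E.

Definition in_X f : Prop := measurable_fun setT f /\ (X_norm f < +oo)%E.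

(* [u] is in C^1([0, oo); X) with derivative [v], where X is the intersection
   of L^1 and L^1_1 with the norm [X_norm]; the derivative at 0 is
   one-sided. *)
Definition C1_with_derivative u v : Prop :=
  forall t : R, 0 <= t ->
  [/\ in_X (u t), in_X (v t),
      X_norm (fun p => (u s p - u t p) / (s - t) - v t p)
        @[s --> within [set s : R | 0 <= s] t^'] --> 0%E
    & X_norm (fun p => v s p - v t p)
        @[s --> within [set s : R | 0 <= s] (nbhs t)] --> 0%E].

Definition solves_boltzmann (a cR t0 : R) (f0 : vec3 R -> R) u : Prop :=
  u 0 = f0 %[ae leb3] /\
  exists2 v, C1_with_derivative u v &
    forall t, 0 <= t -> \forall p \ae leb3,
      collision_converges a (u t) p /\
      v t p = scale_factor cR t0 t `^ (- 3 - a) * collision a (u t) p.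

(* The class in which existence and uniqueness are claimed; [M] bounds the
   supremum in time. *)
Definition admissible_solution (a cR t0 M : R) (f0 : vec3 R -> R) u : Prop :=
  [/\ solves_boltzmann a cR t0 f0 u,
      forall t, 0 <= t -> ae_nonneg (u t)
    & (ereal_sup [set Linfw_norm (u t) | t in [set t : R | (0 <= t)%R]]
       <= M%:E)%E].

End Spaces.

(* Main.v *)
(* Since R(t)^(-3-a) is integrable over the half-line, a change of time makes
   the equation autonomous on a bounded interval, and smallness of the data
   compensates the length of that interval.  Solutions are compared in two
   weights, m = e^(-|p|)/|p| and n = e^(-|p|/2)/|p|: the identity
   |p'| + |q'| = |p| + |q| makes the gain term map each weight into itself, up
   to a constant, while the collision frequency grows at most like 1 + |p| and
   (1 + |p|) m <= 2 n.  The kernel of the gain term has a singularity in the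
   angle between omega and p + q, of an integrable order a < 2.

   Existence: Duhamel's formula keeps the solution between 0 and M m, and is a
   contraction for the norm sup |f| / n.

   Uniqueness: if the difference d of two solutions satisfies |d| <= D n, then
   the positive part of +-d - tau(t) K D n has a nonincreasing integral,
   because the loss term damps d and the rest is at most K D n; hence d is
   bounded by a fraction of D n, and one iterates.  As solutions are only known
   almost everywhere, this needs that p' and q' pull null sets back to null
   sets.  For fixed omega, p' is a quadratic map of p + q and of
   |p| + |q| + varrho which is locally lower Lipschitz, and for fixed p + q the
   latter sum pulls null sets of the line back to null sets in p. *)

Require Import Defs.
From HB Require Import structures.
From mathcomp Require Import all_boot all_order all_algebra.
From mathcomp Require Import all_classical all_reals all_analysis.
From mathcomp Require Import ess_sup_inf measurable_realfun ring lra.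

Set Implicit Arguments.
Unset Strict Implicit.
Unset Printing Implicit Defensive.
Import Order.TTheory GRing.Theory Num.Theory.
Import numFieldNormedType.Exports.
Local Open Scope classical_set_scope.
Local Open Scope ring_scope.

(** * Bilinear collision operators *)

(** The frequency of collisions is unbounded in [p], so a difference of two solutions cannot be
    closed in the weight that bounds them: the term f (loss f - loss g) costs a factor [h], which is
    paid once, by m h <= C n. A single condition 6 T M C^2 <= 1 makes the Duhamel map preserve the
    bound M m, makes it a contraction, and makes the uniqueness step halve the difference. Existence
    is proved for every [p], whereas an arbitrary solution obeys its bounds only almost everywhere;
    the estimates are therefore stated for properties that hold along almost every collision of a
    given [p], and both cases use the same ones. The operators p' and q' pull null sets back by a
    double-counting argument that needs only a lower bound on how they separate points, and no
    Jacobian. The singular integrals are treated in the same elementary spirit: each singularity, on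
    the sphere or at zero momentum, is dominated by a product of functions of one variable, and
    Tonelli reduces it to dyadic sums on the line. *)

Section RealIntegrals.
Context d (Z : measurableType d) (R : realType).
Variable mu : {measure set Z -> \bar R}.

Lemma int_bound (k k' : Z -> R) (A B : R) :
    measurable_fun setT k -> measurable_fun setT k' ->
    (forall z, 0 <= k' z) -> 0 <= B ->
    (\int[mu]_z (k' z)%:E <= A%:E)%E ->
    (\forall z \ae mu, `|k z| <= B * k' z) ->
  mu.-integrable setT (EFin \o k) /\ `|\int[mu]_z k z| <= B * A.
Proof.
move=> mk mk' k'0 B0 iA kk'.
have mEk : measurable_fun setT (EFin \o k) by exact/measurable_EFinP.
have mEk' : measurable_fun setT (EFin \o k') by exact/measurable_EFinP.
have le1 : (\int[mu]_z `|(k z)%:E| <= (B * A)%:E)%E.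
  apply: (@le_trans _ _ (\int[mu]_z (B%:E * (k' z)%:E))%E).
    apply: ae_ge0_le_integral => //.
    - exact: measurableT_comp.
    - by move=> z _; rewrite -EFinM lee_fin mulr_ge0.
    - apply/measurable_EFinP; exact: measurable_funM.
    - by apply: filterS kk' => z + _; rewrite -EFinM abse_EFin lee_fin.
  rewrite ge0_integralZl_EFin//; last by move=> z _; rewrite lee_fin.
  by rewrite EFinM lee_wpmul2l// lee_fin.
have ik : mu.-integrable setT (EFin \o k).
  by apply/integrableP; split => //; rewrite (le_lt_trans le1)// ltry.
split=> //; rewrite -lee_fin EFin_normr_Rintegral//.
exact: le_trans (le_abse_integral _ _ _) le1.
Qed.

End RealIntegrals.

Section Operators.
Context dX dZ (X : measurableType dX) (Z : measurableType dZ) (R : realType).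
Context (mu : {sigma_finite_measure set Z -> \bar R}).
Context (b : X -> Z -> R) (P' Q' : X -> Z -> X) (r : Z -> X).
Implicit Types (f g w : X -> R) (p : X).

(** Here [z] collects the partner momentum and the angle of a collision, and [r] reads off the
    partner. The gain keeps two arguments so that differences can be polarized. *)
Definition gain f g p : R := \int[mu]_z (b p z * (f (P' p z) * g (Q' p z))).

Definition loss g p : R := \int[mu]_z (b p z * g (r z)).

Definition collide f p : R := gain f f p - f p * loss f p.

Context (mb : measurable_fun setT (fun x : X * Z => b x.1 x.2))
  (mP : measurable_fun setT (fun x : X * Z => P' x.1 x.2))
  (mQ : measurable_fun setT (fun x : X * Z => Q' x.1 x.2))
  (mr : measurable_fun setT r)
  (b0 : forall p z, 0 <= b p z).

(** The parameter space [Y] is the momentum space itself for a fixed function, and time times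
    momentum for a function that depends on time. *)
Lemma measurable_gain_integrand dY (Y : measurableType dY) (F G : Y -> X -> R)
    (pr : Y -> X) :
    measurable_fun setT (fun x : Y * X => F x.1 x.2) ->
    measurable_fun setT (fun x : Y * X => G x.1 x.2) ->
    measurable_fun setT pr ->
  measurable_fun setT (fun x : Y * Z => b (pr x.1) x.2 *
    (F x.1 (P' (pr x.1) x.2) * G x.1 (Q' (pr x.1) x.2))).
Proof.
move=> mF mG mpr.
have mpZ : measurable_fun setT (fun x : Y * Z => (pr x.1, x.2)).
  by apply/measurable_fun_pair => //; exact: measurableT_comp.
apply: measurable_funM; first exact: (measurableT_comp mb mpZ).
apply: measurable_funM.
- apply: (measurableT_comp mF (g := fun x : Y * Z => (x.1, P' (pr x.1) x.2))).
  by apply/measurable_fun_pair => //; exact: (measurableT_comp mP mpZ).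
- apply: (measurableT_comp mG (g := fun x : Y * Z => (x.1, Q' (pr x.1) x.2))).
  by apply/measurable_fun_pair => //; exact: (measurableT_comp mQ mpZ).
Qed.

Lemma measurable_loss_integrand dY (Y : measurableType dY) (G : Y -> X -> R)
    (pr : Y -> X) :
    measurable_fun setT (fun x : Y * X => G x.1 x.2) ->
    measurable_fun setT pr ->
  measurable_fun setT (fun x : Y * Z => b (pr x.1) x.2 * G x.1 (r x.2)).
Proof.
move=> mG mpr; apply: measurable_funM.
  apply: (measurableT_comp mb (g := fun x : Y * Z => (pr x.1, x.2))).
  by apply/measurable_fun_pair => //; exact: measurableT_comp.
apply: (measurableT_comp mG (g := fun x : Y * Z => (x.1, r x.2))).
by apply/measurable_fun_pair => //; exact: measurableT_comp.
Qed.

Lemma measurable_Rintegral dY (Y : measurableType dY) (k : Y * Z -> R) :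
    measurable_fun setT k -> (forall x, 0 <= k x) ->
  measurable_fun setT (fun y => \int[mu]_z k (y, z)).
Proof.
move=> mk k0; rewrite /Rintegral; apply: measurableT_comp => //.
apply: (measurable_fun_fubini_tonelli_F (m2 := mu) (EFin \o k)).
- exact/measurable_EFinP.
- by move=> x; rewrite lee_fin.
Qed.

Let mcst dY (Y : measurableType dY) f : measurable_fun setT f ->
  measurable_fun setT (fun x : Y * X => f x.2).
Proof. by move=> mf; exact: measurableT_comp. Qed.

Lemma measurable_gain_at f g p : measurable_fun setT f ->
  measurable_fun setT g ->
  measurable_fun setT (fun z => b p z * (f (P' p z) * g (Q' p z))).
Proof.
move=> mf mg.
have /= := measurable_gain_integrand (Y := X) (F := fun=> f) (G := fun=> g)
  (pr := id) (mcst mf) (mcst mg) (@measurable_id _ _ _).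
move=> mk; apply: (measurableT_comp mk (g := fun z => (p, z))).
exact: measurable_pair1.
Qed.

Lemma measurable_loss_at g p : measurable_fun setT g ->
  measurable_fun setT (fun z => b p z * g (r z)).
Proof.
move=> mg.
have /= := measurable_loss_integrand (Y := X) (G := fun=> g)
  (pr := id) (mcst mg) (@measurable_id _ _ _).
move=> mk; apply: (measurableT_comp mk (g := fun z => (p, z))).
exact: measurable_pair1.
Qed.

Lemma gain_bound f g w p (C al be : R) :
    measurable_fun setT f -> measurable_fun setT g -> measurable_fun setT w ->
    (forall p, 0 <= w p) -> 0 <= al -> 0 <= be ->
    (\int[mu]_z (b p z * (w (P' p z) * w (Q' p z)))%:E <= (C * w p)%:E)%E ->
    (\forall z \ae mu, `|f (P' p z)| <= al * w (P' p z)) ->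
    (\forall z \ae mu, `|g (Q' p z)| <= be * w (Q' p z)) ->
  mu.-integrable setT
    (EFin \o (fun z => b p z * (f (P' p z) * g (Q' p z)))) /\
  `|gain f g p| <= al * be * (C * w p).
Proof.
move=> mf mg mw w0 al0 be0 Cw fal gbe.
apply: int_bound Cw _; rewrite ?mulr_ge0//.
- exact: measurable_gain_at.
- exact: measurable_gain_at.
- by move=> z; rewrite !mulr_ge0.
apply: filterS2 fal gbe => z fz gz.
rewrite !normrM ger0_norm//.
rewrite [leRHS](_ : _ = b p z * ((al * w (P' p z)) * (be * w (Q' p z)))).
  by apply: ler_wpM2l => //; exact: ler_pM.
by ring.
Qed.

Lemma loss_bound g w p (C be : R) :
    measurable_fun setT g -> measurable_fun setT w ->
    (forall p, 0 <= w p) -> 0 <= be ->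
    (\int[mu]_z (b p z * w (r z))%:E <= C%:E)%E ->
    (\forall z \ae mu, `|g (r z)| <= be * w (r z)) ->
  mu.-integrable setT (EFin \o (fun z => b p z * g (r z))) /\
  `|loss g p| <= be * C.
Proof.
move=> mg mw w0 be0 Cw gbe.
apply: int_bound Cw _; rewrite ?mulr_ge0//.
- exact: measurable_loss_at.
- exact: measurable_loss_at.
- by move=> z; rewrite mulr_ge0.
apply: filterS gbe => z gz; rewrite normrM ger0_norm//.
by rewrite mulrCA ler_wpM2l.
Qed.

Lemma gainBl f f' g p :
    mu.-integrable setT
      (EFin \o (fun z => b p z * (f (P' p z) * g (Q' p z)))) ->
    mu.-integrable setT
      (EFin \o (fun z => b p z * (f' (P' p z) * g (Q' p z)))) ->
  gain (f \- f') g p = gain f g p - gain f' g p.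
Proof.
move=> i1 i2; rewrite /gain -RintegralB//.
by apply: eq_Rintegral => z _ /=; ring.
Qed.

Lemma gainBr f g g' p :
    mu.-integrable setT
      (EFin \o (fun z => b p z * (f (P' p z) * g (Q' p z)))) ->
    mu.-integrable setT
      (EFin \o (fun z => b p z * (f (P' p z) * g' (Q' p z)))) ->
  gain f (g \- g') p = gain f g p - gain f g' p.
Proof.
move=> i1 i2; rewrite /gain -RintegralB//.
by apply: eq_Rintegral => z _ /=; ring.
Qed.

Lemma lossB g g' p :
    mu.-integrable setT (EFin \o (fun z => b p z * g (r z))) ->
    mu.-integrable setT (EFin \o (fun z => b p z * g' (r z))) ->
  loss (g \- g') p = loss g p - loss g' p.
Proof.
move=> i1 i2; rewrite /loss -RintegralB//.
by apply: eq_Rintegral => z _ /=; ring.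
Qed.

Lemma gain_ge0 f g p : (forall p, 0 <= f p) -> (forall p, 0 <= g p) ->
  0 <= gain f g p.
Proof. by move=> f0 g0; apply: Rintegral_ge0 => z _; rewrite !mulr_ge0. Qed.

Lemma loss_ge0 g p : (forall p, 0 <= g p) -> 0 <= loss g p.
Proof. by move=> g0; apply: Rintegral_ge0 => z _; rewrite mulr_ge0. Qed.

End Operators.

(** * Integrals in time and Duhamel's formula *)

Lemma measurable_set_ge0 d (T : measurableType d) (R : realType) (f : T -> R) :
  measurable_fun setT f -> measurable [set x | 0 <= f x].
Proof.
move=> mf; rewrite (_ : [set x | _] = setT `&` f @^-1` [set` `[0, +oo[]).
  exact: mf.
by apply/seteqP; split => x /=; rewrite in_itv/= andbT//; case.
Qed.

Section Primitive.
Context (R : realType).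
Notation leb := (@lebesgue_measure R).
Implicit Types (f g l : R -> R) (s t : R).

Definition prim f t : R := \int[leb]_(s in `[0, t]) f s.

Lemma bounded_integrable_itv f B (i : interval R) (s t : R) :
    measurable_fun setT f -> (forall x, `|f x| <= B) ->
    [set` i] `<=` `[s, t] -> measurable [set` i] ->
  leb.-integrable [set` i] (EFin \o f).
Proof.
move=> mf fB ist mi; apply: (@integrableS _ _ _ leb `[s, t]) => //.
apply: measurable_bounded_integrable => //.
- rewrite [X in (X < _)%E]lebesgue_measure_itv/=.
  by case: ifPn => // _; rewrite -EFinB ltry.
- exact: measurable_funTS.
- exists B; split; first exact: num_real.
  by move=> x Bx y _ /=; exact: le_trans (fB y) (ltW Bx).
Qed.

Lemma le_Rintegral_itv f B (i : interval R) (s t : R) :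
    measurable_fun setT f -> (forall x, 0 <= f x <= B) ->
    [set` i] `<=` `[s, t] -> measurable [set` i] -> s <= t ->
  0 <= \int[leb]_(x in [set` i]) f x <= B * (t - s).
Proof.
move=> mf fB ist mi st.
have fB' x : `|f x| <= B by have /andP[? ?] := fB x; rewrite ger0_norm.
apply/andP; split; first by apply: Rintegral_ge0 => x _; case/andP : (fB x).
have B0 : 0 <= B by case/andP : (fB 0); exact: le_trans.
have fin : leb [set` i] \is a fin_num.
  rewrite ge0_fin_numE//; apply: (@le_lt_trans _ _ (leb `[s, t])).
    by apply: le_measure => //; rewrite inE.
  rewrite [X in (X < _)%E]lebesgue_measure_itv/=.
  by case: ifPn => // _; rewrite -EFinB ltry.
apply: (@le_trans _ _ (\int[leb]_(x in [set` i]) B)).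
  apply: le_Rintegral => //; first exact: (bounded_integrable_itv mf fB' ist).
  - apply: (@bounded_integrable_itv (cst B) B _ s t) => // x.
    by rewrite ger0_norm.
  - by move=> x _; case/andP : (fB x).
rewrite Rintegral_cst// ler_wpM2l// -lee_fin fineK//.
apply: (@le_trans _ _ (leb `[s, t])).
  by apply: le_measure => //; rewrite inE.
rewrite [X in (X <= _)%E]lebesgue_measure_itv/=.
by case: ifPn => // _; rewrite lee_fin subr_ge0.
Qed.

Lemma primB f B s t : measurable_fun setT f -> (forall x, `|f x| <= B) ->
  0 <= s <= t -> prim f t - prim f s = \int[leb]_(x in `]s, t]) f x.
Proof.
move=> mf fB /andP[s0 st]; apply: Rintegral_itvB => //.
exact: (@bounded_integrable_itv _ B _ 0 t).
Qed.

Lemma prim_incr f B s t : measurable_fun setT f -> (forall x, 0 <= f x <= B) ->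
  0 <= s <= t -> 0 <= prim f t - prim f s <= B * (t - s).
Proof.
move=> mf fB st.
have fB' x : `|f x| <= B by have /andP[? ?] := fB x; rewrite ger0_norm.
rewrite (primB mf fB')//; apply: le_Rintegral_itv => //.
- by apply: subset_itvr; rewrite bnd_simp.
- by case/andP : st.
Qed.

Lemma prim_le f B t : measurable_fun setT f -> (forall x, 0 <= f x <= B) ->
  0 <= t -> 0 <= prim f t <= B * t.
Proof.
move=> mf fB t0; rewrite -[t in B * t]subr0; apply: le_Rintegral_itv => //.
Qed.

Lemma primD f g B C s : measurable_fun setT f -> measurable_fun setT g ->
  (forall x, `|f x| <= B) -> (forall x, `|g x| <= C) ->
  prim (f \- g) s = prim f s - prim g s.
Proof.
move=> mf mg fB gC; rewrite /prim RintegralB//.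
- exact: (@bounded_integrable_itv _ B _ 0 s).
- exact: (@bounded_integrable_itv _ C _ 0 s).
Qed.

Lemma prim_dist f g B C eta s t :
  measurable_fun setT f -> measurable_fun setT g ->
  (forall x, `|f x| <= B) -> (forall x, `|g x| <= C) ->
  (forall x, `|f x - g x| <= eta) -> 0 <= s <= t ->
  `|(prim f t - prim f s) - (prim g t - prim g s)| <= eta * (t - s).
Proof.
move=> mf mg fB gC fg st.
have mfg : measurable_fun setT (f \- g) by exact: measurable_funB.
have -> : prim f t - prim f s - (prim g t - prim g s) =
    prim (f \- g) t - prim (f \- g) s.
  by rewrite !(primD _ mf mg fB gC); ring.
rewrite (primB mfg fg)//.
have ist : `]s, t] `<=` `[s, t] by apply: subset_itvr; rewrite bnd_simp.
have mn : measurable_fun setT (fun x => `|(f \- g) x|).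
  exact: measurableT_comp.
apply: le_trans (le_normr_Rintegral _ _) _ => //.
  exact: (bounded_integrable_itv mfg fg ist).
case/andP : (st) => _ st'.
have H x : 0 <= `|(f \- g) x| <= eta by rewrite normr_ge0/=; exact: fg.
by have /andP[] := le_Rintegral_itv mn H ist (measurable_itv _) st'.
Qed.

Lemma prim0 f : prim f 0 = 0.
Proof. by rewrite /prim set_itv1 Rintegral_set1. Qed.

Lemma measurable_prim dX (X : measurableType dX) (k : R -> X -> R) :
    measurable_fun setT (fun x : measurableTypeR R * X => k x.1 x.2) ->
    (forall s p, 0 <= k s p) ->
  measurable_fun setT
    (fun x : measurableTypeR R * X => prim (k ^~ x.2) x.1).
Proof.
move=> mk k0.
(* The integral over [0, t] becomes an integral over the whole line against the indicator of 0 <= s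
   <= t, which is jointly measurable in t and s, so Tonelli applies. *)
pose A : set ((measurableTypeR R * X) * measurableTypeR R) :=
  [set y | (0 <= y.2)%R] `&` [set y | (0 <= y.1.1 - y.2)%R].
have mA : measurable A.
  apply: measurableI; apply: measurable_set_ge0 => //.
  apply: measurable_funB => //.
  by apply: (measurableT_comp (f := fst)).
rewrite (_ : (fun _ => _) = fun x : measurableTypeR R * X =>
    \int[leb]_s (\1_A (x, s) * k s x.2)).
  apply: (@measurable_Rintegral _ _ _ leb _ _
    (fun y : (measurableTypeR R * X) * measurableTypeR R =>
      \1_A y * k y.2 y.1.2)).
    apply: measurable_funM; first exact: measurable_indic.
    apply: (measurableT_comp mk
      (g := fun y : (measurableTypeR R * X) * measurableTypeR R => (y.2, y.1.2))).
    apply/measurable_fun_pair => //.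
    by apply: (measurableT_comp (f := snd)).
  by move=> x; rewrite mulr_ge0.
apply/funext => -[t p]/=; rewrite /prim Rintegral_mkcond.
apply: eq_Rintegral => s _; rewrite patchE indicE /A.
case: ifPn => [|/negP].
  rewrite inE/= in_itv/= => /andP[s0 st].
  by rewrite mem_set ?mul1r//; split => //=; rewrite subr_ge0.
move=> st; rewrite memNset ?mul0r//= => -[/= s0]; rewrite subr_ge0 => st'.
by apply: st; rewrite inE/= in_itv/= s0.
Qed.

Lemma measurable_prim1 f : measurable_fun setT f -> (forall s, 0 <= f s) ->
  measurable_fun setT (prim f).
Proof.
move=> mf f0.
have := @measurable_prim _ (measurableTypeR R) (fun s _ => f s).
move=> /(_ (measurableT_comp mf measurable_fst)).
move=> /(_ (fun s _ => f0 s)) mk.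
apply: (measurableT_comp mk (g := fun s : measurableTypeR R => (s, s))).
exact/measurable_fun_pair.
Qed.

Lemma prim_derive f B t : measurable_fun setT f -> (forall x, `|f x| <= B) ->
  0 < t -> {for t, continuous f} -> is_derive t 1 (prim f) (f t).
Proof.
move=> mf fB t0 cf.
have tu : t < t + 1 by rewrite ltrDl.
have intf : leb.-integrable `[0, t + 1] (EFin \o f).
  exact: (@bounded_integrable_itv _ B _ 0 (t + 1)).
have [d1 d2] := continuous_FTC1_closed tu intf t0 cf.
by apply: DeriveDef; [exact: d1|rewrite -derive1E; exact: d2].
Qed.

End Primitive.

Section Duhamel.
Context (R : realType).
Notation leb := (@lebesgue_measure R).
Implicit Types (f g l : R -> R) (y s t : R).

Lemma expRN_dist (x y : R) : 0 <= x -> 0 <= y ->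
  `|expR (- x) - expR (- y)| <= `|x - y|.
Proof.
wlog xy : x y / x <= y => [H x0 y0|x0 y0].
  case: (leP x y) => [|/ltW] xy; first exact: H.
  by rewrite distrC (distrC x); exact: H.
have e1 : expR (- x) <= 1 by rewrite -expR0 ler_expR oppr_le0.
rewrite ger0_norm ?subr_ge0 ?ler_expR ?lerN2// ler0_norm ?subr_le0// opprB.
rewrite (_ : - y = - x + (x - y)); last by ring.
rewrite expRD -[X in X - _]mulr1 -mulrBr.
apply: (@le_trans _ _ (1 * (1 - expR (x - y)))).
  by rewrite ler_wpM2r// subr_ge0 -expR0 ler_expR subr_le0.
by have := expR_ge1Dx (x - y); lra.
Qed.

(** The value at [t] of the solution of f' = g - l f, f(0) = y, by the integrating factor. *)
Definition duhamel l g y t : R :=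
  expR (- prim l t) * (y + prim (fun s => expR (prim l s) * g s) t).

Section bounds.
Context (l g : R -> R) (lam ga : R).
Context (ml : measurable_fun setT l) (mg : measurable_fun setT g)
  (hl : forall s, 0 <= l s <= lam) (hg : forall s, 0 <= g s <= ga).

Let l0 s : 0 <= l s. Proof. by case/andP : (hl s). Qed.
Let g0 s : 0 <= g s. Proof. by case/andP : (hg s). Qed.
Let lam0 : 0 <= lam. Proof. by case/andP : (hl 0) => ?; exact: le_trans. Qed.
Let ga0 : 0 <= ga. Proof. by case/andP : (hg 0) => ?; exact: le_trans. Qed.
Let lB s : `|l s| <= lam.
Proof. by rewrite ger0_norm//; case/andP : (hl s). Qed.

(* Truncating the integrand at the final time makes it bounded on the line. *)
Definition trunc T l g s := if s <= T then expR (prim l s) * g s else 0.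

Let prim_neg f s : s < 0 -> prim f s = 0.
Proof.
by move=> s0; rewrite /prim set_itv_ge ?Rintegral_set0// bnd_simp -ltNge.
Qed.

Let prim_ge0 s : 0 <= prim l s.
Proof.
case: (ltP s 0) => [/prim_neg -> //|s0].
by have /andP[] := prim_le ml hl s0.
Qed.

Lemma prim_homo s t : s <= t -> prim l s <= prim l t.
Proof.
move=> st; case: (ltP s 0) => [/prim_neg -> //|s0].
have st' : 0 <= s <= t by rewrite s0.
by rewrite -subr_ge0; have /andP[] := prim_incr ml hl st'.
Qed.

Lemma prim_trunc T t : t <= T ->
  prim (fun s => expR (prim l s) * g s) t = prim (trunc T l g) t.
Proof.
move=> tT; apply: eq_Rintegral => s; rewrite inE/= in_itv/= => /andP[_ st].
by rewrite /trunc (le_trans st tT).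
Qed.

Lemma trunc_bound T s : 0 <= trunc T l g s <= expR (prim l T) * ga.
Proof.
rewrite /trunc; case: ifPn => sT.
  rewrite mulr_ge0 ?expR_ge0//=.
  have /andP[gs0 gs1] := hg s.
  have lT : expR (prim l s) <= expR (prim l T) by rewrite ler_expR prim_homo.
  exact: ler_pM (expR_ge0 _) gs0 lT gs1.
by rewrite lexx mulr_ge0 ?expR_ge0.
Qed.

Lemma measurable_trunc T : measurable_fun setT (trunc T l g).
Proof.
apply: measurable_fun_if => //.
- exact: measurable_fun_ler.
- apply: measurable_funTS; apply: measurable_funM => //.
  by apply: measurableT_comp => //; apply: measurable_prim1.
Qed.

Lemma duhamel_ge0 y t : 0 <= y -> 0 <= t -> 0 <= duhamel l g y t.
Proof.
move=> y0 t0; rewrite mulr_ge0 ?expR_ge0// addr_ge0//.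
rewrite (prim_trunc (lexx t)).
by have /andP[] := prim_le (measurable_trunc t) (trunc_bound t) t0.
Qed.

(** Restarting at time [s]: the source acting between [s] and [t] adds [c], and since the damping
    can only reduce it, [c] is at most [ga * (t - s)]. Both the upper bound and the Lipschitz bound
    follow. *)
Lemma duhamel_semigroup y s t : 0 <= s <= t ->
  exists2 c, 0 <= c <= ga * (t - s) &
    duhamel l g y t = expR (- (prim l t - prim l s)) * duhamel l g y s + c.
Proof.
move=> st; have /andP[s0 st'] := st.
(* Truncating at [t] makes the growth factor of [trunc_bound] cancel against the damping factor at
   [t]. *)
exists (expR (- prim l t) * (prim (trunc t l g) t - prim (trunc t l g) s)).
  have /andP[c0 c1] := prim_incr (measurable_trunc t) (trunc_bound t) st.
  rewrite mulr_ge0 ?expR_ge0//=.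
  rewrite (le_trans (ler_wpM2l _ c1)) ?expR_ge0//.
  by rewrite !mulrA -expRD addNr expR0 mul1r.
rewrite /duhamel (prim_trunc (lexx t)) (prim_trunc st').
rewrite [in RHS]mulrA -expRD.
rewrite (_ : - (prim l t - prim l s) - prim l s = - prim l t); last by ring.
by ring.
Qed.

Lemma duhamel_le y t : 0 <= y -> 0 <= t -> duhamel l g y t <= y + ga * t.
Proof.
move=> y0 t0; have t0' : 0 <= (0 : R) <= t by apply/andP.
have [c /andP[_ cga] ->] := duhamel_semigroup y t0'; rewrite subr0 in cga; apply: lerD => //.
rewrite /duhamel !prim0 oppr0 expR0 mul1r !addr0 ler_piMl//.
by rewrite -expR0 ler_expR oppr_le0.
Qed.

(** Between [s] and [t] the damping removes at most the fraction [lam * (t - s)] of a value at most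
    [M], and the source adds at most [ga * (t - s)]. *)
Lemma duhamel_lip y M s t : 0 <= y -> 0 <= s <= t ->
    duhamel l g y s <= M ->
  `|duhamel l g y t - duhamel l g y s| <= (lam * M + ga) * (t - s).
Proof.
move=> y0 st sM; have /andP[s0 st'] := st.
have [c /andP[c0 cga] ->] := duhamel_semigroup y st.
set e := expR _; set Y := duhamel l g y s.
have Y0 : 0 <= Y by exact: duhamel_ge0.
have /andP[i0 i1] := prim_incr ml hl st.
have e1 : e <= 1 by rewrite /e -expR0 ler_expR oppr_le0.
have e2 : 1 - lam * (t - s) <= e.
  have := expR_ge1Dx (- (prim l t - prim l s)); rewrite -/e; lra.
have : (1 - e) * Y <= lam * (t - s) * M.
  by apply: ler_pM => //; lra.
have : 0 <= (1 - e) * Y by rewrite mulr_ge0// subr_ge0.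
have ts : 0 <= t - s by rewrite subr_ge0.
have : 0 <= lam * M * (t - s).
  by rewrite mulr_ge0// mulr_ge0// (le_trans Y0).
have : 0 <= ga * (t - s) by rewrite mulr_ge0.
rewrite ler_norml; move=> *; apply/andP; split; nra.
Qed.

Lemma duhamel_derive y t : 0 < t -> {for t, continuous l} ->
    {for t, continuous g} ->
  is_derive t 1 (duhamel l g y) (g t - l t * duhamel l g y t).
Proof.
move=> t0 cl cg.
have dl : is_derive t 1 (prim l) (l t) by exact: prim_derive lB t0 cl.
have cp : {for t, continuous (prim l)}.
  by apply: differentiable_continuous; apply/derivable1_diffP.
(* Near [t] the integrand coincides with its truncation at t + 1, which is bounded on the whole
   line, as differentiating a primitive requires here. *)
have tT : t < t + 1 by rewrite ltrDl.
have etr : trunc (t + 1) l g t = expR (prim l t) * g t.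
  by rewrite /trunc ifT// ltW.
have eqT : {near t, (fun s => expR (prim l s) * g s) =1 trunc (t + 1) l g}.
  near=> s; rewrite /trunc ifT//.
  by near: s; apply: lt_nbhsl_le || (near do [apply: ltW]; exact: lt_nbhsl).
have ck : {for t, continuous (fun s => expR (prim l s) * g s)}.
  apply: cvgM => //; apply: continuous_comp => //.
  exact: continuous_expR.
have ctr : {for t, continuous (trunc (t + 1) l g)}.
  rewrite /prop_for /continuous_at etr.
  apply: cvg_trans ck; exact: near_eq_cvg.
have dtr : is_derive t 1 (prim (trunc (t + 1) l g)) (trunc (t + 1) l g t).
  have trB s : `|trunc (t + 1) l g s| <= expR (prim l (t + 1)) * ga.
    by have /andP[? ?] := trunc_bound (t + 1) s; rewrite ger0_norm.
  exact: prim_derive (measurable_trunc _) trB t0 ctr.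
have dp : is_derive t 1 (prim (fun s => expR (prim l s) * g s))
    (expR (prim l t) * g t).
  rewrite -etr; apply: near_eq_is_derive dtr.
  near=> s; rewrite (@prim_trunc (t + 1))//.
  by near: s; (near do [apply: ltW]; exact: lt_nbhsl).
rewrite /duhamel.
apply: is_derive_eq.
have sE (u v : R) : u *: v = u * v by [].
rewrite !sE add0r mul1r.
have e : expR (- prim l t) * expR (prim l t) = 1 by rewrite -expRD addNr expR0.
by rewrite mulrA e mul1r; ring.
Unshelve. all: by end_near. Qed.

End bounds.
End Duhamel.

(** * An abstract kinetic equation *)

Section DuhamelStability.
Context (R : realType) (l1 l2 g1 g2 : R -> R) (lam ga dl dg : R).
Context (ml1 : measurable_fun setT l1) (ml2 : measurable_fun setT l2)
  (mg1 : measurable_fun setT g1) (mg2 : measurable_fun setT g2)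
  (hl1 : forall s, 0 <= l1 s <= lam) (hl2 : forall s, 0 <= l2 s <= lam)
  (hg1 : forall s, 0 <= g1 s <= ga) (hg2 : forall s, 0 <= g2 s <= ga)
  (hl : forall s, `|l1 s - l2 s| <= dl) (hg : forall s, `|g1 s - g2 s| <= dg).
Implicit Types (l g : R -> R) (y s t : R).

(** Moving the damping factor inside the integral leaves an integrand with values in [0, ga]; a
    perturbation of [l] then enters only through x -> e^(-x), which is 1-Lipschitz for x >= 0, and
    no exponential growth appears. *)
Let kern t l g s := if s <= t then expR (- (prim l t - prim l s)) * g s else 0.

Let duhamelE l g y t : measurable_fun setT l -> measurable_fun setT g ->
    (forall s, 0 <= l s <= lam) -> (forall s, 0 <= g s <= ga) -> 0 <= t ->
  [/\ measurable_fun setT (kern t l g), forall s, `|kern t l g s| <= ga &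
      duhamel l g y t = y * expR (- prim l t) + prim (kern t l g) t].
Proof.
move=> ml mg hl' hg' t0.
have kE : kern t l g = (fun s => expR (- prim l t) * trunc t l g s).
  apply/funext => s; rewrite /kern /trunc; case: ifPn => _; last by rewrite mulr0.
  by rewrite mulrA -expRD opprB addrC.
have mtr := measurable_trunc ml mg hl' t.
split.
- by rewrite kE; exact: measurable_funM.
- have ga0 : 0 <= ga by case/andP : (hg' 0); exact: le_trans.
  move=> s; rewrite /kern; case: ifPn => st; last by rewrite normr0.
  have /andP[g0 gg] := hg' s.
  rewrite ger0_norm ?mulr_ge0 ?expR_ge0//.
  rewrite -[leRHS]mul1r ler_pM ?expR_ge0//.
  by rewrite -expR0 ler_expR oppr_le0 subr_ge0; exact: (prim_homo ml hl').
- rewrite /duhamel (prim_trunc _ _ (lexx t)) mulrDr [y * _]mulrC kE.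
  congr (_ + _); rewrite /prim RintegralZl//.
  have trB s : `|trunc t l g s| <= expR (prim l t) * ga.
    by have /andP[? ?] := trunc_bound ml hl' hg' t s; rewrite ger0_norm.
  exact: (bounded_integrable_itv mtr trB (s := 0) (t := t)).
Qed.

(** The three terms are the effect of [dl] on the damped datum, of [dg] on the source, and of [dl]
    on the damping of the source. *)
Lemma duhamel_dist y t : 0 <= y -> 0 <= t ->
  `|duhamel l1 g1 y t - duhamel l2 g2 y t| <= (y * dl + dg + ga * dl * t) * t.
Proof.
move=> y0 t0.
have [mk1 k1 ->] := duhamelE y ml1 mg1 hl1 hg1 t0.
have [mk2 k2 ->] := duhamelE y ml2 mg2 hl2 hg2 t0.
have l1B s : `|l1 s| <= lam by have /andP[? ?] := hl1 s; rewrite ger0_norm.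
have l2B s : `|l2 s| <= lam by have /andP[? ?] := hl2 s; rewrite ger0_norm.
have pd s : 0 <= s <= t ->
    `|(prim l1 t - prim l1 s) - (prim l2 t - prim l2 s)| <= dl * t.
  move=> /andP[s0 st].
  apply: le_trans (prim_dist ml1 ml2 l1B l2B hl _) _; first by rewrite s0.
  rewrite ler_wpM2l ?gerBl//.
  by apply: le_trans (hl 0).
have pd0 : `|prim l1 t - prim l2 t| <= dl * t.
  by have := pd 0; rewrite !prim0 !subr0; apply; rewrite lexx.
rewrite (_ : _ - _ = y * (expR (- prim l1 t) - expR (- prim l2 t)) +
  (prim (kern t l1 g1) t - prim (kern t l2 g2) t)); last by ring.
rewrite (le_trans (ler_normD _ _))//.
rewrite (_ : _ * t = y * (dl * t) + (dg + ga * (dl * t)) * t); last by ring.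
have prim_pos l : measurable_fun setT l -> (forall s, 0 <= l s <= lam) ->
    0 <= prim l t by move=> ml hl'; have /andP[] := prim_le ml hl' t0.
apply: lerD.
  rewrite normrM ger0_norm// ler_wpM2l//.
  by apply: le_trans pd0; apply: expRN_dist; exact: prim_pos.
have kd s : `|kern t l1 g1 s - kern t l2 g2 s| <= dg + ga * (dl * t).
  have dg0 : 0 <= dg by exact: le_trans (hg 0).
  have ga0 : 0 <= ga by case/andP : (hg1 0); exact: le_trans.
  have dlt0 : 0 <= dl * t by exact: le_trans pd0.
  rewrite /kern; case: ifPn => st; last first.
    by rewrite subrr normr0 addr_ge0// mulr_ge0.
  set x1 := prim l1 t - _; set x2 := prim l2 t - _.
  have x10 : 0 <= x1 by rewrite subr_ge0; exact: (prim_homo ml1 hl1).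
  have x20 : 0 <= x2 by rewrite subr_ge0; exact: (prim_homo ml2 hl2).
  have x12 : `|x1 - x2| <= dl * t.
    have [s0|s0] := ltP s 0; last by apply: pd; rewrite s0.
    rewrite /x1 /x2 /prim (set_itv_ge (b2 := BRight s)) ?Rintegral_set0 ?subr0//.
    by rewrite bnd_simp -ltNge.
  rewrite (_ : _ - _ = expR (- x1) * (g1 s - g2 s) +
    (expR (- x1) - expR (- x2)) * g2 s); last by ring.
  rewrite (le_trans (ler_normD _ _))// !normrM; apply: lerD.
    rewrite -[leRHS]mul1r ler_pM// ger0_norm ?expR_ge0//.
    by rewrite -expR0 ler_expR oppr_le0.
  rewrite mulrC ler_pM//.
    by have /andP[? ?] := hg2 s; rewrite ger0_norm.
  exact: le_trans (expRN_dist x10 x20) _.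
have t00 : 0 <= (0 : R) <= t by apply/andP.
have := prim_dist mk1 mk2 k1 k2 kd t00.
by rewrite !prim0 !subr0.
Qed.

End DuhamelStability.

Section CollisionEstimates.
Context dX dZ (X : measurableType dX) (Z : measurableType dZ) (R : realType).
Context (mu : {sigma_finite_measure set Z -> \bar R}).
Context (b : X -> Z -> R) (P' Q' : X -> Z -> X) (r : Z -> X).
Context (m n h : X -> R) (C : R).

(* [m] is the weight in which solutions are bounded, [n] the weaker one in
   which they are compared; [h] is the growth of the collision frequency. *)
Record kinetic : Prop := Kinetic {
  kin_mb : measurable_fun setT (fun x : X * Z => b x.1 x.2);
  kin_mP : measurable_fun setT (fun x : X * Z => P' x.1 x.2);
  kin_mQ : measurable_fun setT (fun x : X * Z => Q' x.1 x.2);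
  kin_mr : measurable_fun setT r;
  kin_mm : measurable_fun setT m;
  kin_mn : measurable_fun setT n;
  kin_b0 : forall p z, 0 <= b p z;
  kin_m0 : forall p, 0 <= m p;
  kin_mn_le : forall p, m p <= n p;
  kin_h0 : forall p, 0 <= h p;
  kin_mh : forall p, m p * h p <= C * n p;
  kin_gain_m : forall p,
    (\int[mu]_z (b p z * (m (P' p z) * m (Q' p z)))%:E <= (C * m p)%:E)%E;
  kin_gain_n : forall p,
    (\int[mu]_z (b p z * (n (P' p z) * n (Q' p z)))%:E <= (C * n p)%:E)%E;
  kin_loss_n : forall p, (\int[mu]_z (b p z * n (r z))%:E <= (C * h p)%:E)%E }.

Context (K : kinetic).
Implicit Types (M D al be : R) (f g : X -> R) (p : X) (A : X -> Prop).

Local Notation gain := (gain mu b P' Q').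
Local Notation loss := (loss mu b r).
Local Notation collide := (collide mu b P' Q' r).

(** [A] holds at the outgoing and partner momenta of almost every collision of a particle of
    momentum [p]. This is the form in which pointwise bounds and bounds valid only almost everywhere
    share the same estimates. *)
Definition seen p A := [/\ \forall z \ae mu, A (P' p z),
  \forall z \ae mu, A (Q' p z) & \forall z \ae mu, A (r z)].

Lemma seenW p A : (forall x, A x) -> seen p A.
Proof. by move=> ?; split; exact: aeW. Qed.

Lemma seen_sub p A A' : (forall x, A x -> A' x) -> seen p A -> seen p A'.
Proof. by move=> AA' [a1 a2 a3]; split; [move: a1|move: a2|move: a3];
  apply: filterS => z; exact: AA'. Qed.

Let n0 p : 0 <= n p.
Proof. exact: le_trans (kin_m0 K p) (kin_mn_le K p). Qed.

Definition between M f x := 0 <= f x <= M * m x.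

Let between_norm M f x : between M f x -> `|f x| <= M * m x.
Proof. by case/andP => *; rewrite ger0_norm. Qed.

Let between_normn M f x : 0 <= M -> between M f x -> `|f x| <= M * n x.
Proof.
move=> M0 /between_norm /le_trans; apply.
by rewrite ler_wpM2l// (kin_mn_le K).
Qed.

Lemma gain_n_bound p f g al be : measurable_fun setT f ->
    measurable_fun setT g -> 0 <= al -> 0 <= be ->
    seen p (fun x => `|f x| <= al * n x) ->
    seen p (fun x => `|g x| <= be * n x) ->
  mu.-integrable setT
    (EFin \o (fun z => b p z * (f (P' p z) * g (Q' p z)))) /\
  `|gain f g p| <= al * be * (C * n p).
Proof.
move=> mf mg al0 be0 [fP _ _] [_ gQ _].
exact: (gain_bound (kin_mb K) (kin_mP K) (kin_mQ K) (kin_b0 K) mf mg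
  (kin_mn K) n0 al0 be0 (kin_gain_n K p)).
Qed.

Lemma gain_m_bound M p f : measurable_fun setT f -> 0 <= M ->
    seen p (between M f) ->
  mu.-integrable setT
    (EFin \o (fun z => b p z * (f (P' p z) * f (Q' p z)))) /\
  `|gain f f p| <= M * M * (C * m p).
Proof.
move=> mf M0 /(seen_sub (@between_norm M f)) [fP fQ _].
exact: (gain_bound (kin_mb K) (kin_mP K) (kin_mQ K) (kin_b0 K) mf mf
  (kin_mm K) (kin_m0 K) M0 M0 (kin_gain_m K p)).
Qed.

Lemma loss_n_bound p g be : measurable_fun setT g -> 0 <= be ->
    seen p (fun x => `|g x| <= be * n x) ->
  mu.-integrable setT (EFin \o (fun z => b p z * g (r z))) /\
  `|loss g p| <= be * (C * h p).
Proof.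
move=> mg be0 [_ _ gr].
exact: (loss_bound (kin_mb K) (kin_mr K) (kin_b0 K) mg (kin_mn K) n0 be0
  (kin_loss_n K p)).
Qed.

Lemma loss_m_bound M p g : measurable_fun setT g -> 0 <= M ->
    seen p (between M g) ->
  mu.-integrable setT (EFin \o (fun z => b p z * g (r z))) /\
  `|loss g p| <= M * (C * h p).
Proof.
move=> mg M0 sg; apply: loss_n_bound => //.
by apply: seen_sub sg => x; exact: between_normn.
Qed.

(** Polarization: the difference is the gain of (f - g, f) plus that of (g, f - g), and each is
    bounded with all factors measured in [n]. *)
Lemma gain_dist M D p f g : measurable_fun setT f -> measurable_fun setT g ->
    0 <= M -> 0 <= D -> seen p (between M f) -> seen p (between M g) ->
    seen p (fun x => `|f x - g x| <= D * n x) ->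
  `|gain f f p - gain g g p| <= 2 * M * D * (C * n p).
Proof.
move=> mf mg M0 D0.
move=> /(seen_sub (fun x => @between_normn M f x M0)) sf.
move=> /(seen_sub (fun x => @between_normn M g x M0)) sg sfg.
have mfg : measurable_fun setT (f \- g) by exact: measurable_funB.
have [iff _] := gain_n_bound mf mf M0 M0 sf sf.
have [igf _] := gain_n_bound mg mf M0 M0 sg sf.
have [igg _] := gain_n_bound mg mg M0 M0 sg sg.
have [_ e1] := gain_n_bound mfg mf D0 M0 sfg sf.
have [_ e2] := gain_n_bound mg mfg M0 D0 sg sfg.
rewrite gainBl// in e1; rewrite gainBr// in e2.
rewrite (_ : _ - _ = (gain f f p - gain g f p) + (gain g f p - gain g g p));
  last by ring.
rewrite (le_trans (ler_normD _ _))//.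
rewrite [leRHS](_ : _ = D * M * (C * n p) + M * D * (C * n p)); last by ring.
exact: lerD.
Qed.

Lemma loss_dist M D p f g : measurable_fun setT f -> measurable_fun setT g ->
    0 <= M -> 0 <= D -> seen p (between M f) -> seen p (between M g) ->
    seen p (fun x => `|f x - g x| <= D * n x) ->
  `|loss f p - loss g p| <= D * (C * h p).
Proof.
move=> mf mg M0 D0 sf sg sfg.
have mfg : measurable_fun setT (f \- g) by exact: measurable_funB.
have [i1 _] := loss_m_bound mf M0 sf.
have [i2 _] := loss_m_bound mg M0 sg.
by have [_] := loss_n_bound mfg D0 sfg; rewrite lossB.
Qed.

End CollisionEstimates.

(** * Existence by Picard iteration on the Duhamel map *)

Section Existence.
Context dX dZ (X : measurableType dX) (Z : measurableType dZ) (R : realType).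
Context (mu : {sigma_finite_measure set Z -> \bar R}).
Context (b : X -> Z -> R) (P' Q' : X -> Z -> X) (r : Z -> X).
Context (m n h : X -> R) (C : R).
Context (K : kinetic mu b P' Q' r m n h C).
Implicit Types (f g : X -> R) (p : X) (F : R -> X -> R) (s t D : R) (k : nat).

Local Notation gain := (gain mu b P' Q').
Local Notation loss := (loss mu b r).
Local Notation collide := (collide mu b P' Q' r).
Local Notation between := (between m).

Let m0 := kin_m0 K.
Let h0 := kin_h0 K.
Let n0 p : 0 <= n p.
Proof. exact: le_trans (m0 p) (kin_mn_le K p). Qed.

Lemma measurable_collide f : measurable_fun setT f -> (forall p, 0 <= f p) ->
  measurable_fun setT (collide f).
Proof.
move=> mf f0.
have mf2 : measurable_fun setT (fun x : X * X => f x.2).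
  exact: measurableT_comp.
have mid := @measurable_id _ X setT.
have mg := measurable_gain_integrand (kin_mb K) (kin_mP K) (kin_mQ K)
  (F := fun=> f) (G := fun=> f) (pr := id) mf2 mf2 mid.
have mL := measurable_loss_integrand (kin_mb K) (kin_mr K)
  (G := fun=> f) (pr := id) mf2 mid.
have b0 := kin_b0 K.
apply: measurable_funB.
  by apply: (measurable_Rintegral mu mg) => x; rewrite !mulr_ge0.
apply: measurable_funM => //.
by apply: (measurable_Rintegral mu mL) => x; rewrite !mulr_ge0.
Qed.

Context (T M : R) (f0 : X -> R).
Context (T0 : 0 <= T) (M0 : 0 <= M) (C1 : 1 <= C)
  (small : 6 * (T * M * C * C) <= 1)
  (mf0 : measurable_fun setT f0) (hf0 : forall p, 0 <= f0 p <= M / 2 * m p).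

Let C0 : 0 <= C. Proof. exact: le_trans C1. Qed.

(** Freezing the time outside [0, T] makes the iterates defined and bounded on the whole line, so
    that measurability and bounds carry no side condition on time. *)
Definition clamp t : R := Num.max 0 (Num.min t T).

Let clamp_itv t : 0 <= clamp t <= T.
Proof. by rewrite /clamp le_max lexx/= ge_max T0 ge_min lexx orbT. Qed.

Let clampE t : 0 <= t <= T -> clamp t = t.
Proof. by move=> /andP[t0 tT]; rewrite /clamp min_l// max_r. Qed.

Let clamp_lip s t : `|clamp t - clamp s| <= `|t - s|.
Proof.
have n1 : t - s <= `|t - s| by exact: ler_norm.
have n2 : s - t <= `|t - s| by rewrite distrC ler_norm.
rewrite ler_norml /clamp /Num.max /Num.min.
case: (ltP t T) => ?; case: (ltP s T) => ?; do 2 case: ltP => ?;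
  apply/andP; split; lra.
Qed.

Let measurable_clamp : measurable_fun setT (clamp : measurableTypeR R -> R).
Proof. by apply: measurable_maxr => //; exact: measurable_minr. Qed.

Definition mild F t p := duhamel (fun s => loss (F s) p)
  (fun s => gain (F s) (F s) p) (f0 p) (clamp t).

Let adm F := measurable_fun setT (fun x : measurableTypeR R * X => F x.1 x.2)
  /\ forall s p, between M (F s) p.

Let ga p : R := M * M * (C * m p).
Let lam p : R := M * (C * h p).

Section slices.
Context F (aF : adm F).

Let F0 s p : 0 <= F s p. Proof. by case/andP : (aF.2 s p). Qed.

Lemma adm_slice s : measurable_fun setT (F s).
Proof.
apply: (measurableT_comp aF.1 (g := fun p : X => (s : measurableTypeR R, p))).
exact: measurable_pair1.
Qed.

Let mgain_joint : measurable_fun setT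
  (fun x : measurableTypeR R * X => gain (F x.1) (F x.1) x.2).
Proof.
have mF : measurable_fun setT
    (fun x : (measurableTypeR R * X) * X => F x.1.1 x.2).
  apply: (measurableT_comp aF.1
    (g := fun x : (measurableTypeR R * X) * X => (x.1.1, x.2))).
  apply/measurable_fun_pair => //.
  by apply: (measurableT_comp (f := fst)).
have mg := measurable_gain_integrand (kin_mb K) (kin_mP K) (kin_mQ K)
  (F := fun x : measurableTypeR R * X => F x.1)
  (G := fun x : measurableTypeR R * X => F x.1) (pr := snd) mF mF
  (@measurable_snd _ _ _ _).
apply: (measurable_Rintegral mu mg) => x.
by rewrite !mulr_ge0// (kin_b0 K).
Qed.

Let mloss_joint : measurable_fun setT
  (fun x : measurableTypeR R * X => loss (F x.1) x.2).
Proof.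
have mF : measurable_fun setT
    (fun x : (measurableTypeR R * X) * X => F x.1.1 x.2).
  apply: (measurableT_comp aF.1
    (g := fun x : (measurableTypeR R * X) * X => (x.1.1, x.2))).
  apply/measurable_fun_pair => //.
  by apply: (measurableT_comp (f := fst)).
have mg := measurable_loss_integrand (kin_mb K) (kin_mr K)
  (G := fun x : measurableTypeR R * X => F x.1) (pr := snd) mF
  (@measurable_snd _ _ _ _).
apply: (measurable_Rintegral mu mg) => x.
by rewrite !mulr_ge0// (kin_b0 K).
Qed.

Lemma adm_gain_bound s p : 0 <= gain (F s) (F s) p <= ga p.
Proof.
rewrite (gain_ge0 _ _ _ (kin_b0 K))//=.
have [_] := gain_m_bound K (adm_slice s) M0 (seenW _ _ _ _ _ (aF.2 s)) (p := p).
exact: le_trans (ler_norm _).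
Qed.

Lemma adm_loss_bound s p : 0 <= loss (F s) p <= lam p.
Proof.
rewrite (loss_ge0 _ _ (kin_b0 K))//=.
have [_] := loss_m_bound K (adm_slice s) M0 (seenW _ _ _ _ _ (aF.2 s)) (p := p).
exact: le_trans (ler_norm _).
Qed.

Lemma measurable_adm_gain p : measurable_fun setT (fun s => gain (F s) (F s) p).
Proof.
apply: (measurableT_comp mgain_joint (g := fun s : measurableTypeR R => (s, p))).
exact: measurable_pair2.
Qed.

Lemma measurable_adm_loss p : measurable_fun setT (fun s => loss (F s) p).
Proof.
apply: (measurableT_comp mloss_joint (g := fun s : measurableTypeR R => (s, p))).
exact: measurable_pair2.
Qed.

(** The datum takes half of the bound M m; the source adds at most T M^2 C m, which smallness and 1
    <= C keep below the other half. *)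
Lemma adm_mild : adm (mild F).
Proof.
split; last first.
  move=> t p; have /andP[ct0 ctT] := clamp_itv t.
  have /andP[f00 f0M] := hf0 p.
  have mG := measurable_adm_gain p; have mL := measurable_adm_loss p.
  have bL s := adm_loss_bound s p; have bG s := adm_gain_bound s p.
  rewrite /between (duhamel_ge0 mL mG bL bG)//=.
  rewrite (le_trans (duhamel_le mL mG bL bG f00 ct0))//.
  have gp0 : 0 <= ga p by rewrite !mulr_ge0.
  have h1 : ga p * clamp t <= ga p * T by rewrite ler_wpM2l.
  rewrite [leRHS](_ : _ = M / 2 * m p + M / 2 * m p); last by field.
  apply: lerD => //; apply: le_trans h1 _.
  rewrite /ga (_ : _ * T = (T * M * C) * (M * m p)); last by ring.
  rewrite [leRHS](_ : _ = 2^-1 * (M * m p)); last by field.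
  rewrite ler_wpM2r ?mulr_ge0//.
  have : T * M * C <= T * M * C * C by rewrite ler_peMr// !mulr_ge0.
  by have := small; lra.
have mclamp2 : measurable_fun setT
    (fun x : measurableTypeR R * X => (clamp x.1 : measurableTypeR R, x.2)).
  by apply/measurable_fun_pair => //; exact: measurableT_comp.
have loss0 s p : 0 <= loss (F s) p by case/andP : (adm_loss_bound s p).
have mprim := measurable_prim mloss_joint loss0.
have mk : measurable_fun setT (fun x : measurableTypeR R * X =>
    expR (prim (fun s => loss (F s) x.2) x.1) * gain (F x.1) (F x.1) x.2).
  apply: measurable_funM => //.
  exact: measurableT_comp.
have k0 s p : 0 <= expR (prim (fun s => loss (F s) p) s) * gain (F s) (F s) p.
  by rewrite mulr_ge0 ?expR_ge0//; case/andP : (adm_gain_bound s p).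
have mprim2 := measurable_prim mk k0.
apply: measurable_funM.
  apply: measurableT_comp => //; apply: measurable_funN.
  exact: (measurableT_comp mprim mclamp2).
apply: measurable_funD; first exact: measurableT_comp.
exact: (measurableT_comp mprim2 mclamp2).
Qed.

End slices.

(** The perturbation of the damping grows like [h p], but it is always multiplied by the datum or by
    the gain, both of order [m], and m h <= C n brings it back to the weight [n]. *)
Let contraction F G D : adm F -> adm G -> 0 <= D ->
  (forall t p, `|F t p - G t p| <= D * n p) ->
  forall t p, `|mild F t p - mild G t p| <= D / 2 * n p.
Proof.
move=> aF aG D0 FG t p; have /andP[ct0 ctT] := clamp_itv t.
have /andP[f00 f0M] := hf0 p.
have := duhamel_dist (measurable_adm_loss aF p) (measurable_adm_loss aG p)
  (measurable_adm_gain aF p) (measurable_adm_gain aG p)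
  (fun s => adm_loss_bound aF s p) (fun s => adm_loss_bound aG s p)
  (fun s => adm_gain_bound aF s p) (fun s => adm_gain_bound aG s p)
  (dl := D * (C * h p)) (dg := 2 * M * D * (C * n p)) _ _ f00 ct0.
set lhs := `|_|; move=> H; apply: le_trans (H _ _) _.
- move=> s; apply: (loss_dist K (adm_slice aF s) (adm_slice aG s) M0 D0);
    apply: seenW; [exact: aF.2 s|exact: aG.2 s|exact: FG s].
- move=> s; apply: (gain_dist K (adm_slice aF s) (adm_slice aG s) M0 D0);
    apply: seenW; [exact: aF.2 s|exact: aG.2 s|exact: FG s].
set c := clamp t in ct0 ctT *.
have mh := kin_mh K p; have np0 := n0 p; have mp0 := m0 p; have hp0 := h0 p.
have e1 : f0 p * (D * (C * h p)) <= M / 2 * D * C * (C * n p).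
  apply: (@le_trans _ _ (M / 2 * m p * (D * (C * h p)))).
    by rewrite ler_wpM2r// !mulr_ge0.
  rewrite (_ : _ * _ = M / 2 * D * C * (m p * h p)); last by ring.
  by rewrite ler_wpM2l// !mulr_ge0.
have e2 : ga p * (D * (C * h p)) * c <= T * (M * M * C) * D * C * (C * n p).
  apply: (@le_trans _ _ (ga p * (D * (C * h p)) * T)).
    by rewrite ler_wpM2l// !mulr_ge0.
  rewrite (_ : _ * T = T * (M * M * C) * D * C * (m p * h p));
    last by rewrite /ga; ring.
  by rewrite ler_wpM2l// !mulr_ge0.
apply: (@le_trans _ _ ((M / 2 * D * C * (C * n p) + 2 * M * D * (C * n p) +
    T * (M * M * C) * D * C * (C * n p)) * T)).
  apply: ler_pM => //.
  - by rewrite !addr_ge0// !mulr_ge0// !mulr_ge0.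
  - by apply: lerD => //; apply: lerD.
rewrite [leLHS](_ : _ = (D * n p) * ((T * M * C * C) / 2 + 2 * (T * M * C) +
    (T * M * C) * (T * M * C * C))); last by field.
rewrite [leRHS](_ : _ = (D * n p) * 2^-1); last by ring.
(* Since x <= x C <= 1/6, the three terms are at most 1/12, 1/3 and 1/36, with sum 4/9 < 1/2. *)
set x := T * M * C; have x0 : 0 <= x by rewrite !mulr_ge0.
have xC : x <= x * C by rewrite ler_peMr.
have x6 : x <= 6^-1 by have := small; rewrite /x in xC *; lra.
rewrite ler_wpM2l ?mulr_ge0//.
have : x * (x * C) <= 6^-1 * (x * C) by rewrite ler_wpM2r// mulr_ge0.
by have := small; rewrite /x in xC *; lra.
Qed.

Definition picard k : R -> X -> R := iter k mild (fun _ _ => 0).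

Let adm_picard k : adm (picard k).
Proof.
elim: k => [|k ih]; last exact: adm_mild.
split => [|s p]; first exact: measurable_cst.
by rewrite /between lexx mulr_ge0.
Qed.

Let picard_step k t p : `|picard k.+1 t p - picard k t p| <= M / 2 ^+ k * n p.
Proof.
elim: k t p => [|k ih] t p.
  rewrite expr0 divr1 subr0.
  have /andP[a0 aM] := (adm_picard 1).2 t p.
  by rewrite ger0_norm// (le_trans aM)// ler_wpM2l// (kin_mn_le K).
have := contraction (adm_picard k.+1) (adm_picard k) _ ih.
move=> /(_ _ t p); rewrite exprSr invfM mulrA; apply.
by rewrite divr_ge0// exprn_ge0.
Qed.

Definition solution t p : R := limn (fun k => picard k t p).

(** Successive iterates differ by at most M n / 2^k, so all later steps together are at most 2 M n /
    2^k. Adding this tail gives a nonincreasing sequence and subtracting it a nondecreasing one: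
    convergence and its rate follow from monotonicity. *)
Let up t p k := picard k t p + 2 * M / 2 ^+ k * n p.
Let dn t p k := picard k t p - 2 * M / 2 ^+ k * n p.

Let halve p k : 2 * M / 2 ^+ k * n p = 2 * M / 2 ^+ k.+1 * n p + M / 2 ^+ k * n p.
Proof. by rewrite exprS invfM; field; rewrite expf_neq0. Qed.

Let up_noninc t p : nonincreasing_seq (up t p).
Proof.
apply/nonincreasing_seqP => k; rewrite /up (halve p k).
by have := picard_step k t p; rewrite ler_norml => /andP[_ ?]; lra.
Qed.

Let dn_nondec t p : nondecreasing_seq (dn t p).
Proof.
apply/nondecreasing_seqP => k; rewrite /dn (halve p k).
by have := picard_step k t p; rewrite ler_norml => /andP[? _]; lra.
Qed.

Let tail_cvg0 p : (fun k => 2 * M / 2 ^+ k * n p) @ \oo --> (0 : R).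
Proof.
have : geometric (2 * M * n p) (2^-1 : R) @ \oo --> (0 : R).
  by apply: cvg_geometric; rewrite ger0_norm// invf_lt1 ?ltr1n.
apply: cvg_trans; apply: near_eq_cvg; near=> k.
by rewrite /geometric/= exprVn mulrAC.
Unshelve. all: by end_near. Qed.

Let up_cvg t p : cvgn (up t p).
Proof.
apply: nonincreasing_is_cvgn => //.
exists 0 => _ [k _ <-]; rewrite /up addr_ge0 ?mulr_ge0 ?invr_ge0 ?exprn_ge0//.
by case/andP : ((adm_picard k).2 t p).
Qed.

Let picard_cvg t p : (fun k => picard k t p) @ \oo --> solution t p.
Proof.
have e : (fun k => picard k t p) =
    (fun k => up t p k - 2 * M / 2 ^+ k * n p) by apply/funext => k; rewrite /up addrK.
have H : (fun k => picard k t p) @ \oo --> limn (up t p) - 0.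
  by rewrite e; apply: cvgB; [exact: up_cvg|exact: tail_cvg0].
exact: cvgP H.
Qed.

Let up_cvg_sol t p : up t p @ \oo --> solution t p.
Proof. by rewrite -[solution t p]addr0; exact: cvgD (@picard_cvg t p) (@tail_cvg0 p). Qed.

Let dn_cvg_sol t p : dn t p @ \oo --> solution t p.
Proof. by rewrite -[solution t p]subr0; exact: cvgB (@picard_cvg t p) (@tail_cvg0 p). Qed.

Let solution_dist k t p : `|solution t p - picard k t p| <= 2 * M / 2 ^+ k * n p.
Proof.
have h1 : solution t p <= up t p k.
  rewrite -(cvg_lim (@Rhausdorff R) (@up_cvg_sol t p)).
  by apply: nonincreasing_cvgn_ge => //; exact: up_cvg.
have h2 : dn t p k <= solution t p.
  rewrite -(cvg_lim (@Rhausdorff R) (@dn_cvg_sol t p)).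
  apply: nondecreasing_cvgn_le => //.
  by apply/cvg_ex; exists (solution t p); exact: dn_cvg_sol.
by rewrite /up /dn in h1 h2; rewrite ler_norml; apply/andP; split; lra.
Qed.

Let adm_solution : adm solution.
Proof.
split.
  apply: (measurable_fun_cvg (h := fun k (x : measurableTypeR R * X) => picard k x.1 x.2)).
    by move=> k; exact: (adm_picard k).1.
  by move=> x _; exact: picard_cvg.
move=> s p; apply/andP; split.
  apply: limr_ge; first by apply/cvg_ex; exists (solution s p); exact: picard_cvg.
  by near=> k; case/andP : ((adm_picard k).2 s p).
apply: limr_le; first by apply/cvg_ex; exists (solution s p); exact: picard_cvg.
by near=> k; case/andP : ((adm_picard k).2 s p).
Unshelve. all: by end_near. Qed.

Let solution_fix t p : mild solution t p = solution t p.
Proof.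
apply/eqP; rewrite -subr_eq0 -normr_le0.
(* Both sides are compared with iterate k + 1: the contraction gives half of the distance to iterate
   k for the first, and the rate of convergence gives the same amount for the second. *)
have H k : `|mild solution t p - solution t p| <= 2 * M / 2 ^+ k * n p.
  have split3 (x y z : R) : x - y = (x - z) - (y - z) by ring.
  rewrite (split3 _ _ (mild (picard k) t p)) -[X in _ - (_ - X)]/(picard k.+1 t p).
  rewrite (le_trans (ler_normB _ _))//.
  rewrite [leRHS](_ : _ = 2 * M / 2 ^+ k / 2 * n p + 2 * M / 2 ^+ k.+1 * n p).
    apply: lerD; last exact: solution_dist.
    apply: (contraction adm_solution (adm_picard k)).
      by rewrite !mulr_ge0// invr_ge0 exprn_ge0.
    by move=> *; exact: solution_dist.
  by rewrite exprS invfM; field; rewrite expf_neq0.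
rewrite -(cvg_lim (@Rhausdorff R) (@tail_cvg0 p)).
apply: limr_ge; first by apply/cvg_ex; exists 0; exact: tail_cvg0.
by near=> k; exact: H.
Unshelve. all: by end_near. Qed.

Let F_between t p : between M (solution t) p.
Proof. exact: adm_solution.2. Qed.

Let mF t : measurable_fun setT (solution t).
Proof. exact: adm_slice adm_solution t. Qed.

(** Bounds the speed of the solution in the weight [n]: the loss is at most M m M C h <= M^2 C^2 n,
    and the gain at most M^2 C m <= M^2 C^2 n. *)
Let L := 2 * M * M * C * C.

Let L0 : 0 <= L. Proof. by rewrite !mulr_ge0. Qed.

Let mC p : m p * C <= C * n p.
Proof. by rewrite mulrC ler_wpM2l// (kin_mn_le K). Qed.

Let solution_lip s t p : `|solution t p - solution s p| <= L * n p * `|t - s|.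
Proof.
wlog st : s t / s <= t.
  move=> H; case: (leP s t) => [|/ltW] st; first exact: H.
  by rewrite distrC (distrC t); exact: H.
have /andP[f00 f0M] := hf0 p.
have aF := adm_solution.
have cst : 0 <= clamp s <= clamp t.
  have /andP[-> _]/= := clamp_itv s.
  by rewrite /clamp /Num.max /Num.min; case: (ltP t T) => ?;
    case: (ltP s T) => ?; do 2 case: ltP => ?; have := T0; lra.
have := duhamel_lip (measurable_adm_loss aF p) (measurable_adm_gain aF p)
  (fun s => adm_loss_bound aF s p) (fun s => adm_gain_bound aF s p) f00 cst
  (M := M * m p).
rewrite -/(mild solution s p) -/(mild solution t p) !solution_fix.
have /andP[_ sM] := F_between s p.
move=> /(_ sM) /le_trans; apply.
apply: ler_pM.
- by rewrite addr_ge0// !mulr_ge0.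
- by case/andP : cst => _; rewrite subr_ge0.
- have mh := kin_mh K p.
  rewrite /lam /ga (_ : _ + _ = M * M * C * (m p * h p) + M * M * (m p * C));
    last by ring.
  rewrite (_ : L * n p = M * M * C * (C * n p) + M * M * C * (C * n p));
    last by rewrite /L; ring.
  apply: lerD; first by rewrite ler_wpM2l// !mulr_ge0.
  rewrite -[leRHS]mulrA ler_wpM2l ?mulr_ge0//.
  rewrite (le_trans (mC p))// -[leLHS]mul1r ler_wpM2r// mulr_ge0//.
- exact: le_trans (ler_norm _) (clamp_lip s t).
Qed.

Let gain_lip s t p :
  `|gain (solution t) (solution t) p - gain (solution s) (solution s) p| <=
  2 * M * (L * `|t - s|) * (C * n p).
Proof.
apply: (gain_dist K (mF t) (mF s) M0 _) => //; first by rewrite mulr_ge0.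
- by apply: seenW => x; exact: F_between.
- by apply: seenW => x; exact: F_between.
- by apply: seenW => x; rewrite mulrAC; exact: solution_lip.
Qed.

Let loss_lip s t p :
  `|loss (solution t) p - loss (solution s) p| <= L * `|t - s| * (C * h p).
Proof.
apply: (loss_dist K (mF t) (mF s) M0 _) => //; first by rewrite mulr_ge0.
- by apply: seenW => x; exact: F_between.
- by apply: seenW => x; exact: F_between.
- by apply: seenW => x; rewrite mulrAC; exact: solution_lip.
Qed.

Let lip_continuous (u : R -> R) B t : (forall s, `|u t - u s| <= B * `|t - s|) ->
  {for t, continuous u}.
Proof.
move=> uB; apply/cvgrPdist_le => e e0.
have B1 : 0 < `|B| + 1 by rewrite ltr_wpDl.
near=> s; apply: (le_trans (uB s)).
apply: (@le_trans _ _ ((`|B| + 1) * `|t - s|)).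
  by rewrite ler_wpM2r// (le_trans (ler_norm _))// lerDl.
rewrite mulrC -ler_pdivlMr//; near: s.
by apply: cvgr_dist_le => //; rewrite divr_gt0.
Unshelve. all: by end_near. Qed.

Let solution_derive t p : 0 < t < T ->
  is_derive t 1 (solution ^~ p) (collide (solution t) p).
Proof.
move=> /andP[t0 tT]; have aF := adm_solution.
have /andP[f00 _] := hf0 p.
have cl : {for t, continuous (fun s => loss (solution s) p)}.
  apply: (@lip_continuous _ (L * (C * h p))) => s.
  by rewrite mulrAC; exact: loss_lip.
have cg : {for t, continuous (fun s => gain (solution s) (solution s) p)}.
  apply: (@lip_continuous _ (2 * M * L * (C * n p))) => s.
  by rewrite mulrAC -[_ * L * _]mulrA; exact: gain_lip.
have := duhamel_derive (measurable_adm_loss aF p) (measurable_adm_gain aF p)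
  (fun s => adm_loss_bound aF s p) (fun s => adm_gain_bound aF s p)
  (f0 p) t0 cl cg.
have clt : clamp t = t by apply: clampE; rewrite !ltW.
set D := duhamel _ _ _; have -> : D t = solution t p.
  by rewrite -solution_fix /mild clt.
rewrite [_ * solution t p]mulrC; apply: near_eq_is_derive => //.
near=> s; rewrite -solution_fix /mild clampE//; apply/andP; split; apply: ltW;
  near: s; [exact: lt_nbhsr|exact: lt_nbhsl].
Unshelve. all: by end_near. Qed.

(** The factor 1 + h comes from the loss term, where a difference of size [n] meets a frequency of
    size [h]. *)
Let collide_lip s t p :
  `|collide (solution t) p - collide (solution s) p| <=
  2 * M * C * L * (n p * (1 + h p)) * `|t - s|.
Proof.
have /andP[F0 FM] := F_between s p.
have aF := adm_solution.
have /andP[l0 lM] := adm_loss_bound aF t p.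
rewrite /collide.
set g1 := gain _ _ _; set g2 := gain _ _ _.
set l1 := loss (solution t) p in l0 lM *; set l2 := loss (solution s) p.
rewrite (_ : _ - _ = (g1 - g2) - (solution t p - solution s p) * l1
  - solution s p * (l1 - l2)); last by ring.
rewrite (le_trans (ler_normB _ _))//.
rewrite [leRHS](_ : _ = 2 * M * (L * `|t - s|) * (C * n p) +
  (L * n p * `|t - s|) * (M * (C * h p)) +
  (M * n p) * (L * `|t - s| * (C * h p))); last by ring.
apply: lerD; last first.
  rewrite normrM; apply: ler_pM => //; last exact: loss_lip.
  rewrite ger0_norm// (le_trans FM)// ler_wpM2l//; exact: (kin_mn_le K).
rewrite (le_trans (ler_normB _ _))//; apply: lerD; first exact: gain_lip.
rewrite normrM; apply: ler_pM => //.
by rewrite ger0_norm.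
Qed.

Let collide_bound t p : `|collide (solution t) p| <= L * n p.
Proof.
have aF := adm_solution.
have /andP[F0 FM] := F_between t p.
have /andP[g0 gM] := adm_gain_bound aF t p.
have /andP[l0 lM] := adm_loss_bound aF t p.
have mh := kin_mh K p.
rewrite /collide (le_trans (ler_normB _ _))// ger0_norm// ger0_norm ?mulr_ge0//.
rewrite (_ : L * n p = M * M * C * (C * n p) + M * M * C * (C * n p));
  last by rewrite /L; ring.
apply: lerD; last first.
  apply: (@le_trans _ _ (M * m p * (M * (C * h p)))); first exact: ler_pM.
  rewrite (_ : _ * _ = M * M * C * (m p * h p)); last by ring.
  by rewrite ler_wpM2l// !mulr_ge0.
apply: (le_trans gM); rewrite /ga -[leRHS]mulrA ler_wpM2l ?mulr_ge0//.
rewrite mulrC (le_trans (mC p))// -[leLHS]mul1r ler_wpM2r// mulr_ge0//.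
Qed.

Lemma kinetic_existence : exists (F : R -> X -> R) (B : R),
  [/\ 0 <= B /\ (forall p, F 0 p = f0 p),
      forall t, measurable_fun setT (F t) /\ forall p, between M (F t) p,
      forall t p, 0 < t < T -> is_derive t 1 (F ^~ p) (collide (F t) p),
      forall s t p, `|F t p - F s p| <= B * n p * `|t - s| &
      (forall t p, `|collide (F t) p| <= B * n p) /\
      (forall s t p, `|collide (F t) p - collide (F s) p| <=
        B * (n p * (1 + h p)) * `|t - s|)].
Proof.
exists solution, (L + 2 * M * C * L); have ? : 0 <= 2 * M * C * L.
  by rewrite !mulr_ge0.
have ? : L <= L + 2 * M * C * L by rewrite lerDl.
have ? : 2 * M * C * L <= L + 2 * M * C * L by rewrite lerDr.
split.
- split=> [|p]; first by rewrite addr_ge0.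
  rewrite -solution_fix /mild clampE ?lexx ?T0//.
  by rewrite /duhamel !prim0 oppr0 expR0 mul1r addr0.
- by move=> t; split => // p.
- exact: solution_derive.
- move=> s t p; apply: (le_trans (solution_lip s t p)).
  by rewrite ler_wpM2r// ler_wpM2r.
- split=> [t p|s t p].
    by apply: (le_trans (collide_bound t p)); rewrite ler_wpM2r.
  apply: (le_trans (collide_lip s t p)).
  by rewrite -![_ * _ * `|_|]mulrA ler_wpM2r// !mulr_ge0// addr_ge0.
Qed.

End Existence.

(** * Null sets and lower Lipschitz maps *)

Section Boxes.
Context (R : realType).
Implicit Types (x y z : vec3 R) (U V A : set (vec3 R)) (e : R).

Definition box x e : set (vec3 R) := (`]x.1.1 - e, x.1.1 + e[ `*`
  `]x.1.2 - e, x.1.2 + e[) `*` `]x.2 - e, x.2 + e[.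

Lemma boxP x e y : box x e y <-> [/\ `|y.1.1 - x.1.1| < e,
  `|y.1.2 - x.1.2| < e & `|y.2 - x.2| < e].
Proof.
rewrite /box /=; rewrite !in_itv/=.
have E (u v : R) : (v - e < u < v + e) = (`|u - v| < e).
  by rewrite ltr_norml; apply/andP/andP => -[? ?]; split; lra.
by rewrite !E; split=> [[[? ?] ?]|[? ? ?]].
Qed.

Lemma box_sym x y e : box x e y -> box y e x.
Proof. by move=> /boxP[? ? ?]; apply/boxP; split; rewrite distrC. Qed.

Lemma box_trans x y z e e' : box x e y -> box y e' z -> box x (e + e') z.
Proof.
move=> /boxP[a1 a2 a3] /boxP[b1 b2 b3]; apply/boxP.
have T (u v w : R) : `|v - u| < e -> `|w - v| < e' -> `|w - u| < e + e'.
  move=> uv vw; rewrite (_ : w - u = (v - u) + (w - v)); last by ring.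
  by rewrite (le_lt_trans (ler_normD _ _))// ltrD.
by split; [exact: T a1 b1|exact: T a2 b2|exact: T a3 b3].
Qed.

Lemma sub_box x e e' : e <= e' -> box x e `<=` box x e'.
Proof. by move=> ee' y /boxP[? ? ?]; apply/boxP; split; exact: lt_le_trans ee'. Qed.

Lemma measurable_box x e : measurable (box x e).
Proof. by apply: measurableX => //; exact: measurableX. Qed.

Lemma leb3_box x e : 0 < e -> leb3 (box x e) = ((2 * e) ^+ 3)%:E.
Proof.
move=> e0; rewrite /leb3 product_measure1E//; last exact: measurableX.
rewrite [X in (X * _)%E]product_measure1E//= !lebesgue_measure_itv/= !lte_fin.
have E (u : R) : u - e < u + e by lra.
by rewrite !E -!EFinB -!EFinM; congr EFin; ring.
Qed.

(** Measurability is part of the notion, so that it passes to countable unions without appeal to a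
    countable base of boxes. *)
Definition bopen U := measurable U /\
  forall x, U x -> exists2 e, 0 < e & box x e `<=` U.

Lemma bopenT : bopen setT.
Proof. by split => // x _; exists 1. Qed.

Lemma bopenI U V : bopen U -> bopen V -> bopen (U `&` V).
Proof.
move=> [mU oU] [mV oV]; split; first exact: measurableI.
move=> x [/oU[e e0 eU] /oV[e' e'0 eV]]; exists (Num.min e e').
  by rewrite lt_min e0.
by move=> y xy; split; [apply: eU|apply: eV];
  apply: sub_box xy; rewrite ge_min lexx ?orbT.
Qed.

Lemma bopen_bigcup (U : (set (vec3 R))^nat) : (forall k, bopen (U k)) ->
  bopen (\bigcup_k U k).
Proof.
move=> oU; split; first by apply: bigcupT_measurable => k; exact: (oU k).1.
by move=> x [k _ /(oU k).2[e e0 eU]]; exists e => // y /eU ?; exists k.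
Qed.

Lemma bopen_bigcap (U : (set (vec3 R))^nat) k : (forall k, bopen (U k)) ->
  bopen (\bigcap_(i < k) U i).
Proof.
move=> oU; elim: k => [|k ih]; first by rewrite bigcap_mkord big_ord0; exact: bopenT.
rewrite bigcap_mkord big_ord_recr/= -bigcap_mkord; exact: bopenI.
Qed.

Definition box_lip (f : vec3 R -> R) := forall x y e, box x e y -> `|f y - f x| < e.

Lemma bopen_gt (f : vec3 R -> R) c : measurable_fun setT f -> box_lip f ->
  bopen [set x | c < f x].
Proof.
move=> mf lf; split.
  rewrite (_ : [set _ | _] = setT `&` f @^-1` [set` `]c, +oo[]); first exact: mf.
  by apply/seteqP; split => x /=; rewrite in_itv/= andbT//; case.
move=> x /= cx; exists (f x - c); first by rewrite subr_gt0.
by move=> y /lf /=; rewrite ltr_norml => /andP[+ _]; lra.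
Qed.

Lemma bopen_lt (f : vec3 R -> R) c : measurable_fun setT f -> box_lip f ->
  bopen [set x | f x < c].
Proof.
move=> mf lf; rewrite (_ : [set _ | _] = [set x | - c < (\- f) x]).
  apply: bopen_gt; first exact: measurable_funN.
  by move=> x y e /lf; rewrite /= -opprD normrN.
by apply/seteqP; split => x /=; rewrite ltrN2.
Qed.

Section regularity.
Variable pi : {finite_measure set (vec3 R) -> \bar R}.

(** Outer regularity of [A] and of its complement at once: open covers of the two overlap in small
    measure. The symmetric form makes stability under complement immediate. *)
Definition regular A := forall e, 0 < e -> exists U V,
  [/\ bopen U, bopen V, A `<=` U, ~` A `<=` V & (pi (U `&` V) <= e%:E)%E].

Lemma exhaustion (F : (set (vec3 R))^nat) A e : (forall k, measurable (F k)) ->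
    nondecreasing_seq F -> A = \bigcup_k F k -> 0 < e ->
  exists k, (pi (A `\` F k) <= e%:E)%E.
Proof.
move=> mF ndF AE e0.
have mA : measurable A by rewrite AE; exact: bigcupT_measurable.
have cF : pi (F k) @[k --> \oo] --> pi A.
  by rewrite AE; apply: nondecreasing_cvg_mu => //; rewrite -AE.
have fA : pi A \is a fin_num by exact: fin_num_measure.
have := cvgeB _ (cvg_cst (pi A)) cF.
rewrite subee// => /(_ _) H.
have {H} : (fun k => pi A - pi (F k))%E @ \oo --> 0%E.
  by apply: H; rewrite fin_num_adde_defr.
move=> /fine_cvgP[_ /cvgrPdist_le /(_ e e0)[k _ /(_ k (leqnn k))]].
rewrite /= sub0r normrN => ke; exists k.
rewrite measureD//; last by rewrite ltey_eq fA.
rewrite setIidr; last by rewrite AE; exact: bigcup_sup.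
rewrite -[leLHS]fineK ?lee_fin; last first.
  by rewrite fin_numB fA fin_num_measure.
exact: le_trans (ler_norm _) ke.
Qed.

(** The countable union is the real case. Its complement would be covered by an infinite
    intersection of open sets, which may fail to be open; only the first k are intersected, with k
    so large that the open cover of the union gains at most e/2 beyond them. The overlaps themselves
    contribute e/2 through a geometric series. *)
Lemma sigma_algebra_regular : sigma_algebra setT regular.
Proof.
split.
- move=> e e0; exists set0, setT; split => //.
  + exact: bopenT.
  + by rewrite set0I measure0 lee_fin ltW.
- move=> A rA e /rA[U [V [oU oV AU AV UVe]]]; exists V, U; split => //.
  + by rewrite setTD.
  + by rewrite setTD setCK.
  + by rewrite setIC.
- move=> A rA e e0.
  have e2 k : 0 < e / 2 / (2 ^ k.+1)%:R by rewrite !divr_gt0// ltr0n expn_gt0.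
  have /choice[UV H] : forall k, exists UV : set (vec3 R) * set (vec3 R),
      [/\ bopen UV.1, bopen UV.2, A k `<=` UV.1, ~` A k `<=` UV.2 &
        (pi (UV.1 `&` UV.2) <= (e / 2 / (2 ^ k.+1)%:R)%:E)%E].
    by move=> k; have [U [V ?]] := rA k _ (e2 k); exists (U, V).
  have oU k : bopen (UV k).1 by case: (H k).
  have oV k : bopen (UV k).2 by case: (H k).
  pose U := \bigcup_k (UV k).1.
  pose F k := \bigcup_(i < k) (UV i).1.
  have mF k : measurable (F k) by apply: bigcup_measurable => i _; exact: (oU i).1.
  have ndF : nondecreasing_seq F.
    move=> i j ij; apply/subsetPset => x [l /= li Ul]; exists l => //=.
    exact: leq_trans li ij.
  have UF : U = \bigcup_k F k.
    apply/seteqP; split => [x [k _ Uk]|x [k _ [l _ Ul]]]; last by exists l.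
    by exists k.+1 => //; exists k => /=.
  have [|k ke] := exhaustion mF ndF UF (e := e / 2); first by rewrite divr_gt0.
  exists U, (\bigcap_(i < k) (UV i).2); split.
  + exact: bopen_bigcup.
  + exact: bopen_bigcap.
  + by move=> x [i _ Ai]; exists i => //; case: (H i) => _ _ + _ _; apply.
  + move=> x nA i _; case: (H i) => _ _ _ + _; apply => Ai; apply: nA.
    by exists i.
  set W := \bigcap_(i < k) _.
  have mW : measurable W by exact: (bopen_bigcap k oV).1.
  have mU : measurable U by exact: (bopen_bigcup oU).1.
  have mI i : measurable ((UV i).1 `&` (UV i).2).
    by apply: measurableI; [exact: (oU i).1|exact: (oV i).1].
  have mB : measurable (\bigcup_i ((UV i).1 `&` (UV i).2)).
    exact: bigcupT_measurable.
  apply: (@le_trans _ _ (pi ((U `\` F k) `|` \bigcup_i ((UV i).1 `&` (UV i).2)))).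
    apply: le_measure; rewrite ?inE.
    - exact: measurableI.
    - by apply: measurableU => //; exact: measurableD.
    - move=> x [Ux Wx]; have [[i ik Ui]|nF] := pselect (F k x); last by left.
      by right; exists i => //; split => //; exact: Wx.
  rewrite (le_trans (measureU2 _ _ _))//; first exact: measurableD.
  rewrite [e in leRHS](splitr e) EFinD leeD//.
  have := measure_sigma_subadditive pi mI mB (@subset_refl _ _).
  move=> /le_trans; apply.
  apply: (@le_trans _ _ (\sum_(i <oo) (e / 2 / (2 ^ i.+1)%:R)%:E)%E).
    by apply: lee_nneseries => // i _; case: (H i).
  by apply: epsilon_trick0; rewrite divr_ge0// ltW.
Qed.

(** The set is already open, and its complement lies in the open set f < c + 1/(k+1). The overlap c
    < f < c + 1/(k+1) shrinks to the empty set as k grows. *)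
Lemma regular_gt (f : vec3 R -> R) c : measurable_fun setT f -> box_lip f ->
  regular [set x | c < f x].
Proof.
move=> mf lf e e0.
pose F k := [set x | 0 <= f x - (c + k.+1%:R^-1)].
have mF k : measurable (F k).
  by apply: measurable_set_ge0; exact: measurable_funB.
have ndF : nondecreasing_seq F.
  move=> i j ij; apply/subsetPset => x; rewrite /F/=.
  have : j.+1%:R^-1 <= i.+1%:R^-1 :> R by rewrite lef_pV2 ?posrE// ler_nat.
  by move: (j.+1%:R^-1) (i.+1%:R^-1) => ? ? ?; lra.
have AF : [set x | c < f x] = \bigcup_k F k.
  apply/seteqP; split => [x /= cx|x [k _]]; last first.
    have : 0 < k.+1%:R^-1 :> R by rewrite invr_gt0.
    by rewrite /F/=; move: k.+1%:R^-1 => ? ?; lra.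
  have d0 : 0 < f x - c by lra.
  have [k _ /(_ k (leqnn k))/=] := near_infty_natSinv_lt (PosNum d0).
  move=> H; exists k => //; rewrite /F/=; move: H.
  by move: k.+1%:R^-1 => ? ?; lra.
have [k ke] := exhaustion mF ndF AF e0.
exists [set x | c < f x], [set x | f x < c + k.+1%:R^-1]; split.
- exact: bopen_gt.
- exact: bopen_lt.
- by [].
- move=> x /= /negP; rewrite -leNgt => xc.
  have : 0 < k.+1%:R^-1 :> R by rewrite invr_gt0.
  by move: k.+1%:R^-1 => ? ?; lra.
apply: le_trans ke; rewrite le_eqVlt; apply/orP; left; apply/eqP.
congr (pi _); apply/seteqP; split => x /=; rewrite /F/=.
  by move: k.+1%:R^-1 => v [? ?]; split => //; apply/negP; rewrite -ltNge; lra.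
by move: k.+1%:R^-1 => v [? /negP]; rewrite -ltNge => ?; split => //; lra.
Qed.

Lemma measurable_regular A : measurable A -> regular A.
Proof.
(* The space is given the sigma-algebra of regular sets. Its coordinates are measurable for it,
   hence so is the identity towards the product Borel structure, which is the claim. *)
pose T' := g_sigma_algebraType regular.
have mr (f : vec3 R -> R) : measurable_fun setT f -> box_lip f ->
    measurable_fun (setT : set T') (f : T' -> measurableTypeR R).
  move=> mf lf; apply: (measurability _ (RGenOInfty.measurableE R)).
  move=> _ [_ [c ->] <-]; rewrite setTI.
  apply: sub_sigma_algebra; rewrite (_ : _ @^-1` _ = [set x | c < f x]).
    exact: regular_gt.
  by apply/seteqP; split => x /=; rewrite in_itv/= andbT.
have mid : measurable_fun (setT : set T') (id : T' -> vec3 R).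
  rewrite (_ : id = fun x : T' => ((x.1.1, x.1.2), x.2)); last first.
    by apply/funext => -[[]].
  apply/measurable_fun_pair; first apply/measurable_fun_pair.
  - apply: (mr (fun x => x.1.1)); last by move=> x y e /boxP[].
    exact: (measurableT_comp (f := fst)).
  - apply: (mr (fun x => x.1.2)); last by move=> x y e /boxP[].
    exact: (measurableT_comp (f := snd)).
  - by apply: (mr (fun x => x.2)); [exact: measurable_snd|move=> x y e /boxP[]].
move=> mA; have := mid measurableT A mA; rewrite setTI preimage_id.
by rewrite /measurable/= sigma_algebra_id//; exact: sigma_algebra_regular.
Qed.

End regularity.
End Boxes.

(** * Null sets under maps that do not contract distances by more than a fixed factor *)

Section LowerLipschitz.
Context (R : realType).
Implicit Types (x y z : vec3 R) (U N E : set (vec3 R)) (e : R).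

Lemma bopen_box0 e : bopen (box (0 : vec3 R) e).
Proof.
have lip (f : vec3 R -> R) : box_lip f -> box_lip (fun x => `|f x|).
  by move=> lf x y d /lf; apply: le_lt_trans; exact: ler_dist_dist.
have b (f : vec3 R -> R) : measurable_fun setT f -> box_lip f ->
    bopen [set x | `|f x| < e].
  by move=> mf lf; apply: bopen_lt; [exact: measurableT_comp|exact: lip].
rewrite (_ : box 0 e = [set x | `|x.1.1| < e] `&` [set x | `|x.1.2| < e] `&`
    [set x | `|x.2| < e]).
  apply: bopenI; first apply: bopenI; apply: b.
  - exact: (measurableT_comp (f := fst)).
  - by move=> x y d /boxP[].
  - exact: (measurableT_comp (f := snd)).
  - by move=> x y d /boxP[].
  - exact: measurable_snd.
  - by move=> x y d /boxP[].
apply/seteqP; split=> x; first by move=> /boxP[]; rewrite /= !subr0.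
by move=> /= [[? ?] ?]; apply/boxP; rewrite !subr0.
Qed.

Lemma measurable_preimageT d d' (T : measurableType d) (T' : measurableType d')
    (f : T -> T') (B : set T') :
  measurable_fun setT f -> measurable B -> measurable (f @^-1` B).
Proof. by move=> mf mB; rewrite -[X in measurable X]setTI; exact: mf. Qed.

Lemma measurable_set_lt d (T : measurableType d) (f g : T -> R) :
  measurable_fun setT f -> measurable_fun setT g ->
  measurable [set x | f x < g x].
Proof.
move=> mf mg; rewrite (_ : [set _ | _] = ~` [set x | 0 <= f x - g x]).
  by apply: measurableC; apply: measurable_set_ge0; exact: measurable_funB.
apply/seteqP; split => x /=; first by move=> ?; apply/negP; rewrite -ltNge; lra.
by move/negP; rewrite -ltNge; lra.
Qed.

Lemma measurable_box_rel d (T : measurableType d) (F G : T -> vec3 R) e :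
    measurable_fun setT F -> measurable_fun setT G ->
  measurable [set t | box (F t) e (G t)].
Proof.
move=> /measurable_fun_pairP[/measurable_fun_pairP[m1 m2] m3].
move=> /measurable_fun_pairP[/measurable_fun_pairP[n1 n2] n3].
rewrite (_ : [set _ | _] =
    [set t | `|(G t).1.1 - (F t).1.1| < e] `&`
    [set t | `|(G t).1.2 - (F t).1.2| < e] `&`
    [set t | `|(G t).2 - (F t).2| < e]).
  apply: measurableI; first apply: measurableI;
    by apply: measurable_set_lt => //; apply: measurableT_comp => //;
      apply: measurable_funB.
by apply/seteqP; split=> t; [move=> /boxP[]|move=> [[? ?] ?]; apply/boxP].
Qed.

Context (E : set (vec3 R)) (F : vec3 R -> vec3 R) (c : R).
Context (mE : measurable E) (mF : measurable_fun setT F) (c0 : 0 < c)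
  (lipF : forall x y e, E x -> E y -> box (F x) e (F y) -> box x (c * e) y).

Section open.
Variables (U : set (vec3 R)) (oU : bopen U).

Let mU : measurable U. Proof. exact: oU.1. Qed.

(** The volume of the part of the box around [y] outside [U]. Its vanishing is a measurable
    condition on [y], whereas inclusion of the box in [U] involves uncountably many points. *)
Let hole e y := leb3 (xsection [set w : vec3 R * vec3 R |
  box w.1 e w.2 /\ (~` U) w.2] y).

Let holeE e y : hole e y = leb3 (box y e `\` U).
Proof.
congr leb3; apply/seteqP; split => z; rewrite /xsection/= inE/=.
  by case.
by case.
Qed.

Let A e := E `&` [set x | U (F x) /\ hole e (F x) = 0%E].

Let mA e : measurable (A e).
Proof.
apply: measurableI => //.
rewrite (_ : [set _ | _] = F @^-1` (U `&` [set y | hole e y = 0%E])); last first.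
  by apply/seteqP; split.
rewrite -[X in measurable X]setTI; apply: mF => //; apply: measurableI => //.
rewrite (_ : [set y | _] = setT `&` hole e @^-1` [set 0%E]); last first.
  by rewrite setTI.
have mh : measurable_fun setT (hole e).
  apply: measurable_fun_xsection; apply: measurableI.
    by apply: measurable_box_rel.
  by apply: (@measurable_preimageT _ _ _ _ snd (~` U)) => //; exact: measurableC.
by apply: mh => //; exact: emeasurable_set1.
Qed.

(** Double counting of the pairs (x, y) with [x] in [A e], [y] in [U] and [y] in the box of radius
    [e] around [F x]. For fixed [x] the admissible [y] fill this box, of volume (2e)^3. For fixed
    [y] any two admissible [x] have images within 2e, hence lie within 2ce of each other, which
    bounds their volume by (4ce)^3. *)
Let A_le e : 0 < e -> (leb3 (A e) <= ((2 * c) ^+ 3)%:E * leb3 U)%E.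
Proof.
move=> e0.
pose S : set (vec3 R * vec3 R) :=
  [set w | A e w.1 /\ box (F w.1) e w.2 /\ U w.2].
have mS : measurable S.
  apply: measurableI.
    exact: (@measurable_preimageT _ _ _ _ fst (A e)).
  apply: measurableI.
    by apply: measurable_box_rel => //; exact: measurableT_comp.
  exact: (@measurable_preimageT _ _ _ _ snd U).
have e20 : 0 <= (2 * e) ^+ 3 by rewrite exprn_ge0// mulr_ge0// ltW.
have h1 : (((2 * e) ^+ 3)%:E * leb3 (A e) <= \int[leb3]_x leb3 (xsection S x))%E.
  rewrite -[A e]setIT -integral_indic// -ge0_integralZl_EFin//; last first.
    by apply/measurable_EFinP; exact: measurable_indic.
  apply: ge0_le_integral => //.
  - by move=> x _; rewrite mule_ge0.
  - by apply/measurable_EFinP; apply: measurable_funM => //; exact: measurable_indic.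
  - exact: measurable_fun_xsection.
  move=> x _; rewrite indicE; have [|nA] := pselect (A e x); last first.
    by rewrite memNset// mule0.
  move=> Ax; rewrite mem_set// mule1 -(leb3_box (F x))//.
  case: (Ax) => Ex [UFx]; rewrite holeE => h0.
  rewrite (_ : xsection S x = box (F x) e `&` U); last first.
    by apply/seteqP; split => z; rewrite /xsection/= inE/=; [case=> _ []|case].
  have mb := measurable_box (F x) e.
  have mI : measurable (box (F x) e `&` U) by exact: measurableI.
  have mD : measurable (box (F x) e `\` U) by exact: measurableD.
  apply: (@le_trans _ _ (leb3 ((box (F x) e `&` U) `|` (box (F x) e `\` U)))).
    apply: le_measure; rewrite ?inE//; first exact: measurableU.
    by move=> z bz; have [Uz|nUz] := pselect (U z); [left|right].
  by rewrite (le_trans (measureU2 _ _ _))// [X in (_ + X)%E]h0 adde0.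
have h2 : (\int[leb3]_y leb3 (ysection S y) <=
    ((4 * c * e) ^+ 3)%:E * leb3 U)%E.
  have ce0 : 0 <= (4 * c * e) ^+ 3 by rewrite exprn_ge0// !mulr_ge0// ltW.
  rewrite -[U in leRHS]setIT -integral_indic// -ge0_integralZl_EFin//; last first.
    by apply/measurable_EFinP; exact: measurable_indic.
  apply: ge0_le_integral => //.
  - exact: measurable_fun_ysection.
  - by apply/measurable_EFinP; apply: measurable_funM => //; exact: measurable_indic.
  move=> y _; have [[x Sxy]|nS] := pselect (exists x, S (x, y)); last first.
    rewrite (_ : ysection S y = set0) ?measure0 ?mule_ge0//.
    by apply/seteqP; split => // x; rewrite /ysection/= inE => Sx; apply: nS; exists x.
  have [[Ex _] [xy Uy]] := Sxy.
  rewrite indicE mem_set// mule1 (_ : 4 * c * e = 2 * (c * (e + e))); last by ring.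
  rewrite -(leb3_box x); last by rewrite mulr_gt0// addr_gt0.
  apply: le_measure; rewrite ?inE.
  - exact: measurable_ysection.
  - exact: measurable_box.
  move=> z; rewrite /ysection/= inE => -[[Ez _] [zy _]].
  apply: lipF => //; apply: box_trans xy _; exact: box_sym.
have /(le_trans h1) : (\int[leb3]_x leb3 (xsection S x) <=
    ((4 * c * e) ^+ 3)%:E * leb3 U)%E.
  apply: le_trans h2; rewrite le_eqVlt; apply/orP; left; apply/eqP.
  have := indic_fubini_tonelli (@leb3 R) (@leb3 R) mS.
  rewrite (indic_fubini_tonelli_FE (@leb3 R) mS).
  by rewrite (indic_fubini_tonelli_GE (@leb3 R) mS).
rewrite (_ : (4 * c * e) ^+ 3 = (2 * e) ^+ 3 * (2 * c) ^+ 3); last by ring.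
by rewrite (EFinM ((2 * e) ^+ 3)) -muleA lee_pmul2l// ?lte_fin ?exprn_gt0// mulr_gt0.
Qed.

(** As [U] is open, the sets [A e] increase to the whole preimage when [e] decreases to 0, and the
    bound on them does not depend on [e]. *)
Lemma lower_lipschitz_open :
  (leb3 (E `&` F @^-1` U) <= ((2 * c) ^+ 3)%:E * leb3 U)%E.
Proof.
pose B k := A k.+1%:R^-1.
have k0 k : 0 < k.+1%:R^-1 :> R by rewrite invr_gt0.
have ndB : nondecreasing_seq B.
  move=> i j ij; apply/subsetPset => x [Ex [UFx]]; rewrite holeE => h0.
  split => //; split => //; rewrite holeE; apply/eqP; rewrite -measure_le0 -h0.
  apply: le_measure; rewrite ?inE; try by apply: measurableD => //;
    exact: measurable_box.
  apply: setSD; apply: sub_box.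
  by rewrite lef_pV2 ?posrE// ler_nat.
have BE : E `&` F @^-1` U = \bigcup_k B k.
  apply/seteqP; split => [x [Ex UFx]|x [k _ [Ex [UFx _]]]]; last by split.
  have [e e0 eU] := oU.2 _ UFx.
  have [k _ /(_ k (leqnn k))/= ke] := near_infty_natSinv_lt (PosNum e0).
  exists k => //; split => //; split => //; rewrite holeE.
  rewrite (_ : _ `\` _ = set0) ?measure0//; apply/seteqP; split => // y [+ nU].
  by move=> /(sub_box (ltW ke)) /eU.
have cB : leb3 (B k) @[k --> \oo] --> leb3 (\bigcup_k B k).
  apply: nondecreasing_cvg_mu => //; first by move=> k; exact: mA.
  by apply: bigcupT_measurable => k; exact: mA.
rewrite BE -(cvg_lim _ cB)//; apply: lime_le; first by apply/cvg_ex; eexists; exact: cB.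
by near=> k; apply: A_le.
Unshelve. all: by end_near. Qed.

End open.

Lemma lower_lipschitz_null N : measurable N -> leb3 N = 0%E ->
  leb3 (E `&` F @^-1` N) = 0%E.
Proof.
move=> mN N0.
have key k : leb3 (E `&` F @^-1` (N `&` box 0 k.+1%:R)) = 0%E.
  have k0 : 0 < k.+1%:R :> R by [].
  have mb := measurable_box (0 : vec3 R) k.+1%:R.
  have boo : (leb3 (box (0 : vec3 R)%R k.+1%:R) < +oo)%E by rewrite leb3_box// ltry.
  apply/eqP; rewrite -measure_le0; apply/lee_addgt0Pr => e e0; rewrite add0e.
  have d0 : 0 < e / (2 * c) ^+ 3 by rewrite divr_gt0// exprn_gt0// mulr_gt0.
  (* Lebesgue measure restricted to a box is finite, so regularity covers the null set by an open
     set that is small inside the box. *)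
  have [U [V [oU oV NU nNV]]] := measurable_regular (mfrestr mb boo) mN d0.
  rewrite /mfrestr/= /mrestr => UVe.
  have oU' := bopenI oU (bopen_box0 k.+1%:R).
  have mS W : measurable W -> measurable (E `&` F @^-1` W).
    by move=> mW; apply: measurableI => //; exact: measurable_preimageT.
  apply: (@le_trans _ _ (leb3 (E `&` F @^-1` (U `&` box 0 k.+1%:R)))).
    apply: le_measure; rewrite ?inE.
    - by apply: mS; exact: measurableI.
    - by apply: mS; exact: oU'.1.
    - by apply: setIS => x [/NU].
  apply: (le_trans (lower_lipschitz_open oU')).
  have -> : e%:E = (((2 * c) ^+ 3)%:E * (e / (2 * c) ^+ 3)%:E)%E.
    by rewrite -EFinM mulrC divfK// gt_eqF// exprn_gt0// mulr_gt0.
  rewrite lee_pmul2l ?lte_fin ?exprn_gt0 ?mulr_gt0//.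
  rewrite -[leRHS]add0e -N0; apply: (@le_trans _ _ (leb3 (N `|` (U `&` V `&` box 0 k.+1%:R)))).
    have mUV : measurable (U `&` V `&` box 0 k.+1%:R).
      by apply: measurableI => //; apply: measurableI; [exact: oU.1|exact: oV.1].
    apply: le_measure; rewrite ?inE; [exact: oU'.1|exact: measurableU|].
    move=> x [Ux bx]; have [Nx|nNx] := pselect (N x); [by left|right].
    by split => //; split => //; exact: nNV.
  rewrite (le_trans (measureU2 _ _ _))//.
    by apply: measurableI => //; apply: measurableI; [exact: oU.1|exact: oV.1].
  by rewrite leeD2l.
have -> : E `&` F @^-1` N = \bigcup_k (E `&` F @^-1` (N `&` box 0 k.+1%:R)).
  apply/seteqP; split => [x [Ex Nx]|x [k _ [Ex [Nx _]]]]; last by split.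
  set y := F x in Nx *; set M := `|y.1.1| + `|y.1.2| + `|y.2|.
  have [k kM] : exists k, M < k.+1%:R.
    exists (Num.trunc M); exact: truncnS_gt.
  exists k => //; split => //; split => //; apply/boxP; rewrite !subr0.
  have := normr_ge0 y.1.1; have := normr_ge0 y.1.2; have := normr_ge0 y.2.
  by rewrite /M in kM; split; lra.
apply/eqP; rewrite -measure_le0.
have mk k : measurable (E `&` F @^-1` (N `&` box 0 k.+1%:R)).
  apply: measurableI => //; apply: measurable_preimageT => //.
  by apply: measurableI => //; exact: measurable_box.
have mU := bigcupT_measurable _ mk.
apply: (le_trans (measure_sigma_subadditive leb3 mk mU (@subset_refl _ _))).
by rewrite eseries0// => k _ _; exact: key.
Qed.

End LowerLipschitz.

(** * Collision kinematics *)

Section Kinematics.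
Context (R : realType).
Implicit Types (p q w e W x y : vec3 R).

Lemma vec3P x y : x.1.1 = y.1.1 -> x.1.2 = y.1.2 -> x.2 = y.2 -> x = y.
Proof. by case: x => [[? ?] ?]; case: y => [[? ?] ?] /= -> -> ->. Qed.

Lemma dotC p q : dot p q = dot q p.
Proof. by rewrite /dot; ring. Qed.

Lemma dotDl p q w : dot (p + q) w = dot p w + dot q w.
Proof. by rewrite /dot /=; ring. Qed.

Lemma dotDr p q w : dot w (p + q) = dot w p + dot w q.
Proof. by rewrite !(dotC w) dotDl. Qed.

Lemma dotZl (k : R) p w : dot (k *: p) w = k * dot p w.
Proof. by rewrite /dot /= /GRing.scale/=; ring. Qed.

Lemma dotZr (k : R) p w : dot w (k *: p) = k * dot w p.
Proof. by rewrite !(dotC w) dotZl. Qed.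

Lemma dotNr p w : dot w (- p) = - dot w p.
Proof. by rewrite -scaleN1r dotZr mulN1r. Qed.

Lemma dot_ge0 p : 0 <= dot p p.
Proof. by rewrite /dot -!expr2 !addr_ge0// sqr_ge0. Qed.

Lemma enorm_ge0 p : 0 <= enorm p. Proof. exact: sqrtr_ge0. Qed.

Lemma enorm_sqr p : enorm p ^+ 2 = dot p p.
Proof. by rewrite /enorm sqr_sqrtr// dot_ge0. Qed.

Lemma dot_cauchy_sqr p q : dot p q ^+ 2 <= dot p p * dot q q.
Proof.
rewrite -subr_ge0 /dot (_ : _ - _ = (p.1.1 * q.1.2 - p.1.2 * q.1.1) ^+ 2 +
  (p.1.1 * q.2 - p.2 * q.1.1) ^+ 2 + (p.1.2 * q.2 - p.2 * q.1.2) ^+ 2);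
  last by ring.
by rewrite !addr_ge0// sqr_ge0.
Qed.

Lemma dot_cauchy p q : `|dot p q| <= enorm p * enorm q.
Proof.
rewrite -(@ler_pXn2r _ 2)// ?nnegrE ?mulr_ge0 ?enorm_ge0//.
by rewrite real_normK ?num_real// exprMn !enorm_sqr dot_cauchy_sqr.
Qed.

Lemma enorm_triangle p q : enorm (p + q) <= enorm p + enorm q.
Proof.
rewrite -(@ler_pXn2r _ 2)// ?nnegrE ?addr_ge0 ?enorm_ge0//.
rewrite enorm_sqr sqrrD !enorm_sqr dotDl !dotDr (dotC q p).
by have := le_trans (ler_norm _) (dot_cauchy p q); lra.
Qed.

Lemma varrho_ge0 p q : 0 <= varrho p q. Proof. exact: sqrtr_ge0. Qed.

Lemma varrho_sqr p q : varrho p q ^+ 2 = 2 * (enorm p * enorm q - dot p q).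
Proof.
rewrite /varrho sqr_sqrtr// mulr_ge0// subr_ge0.
exact: le_trans (ler_norm _) (dot_cauchy p q).
Qed.

Lemma varrho_sqr_energy p q :
  varrho p q ^+ 2 = (enorm p + enorm q) ^+ 2 - dot (p + q) (p + q).
Proof.
by rewrite varrho_sqr sqrrD !enorm_sqr dotDl !dotDr (dotC q p); ring.
Qed.

Lemma varrho_le p q : varrho p q ^+ 2 <= 4 * (enorm p * enorm q).
Proof.
rewrite varrho_sqr; have := dot_cauchy p q.
by rewrite ler_norml => /andP[? _]; lra.
Qed.

Lemma enorm_unit w : dot w w = 1 -> enorm w = 1.
Proof. by rewrite /enorm => ->; rewrite sqrtr1. Qed.

Lemma dot_unit_le p q w : dot w w = 1 ->
  `|dot (p + q) w| <= enorm p + enorm q.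
Proof.
move=> w1; apply: le_trans (dot_cauchy _ _) _.
by rewrite (enorm_unit w1) mulr1 enorm_triangle.
Qed.

Let kE p q w : dot w w = 1 ->
  dot (p + q) w / (enorm p + enorm q + varrho p q) *
    (enorm p + enorm q + varrho p q) = dot (p + q) w.
Proof.
(* A zero denominator forces |p| + |q| = 0, so the scalar product vanishes too and the identity
   survives the convention x / 0 = 0. *)
move=> w1; have [D0|D0] := eqVneq (enorm p + enorm q + varrho p q) 0.
  have := dot_unit_le p q w1; have := varrho_ge0 p q.
  have := enorm_ge0 p; have := enorm_ge0 q => q0 p0 r0.
  rewrite (_ : enorm p + enorm q = 0) ?normr_le0; last by lra.
  by move=> /eqP ->; rewrite !mul0r.
by rewrite divfK.
Qed.

(** p' is the momentum of a massless particle of energy varrho / 2 and direction [w] in the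
    centre-of-momentum frame, boosted back; the right-hand side is its boosted energy. The
    computation uses only varrho^2 = (|p| + |q|)^2 - |p + q|^2. *)
Lemma enorm_post_p p q w : dot w w = 1 ->
  enorm (post_p p q w) = (enorm p + enorm q + dot (p + q) w) / 2.
Proof.
move=> w1.
have := dot_unit_le p q w1; rewrite ler_norml => /andP[x1 _].
have y0 : 0 <= (enorm p + enorm q + dot (p + q) w) / 2 by lra.
rewrite -[RHS](ger0_norm y0) -sqrtr_sqr {1}/enorm; congr Num.sqrt.
have := kE p q w1; have := varrho_sqr_energy p q.
rewrite /post_p /deflection.
set k := _ / _; set s := enorm p + enorm q; set r := varrho p q.
set P := p + q => e1 e2; clearbody P.
rewrite !(dotDl, dotDr, dotZl, dotZr) w1 (dotC w P).
rewrite (_ : dot P P = s ^+ 2 - r ^+ 2); last by rewrite e1; ring.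
by rewrite -e2 -/s -/r; field.
Qed.

Lemma post_qE p q w : post_q p q w = post_p p q (- w).
Proof.
rewrite /post_q /post_p /deflection dotNr mulNr scalerN scaleNr -opprD.
by rewrite scalerN.
Qed.

Lemma enorm_post_q p q w : dot w w = 1 ->
  enorm (post_q p q w) = (enorm p + enorm q - dot (p + q) w) / 2.
Proof.
move=> w1; rewrite post_qE enorm_post_p ?dotNr//.
by rewrite dotC dotNr opprK.
Qed.

Definition twist w W : vec3 R := (2 * dot W w) *: W - dot W W *: w.

(* In the variables P = p + q and u = |p| + |q| + varrho, the map p' is the
   quadratic map [twist w] evaluated at P + u w. *)
Lemma post_p_twist p q w : dot w w = 1 ->
  let u := enorm p + enorm q + varrho p q in 0 < u ->
  post_p p q w = (4 * u)^-1 *: twist w (p + q + u *: w).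
Proof.
move=> w1 u u0.
have := varrho_sqr_energy p q.
rewrite /post_p /deflection /twist -/u.
set s := enorm p + enorm q; set r := varrho p q; set P := p + q => e1.
have uE : u = s + r by [].
clearbody P.
have -> : dot (P + u *: w) w = dot P w + u by rewrite dotDl dotZl w1 mulr1.
have -> : dot (P + u *: w) (P + u *: w) = dot P P + 2 * u * dot P w + u ^+ 2.
  by rewrite dotDl dotZl !dotDr !dotZr w1 (dotC w P); ring.
have e2 : dot P P = u * (u - 2 * r) by rewrite uE; nra.
rewrite e2; have un : u != 0 by rewrite gt_eqF.
move: (dot P w) => x.
by apply: vec3P; rewrite /= /GRing.scale/=; field.
Qed.

(** With S = W + W' and D = W - W', the right-hand side equals (S.w)^2 |D|^2 + (D.w)^2 (|S|^2 -
    (S.w)^2) + ((D.w)(S.w) - S.D)^2, and the last two terms are nonnegative. The map is thus lower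
    Lipschitz where S.w stays away from 0. *)
Lemma twist_lip w W W' : dot w w = 1 ->
  (dot (W + W') w) ^+ 2 * dot (W - W') (W - W') <=
    dot (twist w W - twist w W') (twist w W - twist w W').
Proof.
move=> w1.
have -> : twist w W - twist w W' = dot (W - W') w *: (W + W') +
    dot (W + W') w *: (W - W') - dot (W + W') (W - W') *: w.
  by apply: vec3P; rewrite /twist /dot /= /GRing.scale/=; ring.
move: (W + W') (W - W') => S D.
have -> : dot (dot D w *: S + dot S w *: D - dot S D *: w)
    (dot D w *: S + dot S w *: D - dot S D *: w) =
    dot D w ^+ 2 * dot S S + dot S w ^+ 2 * dot D D + dot S D ^+ 2
    - 2 * dot D w * dot S w * dot S D.
  rewrite -scaleNr !(dotDl, dotZl) !(dotDr, dotZr) w1 (dotC w S) (dotC w D).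
  by rewrite (dotC D S); ring.
have := dot_cauchy_sqr S w; rewrite w1 mulr1 => SS.
have : 0 <= dot D w ^+ 2 * (dot S S - dot S w ^+ 2).
  by rewrite mulr_ge0 ?sqr_ge0// subr_ge0.
have := sqr_ge0 (dot D w * dot S w - dot S D).
by nra.
Qed.

End Kinematics.

(** * Nonsingularity of the post-collision maps *)

Lemma ae_integral0 d (T : measurableType d) (R : realType)
    (mu : {measure set T -> \bar R}) (f : T -> \bar R) :
    measurable_fun setT f -> (forall x, (0 <= f x)%E) ->
  (\int[mu]_x f x = 0)%E <-> \forall x \ae mu, f x = 0%E.
Proof.
move=> mf f0.
have -> : (\int[mu]_x f x = \int[mu]_x `|f x|)%E.
  by apply: eq_integral => x _; rewrite gee0_abs.
have H := ae_eq_integral_abs mu measurableT mf.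
split=> [/H|fE]; first by apply: filterS => x /(_ I).
by apply/H; apply: filterS fE => x + _.
Qed.

(** By Tonelli, either condition says that the product measure of [H] is zero. *)
Lemma null_section_swap d1 d2 (T1 : measurableType d1) (T2 : measurableType d2)
    (R : realType) (m1 : {sigma_finite_measure set T1 -> \bar R})
    (m2 : {sigma_finite_measure set T2 -> \bar R}) (H : set (T1 * T2)) :
    measurable H ->
    (\forall x \ae m1, m2 [set y | H (x, y)] = 0%E) ->
  \forall y \ae m2, m1 [set x | H (x, y)] = 0%E.
Proof.
move=> mH.
have xE x : [set y | H (x, y)] = xsection H x.
  by apply/seteqP; split => y; rewrite /xsection/= inE.
have yE y : [set x | H (x, y)] = ysection H y.
  by apply/seteqP; split => x; rewrite /ysection/= inE.
have mx := measurable_fun_xsection m2 mH.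
have my := measurable_fun_ysection m1 mH.
move=> H1.
have {}H1 : \forall x \ae m1, (m2 \o xsection H) x = 0%E.
  by apply: filterS H1 => x; rewrite xE.
have {H1} : (\int[m1]_x (m2 \o xsection H) x = 0)%E.
  by apply/ae_integral0.
have := indic_fubini_tonelli m1 m2 mH.
rewrite (indic_fubini_tonelli_FE m2 mH) (indic_fubini_tonelli_GE m1 mH).
move=> -> /(ae_integral0 _ my) H2.
have {}H2 := H2 (fun=> measure_ge0 _ _).
by apply: filterS H2 => y; rewrite yE.
Qed.

Section VecMeasurable.
Context (R : realType) d (T : measurableType d).
Implicit Types (f g : T -> vec3 R) (k : T -> R).

Lemma measurable_vec3P f : measurable_fun setT f <->
  [/\ measurable_fun setT (fun t => (f t).1.1 : R),
    measurable_fun setT (fun t => (f t).1.2 : R) &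
    measurable_fun setT (fun t => (f t).2 : R)].
Proof.
split=> [/measurable_fun_pairP[/measurable_fun_pairP[? ?] ?] //|[f1 f2 f3]].
by apply/measurable_fun_pairP; split => //; apply/measurable_fun_pairP.
Qed.

Lemma measurable_vecD f g : measurable_fun setT f -> measurable_fun setT g ->
  measurable_fun setT (fun t => f t + g t).
Proof.
move=> /measurable_vec3P[? ? ?] /measurable_vec3P[? ? ?].
by apply/measurable_vec3P; split; exact: measurable_funD.
Qed.

Lemma measurable_vecZ k f : measurable_fun setT k -> measurable_fun setT f ->
  measurable_fun setT (fun t => k t *: f t).
Proof.
move=> mk /measurable_vec3P[? ? ?].
by apply/measurable_vec3P; split; exact: measurable_funM.
Qed.

Lemma measurable_vecN f : measurable_fun setT f ->
  measurable_fun setT (fun t => - f t).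
Proof.
by move=> /measurable_vec3P[? ? ?]; apply/measurable_vec3P; split;
  exact: measurable_funN.
Qed.

Lemma measurable_dot f g : measurable_fun setT f -> measurable_fun setT g ->
  measurable_fun setT (fun t => dot (f t) (g t)).
Proof.
move=> /measurable_vec3P[? ? ?] /measurable_vec3P[? ? ?].
by rewrite /dot; apply: measurable_funD; [apply: measurable_funD|];
  exact: measurable_funM.
Qed.

Lemma measurable_sqrt k : measurable_fun setT k ->
  measurable_fun setT (fun t => Num.sqrt (k t)).
Proof.
move=> mk; suff : measurable_fun setT (Num.sqrt \o k) by [].
apply: measurableT_comp => //; apply: continuous_measurable_fun.
exact: sqrt_continuous.
Qed.

Lemma measurable_enorm f : measurable_fun setT f ->
  measurable_fun setT (fun t => enorm (f t)).
Proof. by move=> mf; apply: measurable_sqrt; exact: measurable_dot. Qed.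

Lemma measurable_varrho f g : measurable_fun setT f -> measurable_fun setT g ->
  measurable_fun setT (fun t => varrho (f t) (g t)).
Proof.
move=> mf mg; apply: measurable_sqrt; apply: measurable_funM => //.
apply: measurable_funB; last exact: measurable_dot.
by apply: measurable_funM; exact: measurable_enorm.
Qed.

Lemma measurable_inv k : measurable_fun setT k ->
  measurable_fun setT (fun t => (k t)^-1).
Proof.
move=> mk.
have -> : (fun t => (k t)^-1) = (fun t => k t * (k t ^+ 2) `^ (-1)).
  apply/funext => t; rewrite powR_inv1 ?sqr_ge0//.
  have [->|k0] := eqVneq (k t) 0; first by rewrite invr0 mul0r.
  by rewrite expr2 invfM mulrA divff// mul1r.
apply: measurable_funM => //.
apply: (measurableT_comp (@measurable_powR R (-1))).
exact: measurable_funX.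
Qed.

Lemma measurable_post_p f g h : measurable_fun setT f ->
  measurable_fun setT g -> measurable_fun setT h ->
  measurable_fun setT (fun t => post_p (f t) (g t) (h t)).
Proof.
move=> mf mg mh; have mfg := measurable_vecD mf mg.
apply: measurable_vecD; first exact: measurable_vecZ.
apply: measurable_vecZ => //; apply: measurable_vecD.
  by apply: measurable_vecZ => //; exact: measurable_varrho.
apply: measurable_vecZ => //; apply: measurable_funM.
  exact: measurable_dot.
apply: measurable_inv; apply: measurable_funD; last exact: measurable_varrho.
by apply: measurable_funD; exact: measurable_enorm.
Qed.

End VecMeasurable.

Section Nonsingular.
Context (R : realType).
Notation leb := (@lebesgue_measure R).
Implicit Types (p q w P x y : vec3 R) (N : set (vec3 R)).

Lemma box_dot x y e : box x e y -> dot (y - x) (y - x) < 3 * e ^+ 2.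
Proof.
move=> /boxP[].
have S (u : R) : `|u| < e -> u * u < e ^+ 2.
  move=> ue; rewrite -expr2 -real_normK ?num_real//.
  by rewrite ltr_pXn2r// ?nnegrE// (le_trans _ (ltW ue)).
move=> /S a1 /S a2 /S a3; rewrite /dot /=; lra.
Qed.

Lemma dot_box x y e : 0 < e -> dot (y - x) (y - x) < e ^+ 2 -> box x e y.
Proof.
move=> e0 de; apply/boxP.
have S (u : R) : u ^+ 2 <= dot (y - x) (y - x) -> `|u| < e.
  move=> ud; rewrite -(@ltr_pXn2r _ 2)// ?nnegrE ?(ltW e0)//.
  by rewrite real_normK ?num_real// (le_lt_trans ud).
have s1 := sqr_ge0 (y.1.1 - x.1.1); have s2 := sqr_ge0 (y.1.2 - x.1.2).
have s3 := sqr_ge0 (y.2 - x.2).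
by split; apply: S; rewrite /dot /= -!expr2; lra.
Qed.

Lemma measurable_twist w d (T : measurableType d) (f : T -> vec3 R) :
  measurable_fun setT f -> measurable_fun setT (fun t => twist w (f t)).
Proof.
move=> mf; apply: measurable_vecD.
  apply: measurable_vecZ => //; apply: measurable_funM => //.
  exact: measurable_dot.
apply: measurable_vecN; apply: measurable_vecZ => //; exact: measurable_dot.
Qed.

(** The half-space 0 < P.w + u is exhausted by the sets P.w + u > 1/(k+1), on each of which
    [twist_lip] gives a lower Lipschitz bound. *)
Lemma twist_null w (u : R) N : dot w w = 1 -> 0 < u -> measurable N ->
    leb3 N = 0%E ->
  leb3 [set P | 0 < dot P w + u /\
    N ((4 * u)^-1 *: twist w (P + u *: w))] = 0%E.
Proof.
move=> w1 u0 mN N0.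
pose F P := (4 * u)^-1 *: twist w (P + u *: w).
have mF : measurable_fun setT F.
  apply: measurable_vecZ => //; apply: measurable_twist.
  by apply: measurable_vecD.
pose E k := [set P | k.+1%:R^-1 < dot P w + u].
have md : measurable_fun setT (fun P => dot P w + u).
  by apply: measurable_funD => //; exact: measurable_dot.
have mE k : measurable (E k) by exact: measurable_set_lt.
have key k : leb3 (E k `&` F @^-1` N) = 0%E.
  have k0 : 0 < k.+1%:R :> R by [].
  (* The factor 3 between a box and a Euclidean ball is absorbed by the factor 2^2 = 4 that comes
     from adding two quantities above 1/(k+1). *)
  apply: (lower_lipschitz_null (mE k) mF (c := 4 * u * k.+1%:R)) => //.
    by rewrite !mulr_gt0.
  move=> x y e; rewrite /E/= => Ex Ey bxy.
  have e0 : 0 < e by move/boxP : bxy => [+ _ _]; exact: le_lt_trans.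
  apply: dot_box; first by rewrite !mulr_gt0.
  have := box_dot bxy.
  rewrite (_ : F y - F x = (4 * u)^-1 *: (twist w (y + u *: w) - twist w (x + u *: w)));
    last by rewrite scalerBr.
  rewrite dotZl dotZr.
  have := twist_lip (y + u *: w) (x + u *: w) w1.
  rewrite (_ : y + u *: w - (x + u *: w) = y - x); last by rewrite opprD addrACA subrr addr0.
  set DT := dot (twist _ _ - _) _; set D := dot (y - x) _.
  have D0 : 0 <= D by exact: dot_ge0.
  have -> : dot (y + u *: w + (x + u *: w)) w = (dot y w + u) + (dot x w + u).
    by rewrite !dotDl dotZl w1; ring.
  set a := dot y w + u in Ey *; set b := dot x w + u in Ex *.
  move=> h1; rewrite mulrA -expr2 -ltr_pdivlMl ?exprn_gt0 ?invr_gt0 ?mulr_gt0//.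
  move=> h2.
  have : (2 / k.+1%:R) ^+ 2 * D <= (a + b) ^+ 2 * D.
    have kv : 0 < k.+1%:R^-1 :> R by rewrite invr_gt0.
    rewrite ler_wpM2r//; apply: lerXn2r; rewrite ?nnegrE.
    - by rewrite divr_ge0.
    - by rewrite addr_ge0// ltW// (lt_trans kv).
    - by rewrite mulrDl mul1r lerD// ltW.
  move=> /le_trans /(_ h1) /le_lt_trans /(_ h2).
  rewrite expr_div_n mulrAC ltr_pdivrMr ?exprn_gt0// exprVn invrK.
  have -> : (4 * u) ^+ 2 * (3 * e ^+ 2) * k.+1%:R ^+ 2 =
      3 * (4 * u * k.+1%:R * e) ^+ 2 by ring.
  set Z := (_ * e) ^+ 2; have Z0 : 0 <= Z by exact: sqr_ge0.
  by rewrite (_ : 2 ^+ 2 = 4 :> R); [lra|ring].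
have -> : [set P | 0 < dot P w + u /\ N (F P)] = \bigcup_k (E k `&` F @^-1` N).
  apply/seteqP; split => [x /= [x0 Nx]|x [k _ [Ex Nx]]].
    have [k _ /(_ k (leqnn k))/= ke] := near_infty_natSinv_lt (PosNum x0).
    by exists k.
  by split => //; apply: lt_trans Ex; rewrite invr_gt0.
have mk k : measurable (E k `&` F @^-1` N).
  by apply: measurableI => //; exact: measurable_preimageT.
apply/eqP; rewrite -measure_le0.
apply: (le_trans (measure_sigma_subadditive leb3 mk (bigcupT_measurable _ mk) (@subset_refl _ _))).
by rewrite eseries0// => k _ _; exact: key.
Qed.

(** The statement on the line follows from the one in space, applied to the map that acts on the
    third coordinate over a unit square. *)
Lemma lower_lipschitz_null1 (E : set R) (f : R -> R) (c : R) (N : set R) :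
    measurable E -> measurable_fun setT f -> 0 < c ->
    (forall x y : R, E x -> E y -> `|y - x| <= c * `|f y - f x|) ->
    measurable N -> leb N = 0%E -> leb (E `&` f @^-1` N) = 0%E.
Proof.
move=> mE mf c0 lf mN N0.
pose I : set R := [set` `]0, 1[].
pose F (x : vec3 R) : vec3 R := (x.1, f x.2).
pose c' := Num.max 1 c.
have c'0 : 0 < c' by rewrite lt_max ltr01.
have mF : measurable_fun setT F.
  apply/measurable_fun_pair => //=; exact: measurableT_comp.
have mI : measurable (I : set (measurableTypeR R)) by exact: measurable_itv.
have mI2 : measurable (I `*` I : set (vec2 R)) by exact: measurableX.
have mE' : measurable ((I `*` I) `*` E : set (vec3 R)) by exact: measurableX.
have mN' : measurable ((I `*` I) `*` N : set (vec3 R)) by exact: measurableX.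
have L (A : set R) : measurable A -> leb3 ((I `*` I) `*` A) = leb A.
  move=> mA; rewrite [LHS]product_measure1E//.
  rewrite [X in (X * _)%E]product_measure1E//= !lebesgue_measure_itv/= !lte_fin.
  by rewrite ltr01 -EFinB subr0 !mul1e.
have := lower_lipschitz_null (F := F) mE' mF c'0 _ mN'.
have -> : ((I `*` I) `*` E) `&` F @^-1` ((I `*` I) `*` N) =
    (I `*` I) `*` (E `&` f @^-1` N).
  apply/seteqP; split => [x [[I1 Ex] [_ Nx]]|x [I1 [Ex Nx]]]; first by split.
  by split; split.
have mEN : measurable (E `&` f @^-1` N).
  by apply: measurableI => //; exact: measurable_preimageT.
rewrite !L//; apply => //.
move=> x y e [_ Ex] [_ Ey] /boxP[/= b1 b2 b3].
have e0 : 0 < e by exact: le_lt_trans b1.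
apply/boxP; split.
- by apply: lt_le_trans b1 _; rewrite ler_peMl ?(ltW e0)// le_max lexx.
- by apply: lt_le_trans b2 _; rewrite ler_peMl ?(ltW e0)// le_max lexx.
- apply: le_lt_trans (lf _ _ Ex Ey) _.
  apply: (@le_lt_trans _ _ (c' * `|f y.2 - f x.2|)); last by rewrite ltr_pM2l.
  by rewrite ler_wpM2r// le_max lexx orbT.
Qed.

End Nonsingular.

(** * Level sets of |p| + |q| + varrho at fixed total momentum *)

Section EnergyLevels.
Context (R : realType).
Notation leb := (@lebesgue_measure R).
Implicit Types (p q w P : vec3 R) (al be b x y z : R).

Let rt al z : R := Num.sqrt (z ^+ 2 + al).

Let rt_sqr al z : 0 <= al -> rt al z ^+ 2 = z ^+ 2 + al.
Proof. by move=> al0; rewrite sqr_sqrtr// addr_ge0// sqr_ge0. Qed.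

Let rt_cauchy al y z : 0 <= al -> z * y + al <= rt al y * rt al z.
Proof.
move=> al0; apply: le_trans (ler_norm _) _.
rewrite -(@ler_pXn2r _ 2)// ?nnegrE ?mulr_ge0 ?sqrtr_ge0//.
rewrite real_normK ?num_real// exprMn !rt_sqr//.
rewrite -subr_ge0 (_ : _ - _ = al * (y - z) ^+ 2); last by ring.
by rewrite mulr_ge0// sqr_ge0.
Qed.

Let rt_tangent al y z : 0 <= al ->
  z / rt al z * (y - z) <= rt al y - rt al z.
Proof.
move=> al0; have [r0|r0] := eqVneq (rt al z) 0.
  by rewrite r0 invr0 mulr0 mul0r subr0 sqrtr_ge0.
have rp : 0 < rt al z by rewrite lt_neqAle eq_sym r0 sqrtr_ge0.
rewrite mulrAC ler_pdivrMr// mulrBl -expr2 rt_sqr//.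
by have := rt_cauchy y z al0; lra.
Qed.

Let rt_strict al y z : 0 < al -> rt al y - rt al z = z / rt al z * (y - z) ->
  y = z.
Proof.
move=> al0 e; have al0' := ltW al0.
have rp : 0 < rt al z by rewrite sqrtr_gt0 ltr_wpDl// sqr_ge0.
have e2 : rt al y * rt al z = z * y + al.
  have : (rt al y - rt al z) * rt al z = z * (y - z).
    by rewrite e mulrAC divfK// gt_eqF.
  by rewrite mulrBl -expr2 rt_sqr//; lra.
have : (rt al y * rt al z) ^+ 2 = (z * y + al) ^+ 2 by rewrite e2.
rewrite exprMn !rt_sqr// => h.
have : al * (y - z) ^+ 2 = 0.
  by rewrite (_ : _ * _ = (y ^+ 2 + al) * (z ^+ 2 + al) - (z * y + al) ^+ 2);
    [rewrite h subrr|ring].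
move/eqP; rewrite mulf_eq0 gt_eqF//= sqrf_eq0 subr_eq0 => /eqP //.
Qed.

Definition energy p P : R := enorm p + enorm (P - p).

Definition energy_rho p P : R := energy p P + varrho p (P - p).

(** At fixed [P], varrho^2 is the square of the energy minus |P|^2, so varrho increases with the
    energy and the sum grows at least as fast as the energy alone. *)
Lemma energy_rho_incr p q P : energy p P <= energy q P ->
  energy q P - energy p P <= energy_rho q P - energy_rho p P.
Proof.
move=> pq; suff : varrho p (P - p) <= varrho q (P - q) by rewrite /energy_rho; lra.
have E t : 0 <= energy t P by rewrite addr_ge0// enorm_ge0.
rewrite -(@ler_pXn2r _ 2)// ?nnegrE ?varrho_ge0// !varrho_sqr_energy.
by rewrite !subrKC lerB// ler_pXn2r// nnegrE; exact: E.
Qed.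

Lemma measurable_energy_rho d (T : measurableType d) (f g : T -> vec3 R) :
    measurable_fun setT f -> measurable_fun setT g ->
  measurable_fun setT (fun t => energy_rho (f t) (g t)).
Proof.
move=> mf mg.
have mgf : measurable_fun setT (fun t => g t - f t).
  by apply: measurable_vecD => //; exact: measurable_vecN.
apply: measurable_funD; last exact: measurable_varrho.
by apply: measurable_funD; exact: measurable_enorm.
Qed.

Section slice.
Context (P : vec3 R) (x : vec2 R) (x0 : x.1 != 0).

Let al := x.1 ^+ 2 + x.2 ^+ 2.
Let be := (P.1.1 - x.1) ^+ 2 + (P.1.2 - x.2) ^+ 2.

Let al0 : 0 < al.
Proof. by rewrite ltr_wpDr ?sqr_ge0// lt_neqAle eq_sym sqrf_eq0 x0 sqr_ge0. Qed.

Let be0 : 0 <= be. Proof. by rewrite addr_ge0// sqr_ge0. Qed.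

Let phiE z : energy (x, z) P = rt al z + rt be (z - P.2).
Proof.
by rewrite /energy /enorm /rt /dot /al /be /=; congr (_ + _);
  congr Num.sqrt; ring.
Qed.

(** The slope of the energy along the line. Where the second root vanishes, the convention x / 0 = 0
    still yields the slope of a supporting line, which is all that is used. *)
Let psi z := z / rt al z + (z - P.2) / rt be (z - P.2).

Let mpsi : measurable_fun setT psi.
Proof.
have mrt c (f : R -> R) : measurable_fun setT f ->
    measurable_fun setT (fun z => rt c (f z)).
  by move=> mf; apply: measurable_sqrt; apply: measurable_funD => //;
    exact: measurable_funX.
have mB : measurable_fun setT (fun z : R => z - P.2) by exact: measurable_funB.
apply: measurable_funD; apply: measurable_funM => //; apply: measurable_inv.
  exact: (mrt al id).
exact: mrt.
Qed.

Let tangent y z : psi z * (y - z) <= energy (x, y) P - energy (x, z) P.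
Proof.
rewrite !phiE /psi mulrDl.
have := rt_tangent y z (ltW al0).
have := rt_tangent (y - P.2) (z - P.2) be0.
by rewrite (_ : y - P.2 - (z - P.2) = y - z); [lra|ring].
Qed.

(** Two zeros would both minimize the energy along the line, which is strictly convex there because
    [x.1] is nonzero. *)
Let psi_zero y z : psi y = 0 -> psi z = 0 -> y = z.
Proof.
move=> py pz; have := tangent y z; have := tangent z y.
rewrite py pz !mul0r => h1 h2.
have {h1 h2} : energy (x, y) P - energy (x, z) P = psi z * (y - z).
  by rewrite pz mul0r; lra.
rewrite !phiE /psi mulrDl.
have h1 := rt_tangent y z (ltW al0).
have := rt_tangent (y - P.2) (z - P.2) be0.
rewrite (_ : y - P.2 - (z - P.2) = y - z); last by ring.
by move=> h2 h3; apply: (rt_strict al0); lra.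
Qed.

(** Where the slope exceeds 1/(k+1) in absolute value, with a fixed sign, the tangent inequality
    makes the energy, and hence its sum with varrho, lower Lipschitz. These sets exhaust the line up
    to the single point where the slope may vanish. *)
Lemma energy_slice_null (N : set R) : measurable N -> leb N = 0%E ->
  leb [set z | N (energy_rho (x, z) P)] = 0%E.
Proof.
move=> mN N0.
pose f z := energy_rho (x, z) P.
have mf : measurable_fun setT f.
  apply: measurable_energy_rho => //; exact: measurable_pair1.
have mfN : measurable (f @^-1` N) by exact: measurable_preimageT.
pose Ep k := [set z | k.+1%:R^-1 < psi z].
pose En k := [set z | psi z < - k.+1%:R^-1].
pose Z := [set z | psi z = 0].
have mEp k : measurable (Ep k) by exact: measurable_set_lt.
have mEn k : measurable (En k) by exact: measurable_set_lt.
have mZ : measurable Z.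
  have := @measurable_preimageT _ _ _ _ psi [set 0] mpsi (measurable_set1 _).
  by [].
have incr y z k : k.+1%:R^-1 * `|y - z| <= energy (x, y) P - energy (x, z) P ->
    `|y - z| <= k.+1%:R * `|f y - f z|.
  move=> h; rewrite -ler_pdivrMl//; apply: le_trans h _.
  have [e|e] := leP (energy (x, z) P) (energy (x, y) P).
    exact: le_trans (energy_rho_incr e) (ler_norm _).
  by apply: le_trans (normr_ge0 _); rewrite subr_le0 ltW.
have np k : leb (Ep k `&` f @^-1` N) = 0%E.
  apply: (@lower_lipschitz_null1 _ _ _ k.+1%:R) => // u v Eu Ev.
  wlog uv : u v Eu Ev / u <= v.
    move=> H; case: (leP u v) => [|/ltW] uv; first exact: H.
    by rewrite (distrC v) (distrC (f v)); exact: H.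
  apply: incr; apply: le_trans (tangent v u).
  by rewrite ger0_norm ?subr_ge0// ler_wpM2r ?subr_ge0// ltW.
have nn k : leb (En k `&` f @^-1` N) = 0%E.
  apply: (@lower_lipschitz_null1 _ _ _ k.+1%:R) => // u v Eu Ev.
  wlog uv : u v Eu Ev / v <= u.
    move=> H; case: (leP v u) => [|/ltW] uv; first exact: H.
    by rewrite (distrC v) (distrC (f v)); exact: H.
  apply: incr; apply: le_trans (tangent v u).
  rewrite ler0_norm ?subr_le0// mulrN -mulNr ler_wnM2r ?subr_le0//.
  exact: ltW.
have Z0 : leb Z = 0%E.
  have [[z Zz]|nZ] := pselect (exists z, Z z); last first.
    rewrite (_ : Z = set0) ?measure0//; apply/seteqP; split => // z Zz.
    by apply: nZ; exists z.
  rewrite (_ : Z = [set z]) ?lebesgue_measure_set1//.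
  by apply/seteqP; split => [y Zy|y ->//]; exact: psi_zero.
have mp k : measurable (Ep k `&` f @^-1` N) by exact: measurableI.
have mn k : measurable (En k `&` f @^-1` N) by exact: measurableI.
have sub : f @^-1` N `<=` (\bigcup_k (Ep k `&` f @^-1` N)) `|`
    (\bigcup_k (En k `&` f @^-1` N)) `|` Z.
  move=> z Nz; have [pz|pz|pz] := ltgtP (psi z) 0; [left; right|left; left|by right].
    have nz : 0 < - psi z by rewrite oppr_gt0.
    have [k _ /(_ k (leqnn k))/= ke] := near_infty_natSinv_lt (PosNum nz).
    by exists k => //; split => //=; rewrite /En/= ltrNr.
  have [k _ /(_ k (leqnn k))/= ke] := near_infty_natSinv_lt (PosNum pz).
  by exists k.
have mup := bigcupT_measurable _ mp; have mun := bigcupT_measurable _ mn.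
have up0 : leb (\bigcup_k (Ep k `&` f @^-1` N)) = 0%E.
  apply/eqP; rewrite -measure_le0.
  apply: (le_trans (measure_sigma_subadditive leb mp mup (@subset_refl _ _))).
  by rewrite eseries0// => k _ _; exact: np.
have un0 : leb (\bigcup_k (En k `&` f @^-1` N)) = 0%E.
  apply/eqP; rewrite -measure_le0.
  apply: (le_trans (measure_sigma_subadditive leb mn mun (@subset_refl _ _))).
  by rewrite eseries0// => k _ _; exact: nn.
apply/eqP; rewrite -measure_le0.
apply: (@le_trans _ _ (leb ((\bigcup_k (Ep k `&` f @^-1` N)) `|`
    (\bigcup_k (En k `&` f @^-1` N)) `|` Z))).
  apply: le_measure; rewrite ?inE//.
  by apply: measurableU => //; exact: measurableU.
apply: (le_trans (measureU2 _ _ _)) => //; first exact: measurableU.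
rewrite [X in (_ + X)%E]Z0 adde0.
by rewrite (le_trans (measureU2 _ _ _))// [X in (X + _)%E]up0
  [X in (_ + X)%E]un0 adde0.
Qed.

End slice.

Lemma energy_null P (N : set R) : measurable N -> leb N = 0%E ->
  leb3 [set p | N (energy_rho p P)] = 0%E.
Proof.
move=> mN N0; set A := [set p | _].
have mA : measurable A.
  by apply: (@measurable_preimageT _ _ _ _ (energy_rho ^~ P)) => //;
    exact: measurable_energy_rho.
have mx := measurable_fun_xsection leb mA.
apply/(@ae_integral0 _ _ _ leb2 (leb \o xsection A)) => //.
exists ([set 0] `*` setT); split.
- exact: measurableX.
- rewrite [LHS]product_measure1E//.
  by rewrite [X in (X * _)%E]lebesgue_measure_set1 mul0e.
- move=> x; apply: contra_notP => xN /=.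
  have x0 : x.1 != 0 by apply/eqP => x10; apply: xN; split.
  rewrite -[RHS](energy_slice_null P x0 mN N0); congr lebesgue_measure.
  by apply/seteqP; split => z; rewrite /xsection/= inE.
Qed.

End EnergyLevels.

(** * The measure on collision parameters, and null sets under p' and q' *)

Section CollisionMeasure.
Context {R : realType}.
Implicit Types (p q w P : vec3 R).

Definition collision_measure : set (vec3 R * vec3 R) -> \bar R :=
  (leb3 \x sphere_measure)%E.

HB.instance Definition _ := Measure.on collision_measure.

Let sigma_finite_collision_measure : sigma_finite setT collision_measure.
Proof.
have /sigma_finiteP[F [TF ndF Foo]] := sigma_finiteT (@leb3 R).
exists (fun n => F n `*` setT).
  rewrite -setXTT [X in X `*` _]TF predeqE => -[x y]; split.
    by move=> [/= [n _ Fnx] _]; exists n.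
  by move=> [n _ []/= ? ?]; split => //; exists n.
move=> k; have [? ?] := Foo k.
split; first exact: measurableX.
rewrite /collision_measure product_measure1E// [X in (_ * X)%E]sphere_measureT.
by apply: lte_mul_pinfty; rewrite ?ge0_fin_numE ?ltry.
Qed.

HB.instance Definition _ := Measure_isSigmaFinite.Build _ _ _
  collision_measure sigma_finite_collision_measure.

Lemma sphere_chart_unit (z t : R) : -1 <= z <= 1 ->
  dot (sphere_chart (z, t)) (sphere_chart (z, t)) = 1.
Proof.
move=> /andP[z1 z2]; rewrite /dot /sphere_chart/=.
have z0 : 0 <= 1 - z ^+ 2.
  by rewrite (_ : _ - _ = (1 - z) * (1 + z)); [apply: mulr_ge0; lra|ring].
have := sqr_sqrtr z0; set r := Num.sqrt _ => r2.
rewrite (_ : _ + _ = r ^+ 2 * (cos t ^+ 2 + sin t ^+ 2) + z ^+ 2); last by ring.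
by rewrite r2 cos2Dsin2; ring.
Qed.

Lemma sphere_unit_ae : \forall w \ae (@sphere_measure R), dot w w = 1.
Proof.
exists [set w | dot w w != 1]; split.
- have md : measurable_fun setT (fun w : vec3 R => dot w w).
    exact: measurable_dot.
  rewrite (_ : [set _ | _] = (fun w => dot w w) @^-1` (~` [set 1])).
    by apply: measurable_preimageT => //; apply: measurableC.
  by apply/seteqP; split => w /= /eqP.
- rewrite /sphere_measure /pushforward /mrestr.
  rewrite (_ : _ `&` _ = set0) ?measure0//; apply/seteqP; split => // -[z t].
  by move=> [/= + [+ _]]; rewrite /= in_itv/= => /eqP + /(sphere_chart_unit t).
- by move=> w /= /eqP.
Qed.

Lemma product_null d1 d2 (T1 : measurableType d1) (T2 : measurableType d2)
    (m1 : {sigma_finite_measure set T1 -> \bar R})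
    (m2 : {sigma_finite_measure set T2 -> \bar R}) (H : set (T1 * T2)) :
    measurable H -> (\forall y \ae m2, m1 [set x | H (x, y)] = 0%E) ->
  (m1 \x m2)%E H = 0%E.
Proof.
move=> mH H0.
pose H' : set (T2 * T1) := [set u | H (u.2, u.1)].
have mH' : measurable H'.
  by apply: (@measurable_preimageT _ _ _ _ (fun u : T2 * T1 => (u.2, u.1))) => //;
    apply/measurable_fun_pair.
have := @null_section_swap _ _ _ _ _ m2 m1 H' mH' H0.
have mx := measurable_fun_xsection m2 mH => H1.
apply/(@ae_integral0 _ _ _ m1 (m2 \o xsection H)) => //.
apply: filterS H1 => x /= <-; congr (m2 _).
by apply/seteqP; split => y; rewrite /xsection/= inE.
Qed.

(** In the variables (u, P) the bad set is null because it is so for each fixed [u], hence for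
    almost every [P] its section in [u] is null, and [energy_null] turns this into a null set of
    [p]. Two further exchanges of sections and the translation q = P - p bring back the original
    variables. *)
Let post_p_null_fixed w (N : set (vec3 R)) : dot w w = 1 -> measurable N ->
    leb3 N = 0%E ->
  \forall q \ae leb3, leb3 [set p | 0 < varrho p q /\ N (post_p p q w)] = 0%E.
Proof.
move=> w1 mN N0.
pose tw (u : R) P := (4 * u)^-1 *: twist w (P + u *: w).
pose N' : set (measurableTypeR R * vec3 R) :=
  [set v | [/\ 0 < v.1, 0 < dot v.2 w + v.1 & N (tw v.1 v.2)]].
have msnd := @measurable_snd _ _ (measurableTypeR R) (vec3 R).
have mfst := @measurable_fst _ _ (measurableTypeR R) (vec3 R).
have mN' : measurable N'.
  rewrite (_ : N' = [set v | 0 < v.1] `&` [set v | 0 < dot v.2 w + v.1] `&`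
      (fun v : measurableTypeR R * vec3 R => tw v.1 v.2) @^-1` N); last first.
    by apply/seteqP; split=> v; [case|case=> -[]].
  apply: measurableI; first apply: measurableI; try apply: measurable_set_lt => //.
    by apply: measurable_funD => //; exact: measurable_dot.
  apply: measurable_preimageT => //; apply: measurable_vecZ.
    by apply: measurable_inv; exact: measurable_funM.
  apply: measurable_twist; apply: measurable_vecD => //.
  exact: measurable_vecZ.
have h1 : \forall P \ae leb3, lebesgue_measure [set u | N' (u, P)] = 0%E.
  apply: (null_section_swap mN'); apply: aeW => u.
  have [u0|u0] := ltP 0 u; last first.
    rewrite (_ : [set _ | _] = set0) ?measure0//.
    by apply/seteqP; split => // P [/=]; rewrite ltNge u0.
  rewrite -[RHS](twist_null w1 u0 mN N0); congr leb3.
  by apply/seteqP; split => P /=; [case|case; split].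
pose H : set (vec3 R * vec3 R) := [set v | 0 < varrho v.2 (v.1 - v.2) /\
  N (post_p v.2 (v.1 - v.2) w)].
have mfst3 := @measurable_fst _ _ (vec3 R) (vec3 R).
have msnd3 := @measurable_snd _ _ (vec3 R) (vec3 R).
have mB : measurable_fun setT (fun v : vec3 R * vec3 R => v.1 - v.2).
  by apply: measurable_vecD => //; exact: measurable_vecN.
have mH : measurable H.
  apply: measurableI.
    by apply: measurable_set_lt => //; exact: measurable_varrho.
  apply: (@measurable_preimageT _ _ _ _
    (fun v : vec3 R * vec3 R => post_p v.2 (v.1 - v.2) w)) => //.
  exact: measurable_post_p.
have h2 : \forall P \ae leb3, leb3 [set p | H (P, p)] = 0%E.
  apply: filterS h1 => P h1.
  have mN1 : measurable [set u | N' (u, P)].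
    apply: (@measurable_preimageT _ _ _ _
      (fun u : measurableTypeR R => (u, P))) => //;
    exact: measurable_pair2.
  have mHP : measurable [set p | H (P, p)].
    apply: (@measurable_preimageT _ _ _ _ (fun p : vec3 R => (P, p))) => //;
    exact: measurable_pair1.
  apply/eqP; rewrite -measure_le0.
  rewrite -(energy_null P mN1 h1); apply: le_measure; rewrite ?inE//.
    have me : measurable_fun setT (fun p => energy_rho p P : measurableTypeR R).
      exact: measurable_energy_rho.
    exact: (measurable_preimageT me mN1).
  move=> p [/= r0 Np].
  have e0 : 0 <= energy p P by rewrite addr_ge0// enorm_ge0.
  have u0 : 0 < energy_rho p P by rewrite ltr_wpDl.
  (* Positivity of varrho is what makes P.w + u strictly positive, since |P.w| is at most |p| +
     |q|. *)
  have := dot_unit_le p (P - p) w1; rewrite subrKC ler_norml => /andP[x0 _].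
  split => //=; first by rewrite /energy_rho /energy; lra.
  move: Np; rewrite (post_p_twist w1 u0) /tw; congr (N _).
  by rewrite subrKC.
have h3 : \forall p \ae leb3, leb3 [set P | H (P, p)] = 0%E.
  exact: (null_section_swap mH h2).
pose H' : set (vec3 R * vec3 R) := [set v | 0 < varrho v.1 v.2 /\
  N (post_p v.1 v.2 w)].
have mH' : measurable H'.
  apply: measurableI.
    by apply: measurable_set_lt => //; exact: measurable_varrho.
  apply: (@measurable_preimageT _ _ _ _
    (fun v : vec3 R * vec3 R => post_p v.1 v.2 w)) => //.
  exact: measurable_post_p.
apply: (null_section_swap mH'); apply: filterS h3 => p h3.
have mHp : measurable [set P | H (P, p)].
  apply: (@measurable_preimageT _ _ _ _ (fun P : vec3 R => (P, p))) => //;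
    exact: measurable_pair2.
have msh : measurable_fun setT (fun q : vec3 R => p + q) by exact: measurable_vecD.
(* Translations are lower Lipschitz with constant 1, so the shift by [p] preserves null sets. *)
rewrite -[RHS](lower_lipschitz_null measurableT msh ltr01 _ mHp h3).
  congr leb3; rewrite setTI; apply/seteqP; split => q; rewrite /H /H' /=.
    by rewrite addrAC subrr add0r.
  by rewrite addrAC subrr add0r.
move=> x y e _ _ /boxP[/= b1 b2 b3]; rewrite mul1r.
have E (a b c : R) : a + c - (a + b) = c - b by ring.
by rewrite !E in b1 b2 b3; apply/boxP.
Qed.

(** The sign [k], either 1 or -1, treats p' and q' together, as q' is p' with the angle reversed. *)
Let post_p_null (k : R) (N : set (vec3 R)) : k * k = 1 -> measurable N ->
    leb3 N = 0%E ->
  \forall p \ae leb3, \forall z \ae collision_measure,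
    0 < varrho p z.1 -> dot z.2 z.2 = 1 -> ~ N (post_p p z.1 (k *: z.2)).
Proof.
move=> kk mN N0.
pose H : set ((vec3 R * vec3 R) * vec3 R) := [set v | [/\ 0 < varrho v.2 v.1.1,
  dot v.1.2 v.1.2 = 1 & N (post_p v.2 v.1.1 (k *: v.1.2))]].
have m11 : measurable_fun setT (fun v : (vec3 R * vec3 R) * vec3 R => v.1.1).
  exact: (measurableT_comp (f := fst)).
have m12 : measurable_fun setT (fun v : (vec3 R * vec3 R) * vec3 R => v.1.2).
  exact: (measurableT_comp (f := snd)).
have mH : measurable H.
  rewrite (_ : H = [set v | 0 < varrho v.2 v.1.1] `&`
    (fun v : (vec3 R * vec3 R) * vec3 R => dot v.1.2 v.1.2) @^-1` [set 1] `&`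
    (fun v : (vec3 R * vec3 R) * vec3 R => post_p v.2 v.1.1 (k *: v.1.2)) @^-1` N);
    last by apply/seteqP; split=> v; [case|case=> -[]].
  apply: measurableI; first apply: measurableI.
  - by apply: measurable_set_lt => //; exact: measurable_varrho.
  - by apply: measurable_preimageT => //; exact: measurable_dot.
  - apply: measurable_preimageT => //.
    by apply: measurable_post_p => //; exact: measurable_vecZ.
have msec z : measurable [set p | H (z, p)].
  apply: (@measurable_preimageT _ _ _ _ (fun p : vec3 R => (z, p))) => //;
    exact: measurable_pair1.
have h1 : \forall z \ae collision_measure, leb3 [set p | H (z, p)] = 0%E.
  pose f z := leb3 [set p | H (z, p)].
  have fE : f = leb3 \o xsection H.
    apply/funext => z; congr leb3.
    by apply/seteqP; split => p; rewrite /xsection/= inE.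
  have mf : measurable_fun setT f.
    by rewrite fE; exact: measurable_fun_xsection.
  pose B : set (vec3 R * vec3 R) := [set z | f z <> 0%E].
  have mB : measurable B.
    apply: (@measurable_preimageT _ _ _ _ f (~` [set 0%E])) => //.
    by apply: measurableC; exact: emeasurable_set1.
  exists B; split => //.
  apply: product_null => //; apply: filterS sphere_unit_ae => w w1.
  apply: measure_negligible.
    apply: (@measurable_preimageT _ _ _ _ (fun q : vec3 R => (q, w))) => //;
    exact: measurable_pair2.
  have kw1 : dot (k *: w) (k *: w) = 1 by rewrite dotZl dotZr w1 mulr1.
  apply: negligibleS (post_p_null_fixed kw1 mN N0) => q Bq h0; apply: Bq.
  rewrite /f -[RHS]h0.
  by congr leb3; apply/seteqP; split => p /=; [case|case; split].
have h2 := null_section_swap mH h1.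
apply: filterS h2 => p h2.
have mp : measurable [set z | H (z, p)].
  apply: (@measurable_preimageT _ _ _ _ (fun z : vec3 R * vec3 R => (z, p))) => //;
    exact: measurable_pair2.
exists [set z | H (z, p)]; split => //.
move=> z /= nz; have [//|nH] := pselect (H (z, p)).
by exfalso; apply: nz => r0 z1 Nz; apply: nH; split.
Qed.

Lemma post_nonsingular (N : set (vec3 R)) : measurable N -> leb3 N = 0%E ->
  \forall p \ae leb3, \forall z \ae collision_measure,
    0 < varrho p z.1 -> dot z.2 z.2 = 1 ->
    ~ N (post_p p z.1 z.2) /\ ~ N (post_q p z.1 z.2).
Proof.
move=> mN N0.
have h1 := @post_p_null 1 _ (mulr1 1) mN N0.
have h2 := @post_p_null (- 1) _ (etrans (mulrNN 1 1) (mulr1 1)) mN N0.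
apply: filterS2 h1 h2 => p; apply: filterS2 => z + + r0 z1.
by rewrite post_qE scale1r scaleN1r => /(_ r0 z1) ? /(_ r0 z1).
Qed.

End CollisionMeasure.

(** * An angular integral over the sphere *)

Lemma integral_mrestr d (T : measurableType d) (R : realType)
    (mu : {measure set T -> \bar R}) (D : set T) (mD : measurable D)
    (f : T -> \bar R) : measurable_fun setT f -> (forall x, (0 <= f x)%E) ->
  (\int[mrestr mu mD]_x f x = \int[mu]_(x in D) f x)%E.
Proof.
move=> mf f0; have mC := measurableC mD.
rewrite (@ge0_negligible_integral _ _ _ (mrestr mu mD) setT (~` D))//; last first.
  by rewrite /= /mrestr setICl measure0.
rewrite setTD setCK; apply: eq_measure_integral => A mA AD.
by rewrite /= /mrestr setIidl.
Qed.

Section Singular.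
Context (R : realType).
Notation leb := (@lebesgue_measure R).
Implicit Types (th x c : R).

(* An extended-valued majorant of [`|x| `^ (- th)], equal to [+oo] at [0],
   where [powR] has a junk value. *)
Definition sing th x : \bar R := (1 + \sum_(k <oo)
  ((2 `^ th) ^+ k.+1 * \1_[set y : R | `|y| <= 2^-1 ^+ k] x)%:E)%E.

Let term_ge0 th x k :
  (0 <= ((2 `^ th) ^+ k.+1 * \1_[set y : R | `|y| <= 2^-1 ^+ k] x)%:E)%E.
Proof. by rewrite lee_fin mulr_ge0// exprn_ge0// powR_ge0. Qed.

Lemma sing_ge1 th x : (1 <= sing th x)%E.
Proof. by rewrite leeDl// nneseries_ge0. Qed.

Lemma sing_ge0 th x : (0 <= sing th x)%E.
Proof. exact: le_trans (sing_ge1 th x). Qed.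

Let sing_partial th x k : (\sum_(0 <= i < k)
  ((2 `^ th) ^+ i.+1 * \1_[set y : R | (`|y| <= 2^-1 ^+ i)%R] x)%:E <= sing th x)%E.
Proof.
apply: le_trans (leeDr _ _) => //.
by apply: nneseries_lim_ge => i _ _; exact: term_ge0.
Qed.

Lemma powR_exprn (x y : R) k : 0 <= x -> (x ^+ k) `^ y = (x `^ y) ^+ k.
Proof.
by move=> x0; rewrite -(powR_mulrn k x0) -(powR_mulrn k (powR_ge0 x y)) powRAC.
Qed.

(** When 2^-(k+1) < |x| <= 2^-k, the k-th term alone is 2^(th (k+1)), which already dominates; for
    |x| >= 1 the constant 1 suffices. *)
Lemma sing_lower th x : 0 <= th -> x != 0 ->
  ((`|x| `^ (- th))%:E <= sing th x)%E.
Proof.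
move=> th0 x0; have nx : 0 < `|x| by rewrite normr_gt0.
have [x1|x1] := leP 1 `|x|.
  apply: le_trans (sing_ge1 th x); rewrite lee_fin powRN invf_le1.
    rewrite -(powRr0 `|x|); exact: ler_powR.
  exact: powR_gt0.
have ex : exists k, (2^-1 ^+ k.+1 < `|x|)%R.
  have [k _ /(_ k (leqnn k))/= ke] := near_infty_natSinv_expn_lt (PosNum nx).
  exists k; apply: le_lt_trans ke; rewrite exprVn div1r lef_pV2 ?posrE ?exprn_gt0//.
  by rewrite ler_weXn2l// ler1n.
have [k kx kmin] := ex_minnP ex.
have xk : `|x| <= 2^-1 ^+ k.
  case: k kx kmin => [|k] kx kmin; first by rewrite expr0 ltW.
  by rewrite leNgt; apply/negP => /kmin; rewrite ltnn.
apply: le_trans (sing_partial th x k.+1); rewrite big_nat_recr//=.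
apply: le_trans (leeDr _ _); last by apply: sume_ge0 => i _; exact: term_ge0.
rewrite lee_fin indicE mem_set// mulr1 powRN.
have h0 : 0 <= 2^-1 :> R by rewrite invr_ge0.
have g0 : 0 < 2 `^ th :> R by exact: powR_gt0.
rewrite -[leRHS]invrK lef_pV2 ?posrE ?powR_gt0 ?invr_gt0 ?exprn_gt0//.
rewrite -exprVn -powRN -mulN1r powRrM powR_inv1// -powR_exprn//.
apply: (ge0_ler_powR th0); rewrite ?nnegrE ?exprn_ge0//; exact: ltW.
Qed.

Lemma sing0 th : 0 <= th -> sing th 0 = +oo%E.
Proof.
move=> th0; apply/eqyP => A A0.
have g1 : 1 <= 2 `^ th :> R.
  by rewrite -[leLHS](powRr0 2); apply: ler_powR => //; rewrite ler1n.
have h k : (k%:R%:E <= \sum_(0 <= i < k)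
    ((2 `^ th) ^+ i.+1 * \1_[set y : R | (`|y| <= 2^-1 ^+ i)%R] 0)%:E)%E.
  elim: k => [|k ih]; first by rewrite big_geq.
  rewrite big_nat_recr//= -natr1 EFinD leeD// lee_fin indicE mem_set ?mulr1.
    exact: exprn_ege1.
  by rewrite /= normr0 exprn_ge0// invr_ge0.
apply: le_trans (sing_partial th 0 (Num.trunc A).+1); apply: le_trans (h _).
by rewrite lee_fin ltW// truncnS_gt.
Qed.

Let mball k : measurable [set y : R | `|y| <= 2^-1 ^+ k].
Proof.
rewrite (_ : [set _ | _] = [set` `[- (2^-1 ^+ k), 2^-1 ^+ k]]) //.
by apply/seteqP; split => y /=; rewrite in_itv/= ler_norml.
Qed.

Let mterm th k : measurable_fun setT (fun x : R =>
  ((2 `^ th) ^+ k.+1 * \1_[set y : R | `|y| <= 2^-1 ^+ k] x)%:E).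
Proof.
by apply/measurable_EFinP; apply: measurable_funM.
Qed.

Lemma measurable_sing th : measurable_fun setT (sing th).
Proof.
apply: emeasurable_funD => //.
apply: ge0_emeasurable_sum => // k x _ _; exact: term_ge0.
Qed.

(** The sum of the integrals of the dyadic terms over the line: the k-th is 2 * 2^th * (2^th / 2)^k,
    a geometric series that converges when th < 1. *)
Definition sing_mass th : R := 2 * 2 `^ th / (1 - 2 `^ th / 2).

Lemma powR2_lt2 th : 0 <= th -> th < 1 -> 2 `^ th < 2.
Proof.
move=> th0 th1; rewrite -[ltRHS](powRr1 (ler0n _ 2)) lt_neqAle; apply/andP; split.
  have l2 : ln 2 != 0 :> R by rewrite gt_eqF// ln_gt0// ltr1n.
  apply/eqP => /(congr1 (@ln R)); rewrite !ln_powR => /(mulIf l2) e.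
  by move: th1; rewrite e ltxx.
by apply: ler_powR; rewrite ?ler1n ?ltW.
Qed.

Lemma sing_mass_gt0 th : 0 <= th -> th < 1 -> 0 < sing_mass th.
Proof.
move=> th0 th1; rewrite divr_gt0 ?mulr_gt0 ?powR_gt0// subr_gt0.
by rewrite ltr_pdivrMr// mul1r powR2_lt2.
Qed.

Lemma integral_sing th c (A B : R) : 0 <= th < 1 -> A <= B ->
  (\int[leb]_(x in `[A, B]) sing th (x - c) <= (B - A + sing_mass th)%:E)%E.
Proof.
move=> /andP[th0 th1] AB.
have mt k : measurable_fun (`[A, B] : set R) (fun x : R =>
    ((2 `^ th) ^+ k.+1 * \1_[set y : R | `|y| <= 2^-1 ^+ k] (x - c))%:E).
  apply: measurable_funTS.
  apply: (measurableT_comp (mterm th k) (g := fun x : R => x - c)).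
  exact: measurable_funB.
have g0 : 0 < 2 `^ th :> R by exact: powR_gt0.
have g2 := powR2_lt2 th0 th1.
rewrite /sing ge0_integralD//; last 2 first.
- by move=> x _; apply: nneseries_ge0 => k _ _; exact: term_ge0.
- apply: ge0_emeasurable_sum => [k x _ _|k _]; [exact: term_ge0|exact: mt].
rewrite EFinD leeD//.
  rewrite integral_cst// mul1e [leLHS]lebesgue_measure_itv/=.
  by case: ifPn => _; rewrite ?lee_fin ?subr_ge0// -EFinB.
rewrite integral_nneseries//.
apply: lime_le.
  by apply: is_cvg_nneseries => k _ _; apply: integral_ge0 => x _; exact: term_ge0.
near=> N.
apply: (@le_trans _ _ (series (geometric (2 * 2 `^ th) (2 `^ th / 2)) N)%:E); last first.
  rewrite lee_fin geometric_le_lim ?mulr_ge0 ?ltW// ?divr_gt0//.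
  by rewrite ger0_norm ?divr_ge0 ?ltW// ltr_pdivrMr// mul1r.
rewrite /series/= -sumEFin; apply: lee_sum => k _.
have k0 : 0 < 2^-1 ^+ k :> R by rewrite exprn_gt0// invr_gt0.
have mIc : measurable [set x : R | `|x - c| <= 2^-1 ^+ k].
  apply: (@measurable_preimageT _ _ _ _ (fun x : R => x - c) _ _ (mball k)).
  exact: measurable_funB.
have -> : (fun x : R =>
    ((2 `^ th) ^+ k.+1 * \1_[set y : R | `|y| <= 2^-1 ^+ k] (x - c))%:E) =
  (fun x : R => ((2 `^ th) ^+ k.+1)%:E *
    (\1_[set x : R | (`|x - c| <= 2^-1 ^+ k)%R] x)%:E)%E.
  by apply/funext => x; rewrite -EFinM; congr EFin; congr (_ * _).
rewrite ge0_integralZl_EFin//; last first.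
  by apply/measurable_EFinP; exact: measurable_funTS.
rewrite integral_indic//.
have -> : 2 * 2 `^ th * (2 `^ th / 2) ^+ k =
    (2 `^ th) ^+ k.+1 * (2 * 2^-1 ^+ k) :> R by rewrite exprMn exprS; ring.
rewrite EFinM lee_pmul2l// ?lte_fin ?exprn_gt0//.
apply: (@le_trans _ _ (leb [set` `[c - 2^-1 ^+ k, c + 2^-1 ^+ k]])).
  apply: le_measure; rewrite ?inE//; first exact: measurableI.
  by move=> x [/= + _]; rewrite in_itv/= ler_norml => /andP[? ?]; apply/andP; split; lra.
rewrite [leLHS]lebesgue_measure_itv/=.
case: ifPn => _; last by rewrite lee_fin mulr_ge0// ltW.
by rewrite -EFinB lee_fin; lra.
Unshelve. all: by end_near. Qed.

End Singular.

(** * Lower bounds for the angle between two directions in the chart of the sphere *)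

Section SphereGeometry.
Context (R : realType).
Implicit Types (x y z phi : R) (e w : vec3 R).

(** Up to pi / 4 the cosine stays above 1/2 and the mean value theorem applies; beyond, the sine is
    at least 1/2, while |x| / 4 <= pi / 8 < 1/2. *)
Lemma sin_lower x : `|x| <= pi / 2 -> `|x| / 4 <= `|sin x|.
Proof.
wlog x0 : x / 0 <= x.
  move=> H; case: (leP 0 x) => [|/ltW] x0; first exact: H.
  by rewrite -(normrN x) -(normrN (sin x)) -sinN => ?; apply: H; rewrite ?oppr_ge0.
rewrite ger0_norm// => xpi; have pi4 := @pihalf_lt2 R.
have pi0 := @pi_gt0 R.
rewrite ger0_norm; last by apply: sin_ge0_pi; rewrite x0/=; lra.
have c4 : 2^-1 <= cos (pi / 4) :> R.
  have c0 : 0 <= cos (pi / 4) :> R.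
    by apply: cos_ge0_pihalf; apply/andP; split; lra.
  have := cos_mulr2n (pi / 4 : R).
  rewrite (_ : pi / 4 *+ 2 = pi / 2); last by rewrite -mulr_natr; field.
  rewrite cos_pihalf => c2; rewrite leNgt; apply/negP => c12.
  have : cos (pi / 4) * cos (pi / 4) < 2^-1 * (2^-1 : R) by rewrite ltr_pM.
  by rewrite -expr2; move: c2; rewrite -mulr_natr; lra.
have [xp|xp] := leP x (pi / 4).
  have [->|xn0] := eqVneq x 0; first by rewrite sin0 mul0r.
  have xgt : 0 < x by rewrite lt_neqAle eq_sym xn0.
  have [c + cx'] := @MVT R sin cos 0 x xgt (fun y _ => is_derive_sin y)
    (continuous_subspaceT (@continuous_sin R)).
  have {cx'} -> : sin x = cos c * x by move: cx'; rewrite sin0 !subr0.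
  rewrite in_itv/= => /andP[c0 cx].
  have : cos (pi / 4) <= cos c.
    have I1 : pi / 4 \in `[0, pi : R] by rewrite in_itv/=; apply/andP; split; lra.
    have I2 : c \in `[0, pi : R] by rewrite in_itv/=; apply/andP; split; lra.
    by rewrite leNgt ltr_cos// -leNgt; lra.
  move=> cc; rewrite mulrC ler_wpM2r//; lra.
have : sin (pi / 4) <= sin x.
  have I1 : pi / 4 \in `[- (pi / 2), pi / 2 : R].
    by rewrite in_itv/=; apply/andP; split; lra.
  have I2 : x \in `[- (pi / 2), pi / 2 : R].
    by rewrite in_itv/=; apply/andP; split; lra.
  by rewrite leNgt ltr_sin// -leNgt; lra.
have -> : sin (pi / 4) = cos (pi / 4) :> R.
  rewrite -cosBpihalf -cosN; congr cos; lra.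
lra.
Qed.

(** (rho, t) and (h, c) are points of the unit circle, and the absolute value Y is the sine of the
    angle between them. Always |t - c| <= Y (rho + Y), which settles Y <= rho. If rho < Y, then 1 -
    t <= rho^2 <= rho Y: close to the pole, the height is compared with that of the pole instead. *)
Lemma chord_lower (rho c h t : R) : 0 <= rho -> 0 <= c -> 0 <= h -> 0 <= t ->
    rho ^+ 2 + t ^+ 2 = 1 -> c ^+ 2 + h ^+ 2 = 1 ->
  1 - t <= 2 * rho * `|rho * c - t * h| \/
  `|t - c| <= 2 * rho * `|rho * c - t * h|.
Proof.
move=> r0 c0 h0 t0 rt ch; set Y := `|_|; have Y0 : 0 <= Y by exact: normr_ge0.
have rt' : rho ^+ 2 = 1 - t ^+ 2 by lra.
have ch' : h ^+ 2 = 1 - c ^+ 2 by lra.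
have rc0 : 0 <= rho * c + t * h by rewrite addr_ge0// mulr_ge0.
have e1 : `|t - c| * (t + c) = Y * (rho * c + t * h).
  rewrite -[X in _ * X = _](ger0_norm (addr_ge0 t0 c0)) -[X in _ = _ * X](ger0_norm rc0).
  rewrite /Y -!normrM -[LHS]normrN; congr (Num.norm _).
  rewrite (_ : _ * (rho * c + t * h) = rho ^+ 2 * c ^+ 2 - t ^+ 2 * h ^+ 2);
    last by ring.
  by rewrite rt' ch'; ring.
have e2 : `|rho - h| * (rho + h) = Y * (rho * c + t * h).
  rewrite -[X in _ * X = _](ger0_norm (addr_ge0 r0 h0)) -[X in _ = _ * X](ger0_norm rc0).
  rewrite /Y -!normrM; congr (Num.norm _).
  rewrite (_ : _ * (rho * c + t * h) = rho ^+ 2 * c ^+ 2 - t ^+ 2 * h ^+ 2);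
    last by ring.
  rewrite (_ : _ * (rho + h) = rho ^+ 2 - h ^+ 2); last by ring.
  by rewrite rt' ch'; ring.
have t1 : t <= 1 by nra.
have c1 : c <= 1 by nra.
have h1 : `|rho - h| <= Y.
  have [rh|rh] := eqVneq (rho + h) 0.
    have -> : rho - h = 0 by lra.
    by rewrite normr0.
  have rh0 : 0 < rho + h by rewrite lt_neqAle eq_sym rh addr_ge0.
  rewrite -(ler_pM2r rh0) e2 ler_wpM2l//; nra.
have hr : h <= rho + Y.
  by move: h1; rewrite ler_norml => /andP[? ?]; lra.
have h2 : `|t - c| <= Y * (rho + Y).
  have [tc|tc] := eqVneq (t + c) 0.
    have -> : t - c = 0 by lra.
    by rewrite normr0 mulr_ge0// addr_ge0.
  have tc0 : 0 < t + c by rewrite lt_neqAle eq_sym tc addr_ge0.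
  rewrite -(ler_pM2r tc0) e1 -mulrA ler_wpM2l//.
  have : t * h <= t * (rho + Y) by rewrite ler_wpM2l.
  have : 0 <= Y * c by rewrite mulr_ge0.
  nra.
have [Yr|Yr] := leP Y rho; [right|left].
  apply: le_trans h2 _; rewrite mulrC ler_wpM2r//; lra.
have : rho * rho <= rho * Y by rewrite ler_wpM2l// ltW.
nra.
Qed.

Lemma polar_angle x y : x ^+ 2 + y ^+ 2 = 1 ->
  exists2 phi, `|phi| <= pi & cos phi = x /\ sin phi = y.
Proof.
move=> xy; have x1 : -1 <= x <= 1.
  by rewrite -ler_norml -(@ler_pXn2r _ 2)// ?nnegrE// real_normK ?num_real//
    expr1n -xy lerDl sqr_ge0.
have a0 := acos_ge0 x1; have api := acos_lepi x1.
have ca : cos (acos x) = x by apply: acosK; rewrite in_itv.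
have sa : sin (acos x) = `|y|.
  by rewrite sin_acos// -sqrtr_sqr; congr Num.sqrt; rewrite -xy; ring.
have [y0|y0] := leP 0 y.
  exists (acos x); first by rewrite ger0_norm.
  by rewrite ca sa ger0_norm.
exists (- acos x); first by rewrite normrN ger0_norm.
by rewrite cosN sinN ca sa ltr0_norm// opprK.
Qed.

(** The zeros of the sine in [- pi, 3 pi], which is the range of phi - phi0 for phi in [0, 2 pi] and
    |phi0| <= pi. *)
Definition turns : seq R := [:: - pi; 0; pi; 2 * pi; 3 * pi].

Lemma sin_lower_turns x : - pi <= x <= 3 * pi ->
  exists2 k, k \in turns & `|x - k| / 4 <= `|sin x|.
Proof.
move=> /andP[x0 x1]; have pi0 := @pi_gt0 R.
have key k : k \in turns -> `|sin (x - k)| = `|sin x| -> `|x - k| <= pi / 2 ->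
    exists2 k, k \in turns & `|x - k| / 4 <= `|sin x|.
  by move=> kt <- /sin_lower ?; exists k.
have sB y : `|sin (y - pi)| = `|sin y|.
  by rewrite -[y in RHS](subrK pi) sinDpi normrN.
have [?|?] := leP x (- (pi / 2)).
  apply: (key (- pi)); rewrite ?inE ?eqxx//.
    by rewrite -[LHS]sB; congr `|sin _|; ring.
  by rewrite ler_norml; apply/andP; split; lra.
have [?|?] := leP x (pi / 2).
  apply: (key 0); rewrite ?inE ?eqxx ?orbT ?subr0//.
  by rewrite ler_norml; apply/andP; split; lra.
have [?|?] := leP x (3 * pi / 2).
  apply: (key pi); rewrite ?inE ?eqxx ?orbT//.
  by rewrite ler_norml; apply/andP; split; lra.
have [?|?] := leP x (5 * pi / 2).
  apply: (key (2 * pi)); rewrite ?inE ?eqxx ?orbT//.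
    by rewrite -[RHS]sB -[RHS]sB; congr `|sin _|; ring.
  by rewrite ler_norml; apply/andP; split; lra.
apply: (key (3 * pi)); rewrite ?inE ?eqxx ?orbT//.
  by rewrite -[RHS]sB -[RHS]sB -[RHS]sB; congr `|sin _|; ring.
by rewrite ler_norml; apply/andP; split; lra.
Qed.

(** The squared sine of the angle to [e] dominates a product of a distance in height and a distance
    in longitude, so that its inverse powers are controlled by products of functions of one
    variable. *)
Lemma sphere_chart_lower e : dot e e = 1 -> exists c phi0, `|phi0| <= pi /\
  forall z phi, -1 <= z <= 1 -> 0 <= phi <= 2 * pi ->
    exists u v, [/\ u \in [:: 1; -1; c; - c], v \in turns &
      `|z - u| * `|phi - (phi0 + v)| / 8 <=
        1 - dot e (sphere_chart (z, phi)) ^+ 2].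
Proof.
case: e => [[e1 e2] e3]; rewrite /dot /= => e_unit.
pose h := Num.sqrt (e1 ^+ 2 + e2 ^+ 2); pose c := `|e3|.
have h0 : 0 <= h by exact: sqrtr_ge0.
have h2 : h ^+ 2 = e1 ^+ 2 + e2 ^+ 2 by rewrite sqr_sqrtr// addr_ge0// sqr_ge0.
have ch : c ^+ 2 + h ^+ 2 = 1.
  by rewrite real_normK ?num_real// h2 -e_unit; ring.
have [phi0 phi0pi [E1 E2]] : exists2 phi0, `|phi0| <= pi &
    e1 = h * cos phi0 /\ e2 = h * sin phi0.
  have [hz|hz] := eqVneq h 0.
    exists 0; first by rewrite normr0 pi_ge0.
    rewrite hz !mul0r; move: h2; rewrite hz expr0n/= => h2.
    have s1 := sqr_ge0 e1; have s2 := sqr_ge0 e2.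
    by split; apply/eqP; rewrite -sqrf_eq0; apply/eqP; lra.
  have [|phi0 ? [c1 s1]] := @polar_angle (e1 / h) (e2 / h).
    by rewrite !expr_div_n -mulrDl -h2 divff// sqrf_eq0.
  by exists phi0 => //; rewrite c1 s1; split; field.
exists c, phi0; split => // z phi z1 phi1.
set rho := Num.sqrt (1 - z ^+ 2).
have rho0 : 0 <= rho by exact: sqrtr_ge0.
have rho2 : rho ^+ 2 = 1 - z ^+ 2.
  rewrite sqr_sqrtr// (_ : 1 - z ^+ 2 = (1 - z) * (1 + z)); last by ring.
  by case/andP : z1 => *; apply: mulr_ge0; lra.
set C := cos (phi - phi0); set S := sin (phi - phi0).
have CS : C ^+ 2 + S ^+ 2 = 1 by exact: cos2Dsin2.
have dE : e1 * (rho * cos phi) + e2 * (rho * sin phi) + e3 * z =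
    rho * h * C + z * e3.
  by rewrite E1 E2 /C cosB; ring.
rewrite dE; set kappa := 1 - _.
have e3c : e3 ^+ 2 = c ^+ 2 by rewrite real_normK ?num_real.
(* Two lower bounds for the squared sine, one through the longitude and one through the heights; it
   also dominates the product of their square roots, where the factor rho is the one that
   [chord_lower] requires. *)
have k1 : (rho * `|S|) ^+ 2 <= kappa.
  rewrite exprMn real_normK ?num_real// -subr_ge0 /kappa.
  rewrite (_ : _ - _ = (rho * C * e3 - z * h) ^+ 2 +
    (1 - (rho ^+ 2 * C ^+ 2 + z ^+ 2) * (e3 ^+ 2 + h ^+ 2) -
      rho ^+ 2 * S ^+ 2)); last by ring.
  rewrite e3c ch mulr1 rho2.
  rewrite (_ : 1 - _ - _ = (1 - z ^+ 2) * (1 - (C ^+ 2 + S ^+ 2))); last by ring.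
  by rewrite CS subrr mulr0 addr0 sqr_ge0.
have k2 : `|rho * c - `|z| * h| ^+ 2 <= kappa.
  rewrite real_normK ?num_real// /kappa lerBrDl.
  have D : `|rho * h * C + z * e3| <= rho * h + `|z| * c.
    rewrite (le_trans (ler_normD _ _))// !normrM (ger0_norm rho0) (ger0_norm h0).
    rewrite lerD2r ler_piMr ?mulr_ge0// /C.
    by rewrite ler_norml cos_geN1 cos_le1.
  have := ler_pM (normr_ge0 _) (normr_ge0 _) D D.
  rewrite -!expr2 real_normK ?num_real//.
  have -> : (rho * h + `|z| * c) ^+ 2 =
      (rho ^+ 2 + `|z| ^+ 2) * (c ^+ 2 + h ^+ 2) - (rho * c - `|z| * h) ^+ 2.
    by ring.
  by rewrite ch rho2 real_normK ?num_real//; lra.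
have [u ut uY] : exists2 u, u \in [:: 1; -1; c; - c] &
    `|z - u| <= 2 * rho * `|rho * c - `|z| * h|.
  have zz : rho ^+ 2 + `|z| ^+ 2 = 1 by rewrite real_normK ?num_real// rho2; lra.
  case/andP : z1 => z1 z1'.
  have [] := chord_lower rho0 (normr_ge0 e3) h0 (normr_ge0 z) zz ch => H.
    have [z0|z0] := leP 0 z.
      exists 1; rewrite ?inE ?eqxx// ler0_norm ?subr_le0// opprB.
      by rewrite -[z in 1 - z]ger0_norm.
    exists (-1); rewrite ?inE ?eqxx ?orbT// opprK ger0_norm; last by lra.
    by apply: le_trans H; rewrite ltr0_norm//; lra.
  have [z0|z0] := leP 0 z.
    by exists c; rewrite ?inE ?eqxx ?orbT//; rewrite -[z in z - c]ger0_norm.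
  exists (- c); rewrite ?inE ?eqxx ?orbT// opprK.
  have -> : z + c = - (`|z| - c) by rewrite ltr0_norm//; ring.
  by rewrite normrN.
have [|v vt vS] := @sin_lower_turns (phi - phi0).
  move: phi0pi; rewrite ler_norml => /andP[? ?].
  by case/andP : phi1 => *; apply/andP; split; lra.
exists u, v; split => //.
rewrite opprD addrA.
have xy : rho * `|S| * `|rho * c - `|z| * h| <= kappa.
  set a := rho * `|S| in k1 *; set b := `|rho * c - _| in k2 *.
  by have := sqr_ge0 (a - b); rewrite sqrrB; lra.
apply: le_trans xy.
apply: (@le_trans _ _ (2 * rho * `|rho * c - `|z| * h| * (4 * `|S|) / 8)).
  rewrite ler_wpM2r//; apply: ler_pM => //.
  by move: vS; rewrite ler_pdivrMr// mulrC.
by rewrite le_eqVlt; apply/orP; left; apply/eqP; field.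
Qed.

End SphereGeometry.

Section SphereIntegral.
Context (R : realType).
Notation leb := (@lebesgue_measure R).
Implicit Types (e w : vec3 R).

Let sumsing (th : R) (s : seq R) (x : R) : \bar R :=
  (\sum_(u <- s) sing th (x - u))%E.

Let sumsing_ge0 th s x : (0 <= sumsing th s x)%E.
Proof. by apply: sume_ge0 => u _; exact: sing_ge0. Qed.

Let sumsing_ge th s x u : u \in s -> (sing th (x - u) <= sumsing th s x)%E.
Proof.
move=> us; rewrite /sumsing (big_rem u us)/= leeDl//.
by apply: sume_ge0 => v _; exact: sing_ge0.
Qed.

Let sumsing_ge1 th s x u : u \in s -> (1 <= sumsing th s x)%E.
Proof. by move=> us; apply: le_trans (sumsing_ge th x us); exact: sing_ge1. Qed.

Let measurable_sing_shift th c : measurable_fun setT (fun x : R => sing th (x - c)).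
Proof.
apply: (measurableT_comp (measurable_sing th) (g := fun x : R => x - c)).
exact: measurable_funB.
Qed.

Let measurable_sumsing th s : measurable_fun setT (sumsing th s).
Proof. by apply: emeasurable_sum => u; exact: measurable_sing_shift. Qed.

Let integral_sumsing th s (A B : R) : 0 <= th < 1 -> A <= B ->
  (\int[leb]_(x in `[A, B]) sumsing th s x <=
    ((size s)%:R * (B - A + sing_mass th))%:E)%E.
Proof.
move=> th1 AB; rewrite /sumsing ge0_integral_sum//.
- apply: (@le_trans _ _ (\sum_(u <- s) (B - A + sing_mass th)%:E)%E).
    by apply: lee_sum => u _; exact: integral_sing.
  rewrite sumEFin lee_fin big_const_seq count_predT iter_addr_0.
  by rewrite mulr_natl.
- by move=> u; apply: measurable_funTS; exact: measurable_sing_shift.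
- by move=> u x _; exact: sing_ge0.
Qed.

(** The hypothesis on [f] is a product rather than a bound by an inverse power, so it stays
    meaningful in the two singular directions, parallel and opposite to [e]. *)
Lemma sphere_bound (th : R) : 0 <= th < 1 -> exists2 S, 0 < S &
  forall (e : vec3 R) (f : vec3 R -> R) (B : R), dot e e = 1 -> 0 < B ->
    measurable_fun setT f -> (forall w, 0 <= f w) ->
    (forall w, dot w w = 1 -> f w * (1 - dot e w ^+ 2) `^ th <= B) ->
  (\int[sphere_measure]_w (f w)%:E <= (B * S)%:E)%E.
Proof.
move=> thb; have /andP[th0 th1] := thb.
have m0 := sing_mass_gt0 th0 th1.
(* Four heights over an interval of length 2, five longitudes over one of length 2 pi; 8^th stems
   from the factor 1/8 in [sphere_chart_lower]. *)
pose S := 8 `^ th * ((4 * (2 + sing_mass th)) * (5 * (2 * pi + sing_mass th))).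
exists S.
  by rewrite /S !mulr_gt0// ?powR_gt0// ?addr_gt0// mulr_gt0// pi_gt0.
move=> e f B e1 B0 mf f0 fB.
have [c [phi0 [phi0pi lower]]] := sphere_chart_lower e1.
pose G z := sumsing th [:: 1; -1; c; - c] z.
pose H phi := sumsing th [seq phi0 + v | v <- turns R] phi.
pose K := B * 8 `^ th; have K0 : 0 < K by rewrite mulr_gt0// powR_gt0.
have G0 z : (0 <= G z)%E by exact: sumsing_ge0.
have H0 z : (0 <= H z)%E by exact: sumsing_ge0.
have fK z phi : -1 <= z <= 1 -> 0 <= phi <= 2 * pi ->
    ((f (sphere_chart (z, phi)))%:E <= K%:E * (G z * H phi))%E.
  move=> z1 phi1; have [u [v [us vs]]] := lower z phi z1 phi1.
  set w := sphere_chart _; set kappa := 1 - _ => uvk.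
  have w1 : dot w w = 1 by exact: sphere_chart_unit.
  have Gu := sumsing_ge th z us.
  have vs' : phi0 + v \in [seq phi0 + v | v <- turns R] by exact: map_f.
  have Hv := sumsing_ge th phi vs'.
  have G1 := sumsing_ge1 th z us.
  have H1 := sumsing_ge1 th phi vs'.
  have Gp : (0 < G z)%E by exact: lt_le_trans G1.
  have Hp : (0 < H phi)%E by exact: lt_le_trans H1.
  (* On the singular height or longitude the majorant is infinite, and there is nothing to prove. *)
  have [zu|zu] := eqVneq (z - u) 0.
    move: Gu; rewrite zu sing0// leye_eq => /eqP; rewrite -/(G z) => ->.
    by rewrite gt0_mulye// gt0_muley ?lte_fin// leey.
  have [pv|pv] := eqVneq (phi - (phi0 + v)) 0.
    move: Hv; rewrite pv sing0// leye_eq => /eqP; rewrite -/(H phi) => ->.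
    by rewrite gt0_muley// gt0_muley ?lte_fin// leey.
  have := sing_lower th0 zu; have := sing_lower th0 pv.
  set a := `|z - u| in uvk *; set b := `|phi - _| in uvk * => hb ha.
  have a0 : 0 < a by rewrite normr_gt0.
  have b0 : 0 < b by rewrite normr_gt0.
  have k0 : 0 < kappa by apply: lt_le_trans uvk; rewrite divr_gt0// mulr_gt0.
  apply: (@le_trans _ _ (K%:E * ((a `^ - th)%:E * (b `^ - th)%:E))%E); last first.
    rewrite lee_pmul2l ?lte_fin//; apply: lee_pmul; rewrite ?lee_fin ?powR_ge0//.
      exact: le_trans Gu.
    exact: le_trans Hv.
  rewrite -!EFinM lee_fin.
  have := fB w w1; rewrite -/kappa -ler_pdivlMr ?powR_gt0// => /le_trans; apply.
  rewrite /K -mulrA ler_pM2l//.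
  rewrite (_ : 8 `^ th * _ = ((a * b / 8) `^ th)^-1).
    rewrite lef_pV2 ?posrE ?powR_gt0 ?divr_gt0 ?mulr_gt0//.
    apply: (ge0_ler_powR th0) => //; rewrite nnegrE ltW//.
    by rewrite divr_gt0// mulr_gt0.
  rewrite !powRM ?mulr_ge0 ?invr_ge0 ?(ltW a0) ?(ltW b0)//.
  rewrite -(powR_inv1 (ler0n _ 8)) (powRAC 8 (-1)) powR_inv1 ?powR_ge0//.
  rewrite !invfM invrK !powRN; ring.
have mfc : measurable_fun setT (fun x => (f (sphere_chart x))%:E).
  apply/measurable_EFinP; apply: measurableT_comp => //.
  exact: measurable_sphere_chart.
rewrite ge0_integral_pushforward//=; last first.
- by move=> w _; rewrite lee_fin.
- exact/measurable_EFinP.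
- exact: measurable_sphere_chart.
rewrite preimage_setT integral_mrestr//; last by move=> x; rewrite lee_fin.
rewrite integral_mkcond.
pose G' := G \_ `[-1, 1]; pose H' := H \_ `[0, 2 * pi].
have G'0 z : (0 <= G' z)%E by rewrite /G' patchE; case: ifP.
have H'0 z : (0 <= H' z)%E by rewrite /H' patchE; case: ifP.
have mG' : measurable_fun setT G'.
  apply/(measurable_restrictT _ (measurable_itv _)).
  by apply: measurable_funTS; exact: measurable_sumsing.
have mH' : measurable_fun setT H'.
  apply/(measurable_restrictT _ (measurable_itv _)).
  by apply: measurable_funTS; exact: measurable_sumsing.
have mGH : measurable_fun setT (fun x : vec2 R => G' x.1 * H' x.2)%E.
  by apply: emeasurable_funM; exact: measurableT_comp.
apply: (@le_trans _ _ (\int[leb2]_x (K%:E * (G' x.1 * H' x.2)))%E).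
  apply: ge0_le_integral => //.
  - by move=> x _; rewrite patchE; case: ifP => // _; rewrite lee_fin.
  - by apply/(measurable_restrictT _ measurable_chart_domain); exact: measurable_funTS.
  - exact: measurable_funeM.
  move=> [z phi] _; rewrite patchE; case: ifPn => [|_]; last first.
    by rewrite !mule_ge0// lee_fin ltW.
  rewrite inE /chart_domain => -[/=]; rewrite !in_itv/= => z1 phi1.
  rewrite /G' /H' !patchE !mem_set/= ?in_itv//; exact: fK.
have GH0 x : setT x -> (0 <= G' x.1 * H' x.2)%E by move=> _; rewrite mule_ge0.
have -> : (\int[leb2]_x (K%:E * (G' x.1 * H' x.2)) =
    K%:E * \int[leb2]_x (G' x.1 * H' x.2))%E.
  exact: (ge0_integralZl_EFin leb2 measurableT GH0 mGH (ltW K0)).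
rewrite /S (_ : B * _ = K * ((4 * (2 + sing_mass th)) * (5 * (2 * pi + sing_mass th))));
  last by rewrite /K; ring.
rewrite (EFinM K) lee_pmul2l ?lte_fin//.
rewrite (fubini_tonelli1 (m1 := leb) (m2 := leb) (fun x => G' x.1 * H' x.2)%E)//=;
  last by move=> x; rewrite mule_ge0.
rewrite /fubini_F/=.
under eq_integral do rewrite ge0_integralZl//.
rewrite ge0_integralZr//; last exact: integral_ge0.
rewrite EFinM; apply: lee_pmul; [exact: integral_ge0|exact: integral_ge0| |].
  rewrite -integral_mkcond.
  have := @integral_sumsing th [:: 1; -1; c; - c] (-1) 1 thb.
  rewrite opprK (_ : 1 + 1 = 2)//; apply; lra.
rewrite -integral_mkcond.
have := @integral_sumsing th [seq phi0 + v | v <- turns R] 0 (2 * pi) thb.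
rewrite subr0 size_map; apply; by rewrite mulr_ge0// pi_ge0.
Qed.

End SphereIntegral.

(** * Momentum integrals and the collision kernel *)

Section MomentumIntegrals.
Context (R : realType).
Notation leb := (@lebesgue_measure R).
Implicit Types (p q : vec3 R) (x dl : R).

(** The rate 1 gives the weight m and the rate 1/2 the weight n; both satisfy the same estimates.
    The value at the origin is 0 by the convention on inverses. *)
Definition wt dl p : R := (enorm p)^-1 * expR (- (dl * enorm p)).

Lemma wt_ge0 dl p : 0 <= wt dl p.
Proof. by rewrite mulr_ge0 ?invr_ge0 ?enorm_ge0 ?expR_ge0. Qed.

Lemma measurable_wt dl : measurable_fun setT (wt dl).
Proof.
apply: measurable_funM.
  by apply: measurable_inv; exact: measurable_enorm.
apply: measurableT_comp => //; apply: measurable_funN.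
by apply: measurable_funM => //; exact: measurable_enorm.
Qed.

Lemma integral_expRN_abs (k : R) : 0 < k ->
  (\int[leb]_x (expR (- (k * `|x|)))%:E <= (2 / k)%:E)%E.
Proof.
move=> k0; have k0' := ltW k0.
have cf : continuous (fun x : R => expR (- (k * `|x|)) : R).
  move=> x; apply: continuous_comp; last exact: continuous_expR.
  by apply: cvgN; apply: cvgM; [exact: cvg_cst|exact: norm_continuous].
rewrite (ge0_symfun_integralT (fun x => expR_ge0 _) cf); last first.
  by move=> x /=; rewrite normrN.
rewrite EFinM lee_pmul2l//.
have mA : measurable [set x : R | 0 <= x] by exact: measurable_set_ge0.
have mf : measurable_fun [set x : R | 0 <= x] (fun x : R => (expR (- (k * `|x|)))%:E).
  apply: measurable_funTS; apply/measurable_EFinP.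
  exact: continuous_measurable_fun.
rewrite -(@lee_pmul2l _ k%:E)// ?lte_fin// -EFinM divff ?gt_eqF//.
rewrite -ge0_integralZl_EFin//.
rewrite -(integral_exponential_pdf k0).
apply: (@le_trans _ _ (\int[leb]_(x in [set x : R | (0 <= x)%R]) (exponential_pdf k x)%:E)%E).
  apply: ge0_le_integral => //.
  - by move=> x _; rewrite mule_ge0// lee_fin ?expR_ge0.
  - exact: measurable_funeM.
  - by apply: measurable_funTS; apply/measurable_EFinP; exact: measurable_exponential_pdf.
  move=> x /= x0; rewrite exponential_pdfE// ger0_norm// -EFinM lee_fin.
  by rewrite mulNr.
apply: ge0_subset_integral => //.
- by apply/measurable_EFinP; exact: measurable_exponential_pdf.
- by move=> x _; rewrite lee_fin exponential_pdf_ge0.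
Qed.

(** The exponent 1/3 shares the singularity 1/|q| equally among the three coordinates, each factor
    being integrable on the line. *)
Let th : R := 3^-1.
Let th0 : 0 <= th. Proof. by rewrite invr_ge0. Qed.
Let th1 : th < 1. Proof. by rewrite invf_lt1// ltr1n. Qed.
Let thb : 0 <= th < 1. Proof. by rewrite th0. Qed.

Let singI : R -> \bar R := sing th \_ `[-1, 1].

Let ph x : \bar R := ((expR (- (12^-1 * `|x|)))%:E + singI x)%E.

Let singI0 x : (0 <= singI x)%E.
Proof. by rewrite /singI patchE; case: ifP => // _; exact: sing_ge0. Qed.

Let mexp : measurable_fun setT (fun x : R => (expR (- (12^-1 * `|x|)))%:E).
Proof.
apply/measurable_EFinP; apply: measurableT_comp => //; apply: measurable_funN.
by apply: measurable_funM => //; exact: measurableT_comp.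
Qed.

Let msing : measurable_fun setT singI.
Proof.
apply/(measurable_restrictT _ (measurable_itv _)).
by apply: measurable_funTS; exact: measurable_sing.
Qed.

Let mph : measurable_fun setT ph. Proof. exact: emeasurable_funD. Qed.

Let ph_gt0 x : (0 < ph x)%E.
Proof. by rewrite /ph (@lt_le_trans _ _ (expR (- (12^-1 * `|x|)))%:E)// ?lte_fin ?expR_gt0// leeDl. Qed.

Let ph_ge0 x : (0 <= ph x)%E. Proof. exact: ltW. Qed.

Let c1 : R := 24 + (2 + sing_mass th).

Let integral_ph : (\int[leb]_x ph x <= c1%:E)%E.
Proof.
rewrite /ph ge0_integralD//.
rewrite EFinD leeD//.
  have := @integral_expRN_abs 12^-1; rewrite invrK (_ : 2 * 12 = 24 :> R); last by ring.
  by apply; rewrite invr_gt0.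
rewrite -integral_mkcond.
have := @integral_sing R th 0 (-1) 1 thb.
rewrite (_ : (fun x => sing th (x - 0)) = sing th); last first.
  by apply/funext => x; rewrite subr0.
by rewrite (_ : 1 - -1 = 2 :> R); [apply; lra|ring].
Qed.

Let ph_lower x : x != 0 ->
  ((`|x| `^ (- th) * expR (- (12^-1 * `|x|)))%:E <= ph x)%E.
Proof.
move=> x0; have nx : 0 < `|x| by rewrite normr_gt0.
have [x1|x1] := leP `|x| 1; rewrite /ph.
  apply: (@le_trans _ _ (singI x)); last by rewrite leeDr// lee_fin expR_ge0.
  rewrite /singI patchE ifT; last by rewrite inE/= in_itv/= -ler_norml.
  apply: le_trans (sing_lower th0 x0); rewrite lee_fin ler_piMr ?powR_ge0//.
apply: (@le_trans _ _ (expR (- (12^-1 * `|x|)))%:E); last by rewrite leeDl.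
rewrite lee_fin ler_piMl ?expR_ge0//.
rewrite powRN invf_le1 ?powR_gt0//.
by rewrite -(powRr0 `|x|); apply: ler_powR => //; exact: ltW.
Qed.

Let ph0 : ph 0 = +oo%E.
Proof.
by rewrite /ph /singI patchE ifT ?sing0// ?addeey//; rewrite inE/= in_itv/=; apply/andP; split; lra.
Qed.

Lemma abs_le_enorm q : [/\ `|q.1.1| <= enorm q, `|q.1.2| <= enorm q & `|q.2| <= enorm q].
Proof.
by split; rewrite -sqrtr_sqr /enorm ler_wsqrtr// /dot -!expr2;
  have := sqr_ge0 q.1.1; have := sqr_ge0 q.1.2; have := sqr_ge0 q.2; lra.
Qed.

(** Every coordinate is at most |q| in absolute value. Hence 1/|q| <= |x y z|^(-1/3), and the
    exponential of rate 1/4 splits into three of rate 1/12. *)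
Let yukawa_le q : ((wt 4^-1 q)%:E <= ph q.1.1 * ph q.1.2 * ph q.2)%E.
Proof.
case: q => -[x y] z /=.
have [->|x0] := eqVneq x 0.
  by rewrite ph0 gt0_mulye// gt0_mulye// leey.
have [->|y0] := eqVneq y 0.
  by rewrite ph0 gt0_muley// gt0_mulye// leey.
have [->|z0] := eqVneq z 0.
  by rewrite ph0 gt0_muley ?mule_gt0// leey.
have e0 (u : R) : (0 <= (`|u| `^ (- th) * expR (- (12^-1 * `|u|)))%:E)%E.
  by rewrite lee_fin mulr_ge0 ?powR_ge0 ?expR_ge0.
have xy := lee_pmul (e0 x) (e0 y) (ph_lower x0) (ph_lower y0).
apply: le_trans (lee_pmul (mule_ge0 (e0 x) (e0 y)) (e0 z) xy (ph_lower z0)).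
rewrite -!EFinM lee_fin.
have [/=] := abs_le_enorm ((x, y), z); set N := enorm _ => xN yN zN.
have nx : 0 < `|x| by rewrite normr_gt0.
have ny : 0 < `|y| by rewrite normr_gt0.
have nz : 0 < `|z| by rewrite normr_gt0.
have N0 : 0 < N by exact: lt_le_trans xN.
rewrite [leRHS](_ : _ = (`|x| `^ (- th) * `|y| `^ (- th) * `|z| `^ (- th)) *
  (expR (- (12^-1 * `|x|)) * expR (- (12^-1 * `|y|)) * expR (- (12^-1 * `|z|))));
  last by ring.
rewrite -!expRD /wt -/N; apply: ler_pM; rewrite ?invr_ge0 ?expR_ge0 ?(ltW N0)//.
  rewrite !powRN -!invfM -!powRM ?mulr_ge0 ?normr_ge0//.
  rewrite lef_pV2 ?posrE ?powR_gt0 ?mulr_gt0//.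
  have -> : N = (N * N * N) `^ th.
    rewrite -[N * N * N](_ : N ^+ 3 = _); last by ring.
    by rewrite -powR_mulrn ?ltW// -powRrM divff// powRr1// ltW.
  apply: (ge0_ler_powR th0); rewrite ?nnegrE ?mulr_ge0 ?(ltW N0) ?(ltW nx) ?(ltW ny) ?(ltW nz)//.
  by apply: ler_pM; rewrite ?mulr_ge0//; exact: ler_pM.
by rewrite ler_expR; lra.
Qed.

Let ph_prod : (\int[leb3]_q (ph q.1.1 * ph q.1.2 * ph q.2) <= (c1 * c1 * c1)%:E)%E.
Proof.
have m2 : measurable_fun setT (fun x : vec2 R => ph x.1 * ph x.2)%E.
  by apply: emeasurable_funM; exact: measurableT_comp.
have m3 : measurable_fun setT (fun q : vec3 R => ph q.1.1 * ph q.1.2 * ph q.2)%E.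
  apply: emeasurable_funM; last exact: measurableT_comp.
  exact: (measurableT_comp m2).
have i2 : (\int[leb2]_x (ph x.1 * ph x.2) <= (c1 * c1)%:E)%E.
  rewrite (fubini_tonelli1 (m1 := leb) (m2 := leb) (fun x : vec2 R => ph x.1 * ph x.2)%E)//=;
    last by move=> x; rewrite mule_ge0.
  rewrite /fubini_F/=; under eq_integral do rewrite ge0_integralZl//.
  rewrite ge0_integralZr//; last exact: integral_ge0.
  rewrite EFinM; apply: lee_pmul; [exact: integral_ge0|exact: integral_ge0|
    exact: integral_ph|exact: integral_ph].
rewrite (fubini_tonelli1 (m1 := leb2) (m2 := leb)
  (fun q : vec3 R => ph q.1.1 * ph q.1.2 * ph q.2)%E)//=;
  last by move=> x; rewrite !mule_ge0.
rewrite /fubini_F/=; under eq_integral do rewrite ge0_integralZl// ?mule_ge0//.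
rewrite ge0_integralZr//; last 2 first.
- by move=> x _; rewrite mule_ge0.
- exact: integral_ge0.
rewrite EFinM; apply: lee_pmul; [|exact: integral_ge0|exact: i2|exact: integral_ph].
by apply: integral_ge0 => x _; rewrite mule_ge0.
Qed.

Definition moment_bound : R := 64 * (c1 * c1 * c1).

Lemma moment_bound_gt0 : 0 < moment_bound.
Proof.
have m0 := sing_mass_gt0 th0 th1.
by rewrite /moment_bound /c1 !mulr_gt0//; lra.
Qed.

(** The polynomial is paid for by part of the exponential: (1 + N)^2 <= 64 e^(N/4), so that a rate
    of at least 1/2 leaves a rate of 1/4. *)
Lemma wt_moment dl : 2^-1 <= dl ->
  (\int[leb3]_q ((1 + enorm q) ^+ 2 * wt dl q)%:E <= moment_bound%:E)%E.
Proof.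
move=> dl2.
have m1 : measurable_fun setT (fun q : vec3 R => ((1 + enorm q) ^+ 2 * wt dl q)%:E).
  apply/measurable_EFinP; apply: measurable_funM; last exact: measurable_wt.
  by apply: measurable_funX; apply: measurable_funD => //; exact: measurable_enorm.
have m3 : measurable_fun setT (fun q : vec3 R => ph q.1.1 * ph q.1.2 * ph q.2)%E.
  apply: emeasurable_funM; last exact: measurableT_comp.
  by apply: emeasurable_funM; apply: measurableT_comp => //;
    [exact: (measurableT_comp (f := fst))|exact: (measurableT_comp (f := snd))].
apply: (@le_trans _ _ (\int[leb3]_q (64%:E * (ph q.1.1 * ph q.1.2 * ph q.2)))%E).
  apply: ge0_le_integral => //.
  - by move=> q _; rewrite lee_fin mulr_ge0 ?wt_ge0 ?sqr_ge0.
  - exact: measurable_funeM.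
  move=> q _; apply: (@le_trans _ _ (64 * wt 4^-1 q)%:E); last first.
    by rewrite EFinM; apply: lee_wpmul2l => //; exact: yukawa_le.
  rewrite lee_fin /wt mulrCA [leRHS]mulrCA ler_wpM2l ?invr_ge0 ?enorm_ge0//.
  have N0 := enorm_ge0 q; set N := enorm q in N0 *.
  have e8 := expR_ge1Dx (N / 8).
  have s8 : (1 + N) ^+ 2 <= 64 * expR (N / 4).
    have -> : N / 4 = N / 8 + N / 8 by field.
    rewrite expRD; have h1 : 1 + N <= 8 * expR (N / 8) by lra.
    have h2 : (1 + N) ^+ 2 <= (8 * expR (N / 8)) ^+ 2.
      by apply: lerXn2r => //; rewrite nnegrE; lra.
    by apply: (le_trans h2); rewrite le_eqVlt; apply/orP; left; apply/eqP; ring.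
  apply: (@le_trans _ _ (64 * expR (N / 4) * expR (- (2^-1 * N)))).
    apply: ler_pM => //; rewrite ?sqr_ge0 ?expR_ge0//.
    by rewrite ler_expR lerN2 ler_wpM2r.
  rewrite -mulrA -expRD ler_wpM2l// ler_expR; lra.
rewrite ge0_integralZl_EFin//; last by move=> q _; rewrite !mule_ge0.
by rewrite /moment_bound EFinM; apply: lee_wpmul2l => //; exact: ph_prod.
Qed.

End MomentumIntegrals.

(** * The collision kernel fulfils the abstract estimates *)

Section CollisionKernel.
Context (R : realType) (a : R) (ha : 0 <= a < 2).
Implicit Types (p q w e : vec3 R) (z : vec3 R * vec3 R) (f : vec3 R -> R).

(* The post-collision maps are cut off where the kernel vanishes, so that
   they pull null sets back to null sets. *)
Definition colliding p z := (0 < varrho p z.1) && (dot z.2 z.2 == 1).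

Definition kern p z : R := if colliding p z then
  varrho p z.1 `^ (2 + a) / (enorm p * enorm z.1) else 0.

Definition out_p p z := if colliding p z then post_p p z.1 z.2 else z.1.

Definition out_q p z := if colliding p z then post_q p z.1 z.2 else z.1.

Let a0 : 0 <= a. Proof. by case/andP: ha. Qed.
Let a2 : a < 2. Proof. by case/andP: ha. Qed.

Section measurability.
Let T : measurableType _ := (vec3 R * (vec3 R * vec3 R))%type.

Let m2 : measurable_fun setT (fun x : T => x.2.1).
Proof. exact: (measurableT_comp (f := fst)). Qed.

Let m3 : measurable_fun setT (fun x : T => x.2.2).
Proof. exact: (measurableT_comp (f := snd)). Qed.

Lemma measurable_colliding : measurable_fun setT (fun x : T => colliding x.1 x.2).
Proof.
apply: measurable_and.
  by apply: measurable_fun_ltr => //; exact: measurable_varrho.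
by apply: measurable_fun_eqr => //; exact: measurable_dot.
Qed.

Lemma measurable_kern : measurable_fun setT (fun x : T => kern x.1 x.2).
Proof.
apply: measurable_fun_ifT => //; first exact: measurable_colliding.
apply: measurable_funM.
  have := measurableT_comp (@measurable_powR R (2 + a))
    (@measurable_varrho _ _ T _ _ measurable_fst m2).
  exact.
apply: measurable_inv; apply: measurable_funM; exact: measurable_enorm.
Qed.

Lemma measurable_out_p : measurable_fun setT (fun x : T => out_p x.1 x.2).
Proof.
apply: measurable_fun_ifT => //; first exact: measurable_colliding.
exact: measurable_post_p.
Qed.

Lemma measurable_out_q : measurable_fun setT (fun x : T => out_q x.1 x.2).
Proof.
apply: measurable_fun_ifT => //; first exact: measurable_colliding.
rewrite (_ : (fun x : T => _) = (fun x : T => post_p x.1 x.2.1 (- x.2.2))).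
  by apply: measurable_post_p => //; exact: measurable_vecN.
by apply/funext => x; rewrite post_qE.
Qed.

End measurability.

Lemma kern_ge0 p z : 0 <= kern p z.
Proof.
rewrite /kern; case: ifP => // _.
by rewrite mulr_ge0 ?powR_ge0 ?invr_ge0 ?mulr_ge0 ?enorm_ge0.
Qed.

Lemma varrho_gt0 p q : 0 < varrho p q -> 0 < enorm p /\ 0 < enorm q.
Proof.
move=> r0; have := varrho_le p q.
have : 0 < varrho p q ^+ 2 by rewrite exprn_gt0.
have := enorm_ge0 p; have := enorm_ge0 q.
rewrite le_eqVlt => /orP[/eqP<-|q0]; first by rewrite mulr0 mulr0 => _ /lt_le_trans /[apply]; rewrite ltxx.
rewrite le_eqVlt => /orP[/eqP<-|p0//]; by rewrite mul0r mulr0 => /lt_le_trans /[apply]; rewrite ltxx.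
Qed.

Lemma powR_le_1D (x b : R) (c : nat) : 0 <= x -> 0 <= b <= c%:R ->
  x `^ b <= (1 + x) ^+ c.
Proof.
move=> x0 /andP[b0 bc].
apply: (@le_trans _ _ ((1 + x) `^ b)).
  by apply: (ge0_ler_powR b0); rewrite ?nnegrE; lra.
by rewrite -powR_mulrn; [apply: ler_powR => //|]; lra.
Qed.

Lemma unit_along p : exists2 e, dot e e = 1 &
  forall w, dot p w = enorm p * dot e w.
Proof.
have [n0|n0] := eqVneq (enorm p) 0.
  exists (0, 0, 1) => [|w]; first by rewrite /dot/=; ring.
  have := dot_cauchy_sqr p w; rewrite -enorm_sqr n0 expr0n/= !mul0r => h.
  by apply/eqP; rewrite -sqrf_eq0 eq_le sqr_ge0 andbT.
exists ((enorm p)^-1 *: p) => [|w].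
  by rewrite dotZl dotZr -enorm_sqr expr2 mulKf// mulVf.
by rewrite dotZl mulVKf.
Qed.

(* Interpolating [y] between the two lower bounds [rho ^ 2] and [s ^ 2 * k]
   trades the singularity of the gain kernel for an integrable power of the
   angle. *)
Let interpolation (rho s N k y : R) : 0 < rho -> 0 < s -> 0 <= N -> 0 <= k ->
    rho ^+ 2 <= y -> s ^+ 2 * k <= y -> rho ^+ 2 <= 4 * (s * N) ->
  rho `^ (2 + a) * k `^ (a / 2) <= 4 `^ a * N `^ a * y.
Proof.
move=> r0 s0 N0 k0 ry sy rs; have a0' := a0; have a2' := a2.
have y0 : 0 < y by apply: lt_le_trans ry; rewrite exprn_gt0.
have E2 (x : R) b : 0 <= x -> (x ^+ 2) `^ b = x `^ (2 * b).
  by move=> x0; rewrite -powR_mulrn// -powRrM.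
have r1 : (rho ^+ 2) `^ (1 - a / 2) <= y `^ (1 - a / 2).
  by apply: ge0_ler_powR => //; rewrite ?nnegrE ?sqr_ge0 ?(ltW y0)//; lra.
have r2 : (s ^+ 2 * k) `^ (a / 2) <= y `^ (a / 2).
  apply: ge0_ler_powR => //; rewrite ?nnegrE ?mulr_ge0 ?sqr_ge0 ?(ltW y0)//; lra.
have r3 : (rho ^+ 2) `^ a <= (4 * (s * N)) `^ a.
  by apply: ge0_ler_powR => //; rewrite ?nnegrE ?sqr_ge0 ?mulr_ge0 ?(ltW s0).
have yE : y = y `^ (1 - a / 2) * y `^ (a / 2).
  by rewrite -powRD ?subrK ?powRr1 ?ltW// oner_eq0.
have := ler_pM (powR_ge0 _ _) (powR_ge0 _ _) r1 r2.
rewrite -yE powRM ?sqr_ge0// !E2 ?(ltW r0) ?(ltW s0)//.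
rewrite (_ : 2 * (1 - a / 2) = 2 - a); last by field.
rewrite (_ : 2 * (a / 2) = a); last by field.
move=> r4; move: r3; rewrite E2 ?(ltW r0)// !powRM ?mulr_ge0 ?(ltW s0)//.
rewrite (_ : 2 + a = (2 - a) + 2 * a); last by ring.
rewrite powRD ?(gt_eqF r0) ?implybT// => r3.
have k1 : 0 <= k `^ (a / 2) by exact: powR_ge0.
have r5 : 0 <= rho `^ (2 - a) by exact: powR_ge0.
apply: (@le_trans _ _ (rho `^ (2 - a) * (4 `^ a * (s `^ a * N `^ a)) * k `^ (a / 2))).
  by rewrite ler_wpM2r// ler_wpM2l.
rewrite [leLHS](_ : _ = 4 `^ a * N `^ a * (rho `^ (2 - a) * (s `^ a * k `^ (a / 2)))); last by ring.
by rewrite ler_wpM2l// mulr_ge0 ?powR_ge0.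
Qed.

(** With [e] along p + q and c = e.w, the quantity y = s^2 - (P c)^2 equals 4 |p'| |q'|, the
    denominator produced by the two outgoing weights. It is at least varrho^2 and at least s^2 (1 -
    c^2), which is what the interpolation consumes; conservation of energy handles the
    exponentials. *)
Let gain_pointwise (dl : R) p q : 0 < varrho p q ->
  exists2 e, dot e e = 1 & forall w, dot w w = 1 ->
    kern p (q, w) * (wt dl (out_p p (q, w)) * wt dl (out_q p (q, w))) *
      (1 - dot e w ^+ 2) `^ (a / 2) <=
    4 * 4 `^ a * (enorm q `^ a * wt dl q) * wt dl p.
Proof.
move=> r0; have [p0 q0] := varrho_gt0 r0.
have [e e1 eP] := unit_along (p + q); exists e => // w w1.
have col : colliding p (q, w) by rewrite /colliding/= r0 w1 eqxx.
rewrite /kern /out_p /out_q col /= /wt enorm_post_p// enorm_post_q// eP.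
have ew : dot e w ^+ 2 <= 1 by have := dot_cauchy_sqr e w; rewrite e1 w1 mulr1.
have := varrho_sqr_energy p q; rewrite -(enorm_sqr (p + q)).
have := varrho_le p q.
move: r0 p0 q0 (enorm_ge0 (p + q)) ew.
move: (varrho p q) (enorm p) (enorm q) (enorm (p + q)) (dot e w) => r x N P c.
move=> r0 x0 N0 P0 c1 rx rP.
set s := x + N in rP *; have s0 : 0 < s by rewrite addr_gt0.
have P2 : 0 <= P ^+ 2 by rewrite sqr_ge0.
have ks : 0 <= 1 - c ^+ 2 by rewrite subr_ge0.
have r2 : 0 < r ^+ 2 by rewrite exprn_gt0.
set y := s ^+ 2 - (P * c) ^+ 2.
have ry : r ^+ 2 <= y.
  by rewrite rP /y exprMn; apply: lerB => //; rewrite ler_piMr.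
have sy : s ^+ 2 * (1 - c ^+ 2) <= y.
  rewrite /y exprMn mulrBr mulr1 lerB// ler_wpM2r ?sqr_ge0//; lra.
have rs : r ^+ 2 <= 4 * (s * N).
  by apply: (le_trans rx); rewrite ler_wpM2l// ler_wpM2r ?ltW// /s ltrDl.
have y0 : 0 < y by exact: lt_le_trans ry.
have H := interpolation r0 s0 (ltW N0) ks ry sy rs.
have nz1 : s + P * c != 0.
  by apply: contraTneq y0 => h; rewrite /y subr_sqr h mulr0 ltxx.
have nz2 : s - P * c != 0.
  by apply: contraTneq y0 => h; rewrite /y subr_sqr h mul0r ltxx.
set E1 := expR (- (dl * ((s + P * c) / 2))).
set E2 := expR (- (dl * ((s - P * c) / 2))).
have EE : E1 * E2 = expR (- (dl * x)) * expR (- (dl * N)).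
  by rewrite /E1 /E2 -!expRD; congr expR; rewrite /s; field.
rewrite [leLHS](_ : _ = (r `^ (2 + a) * (1 - c ^+ 2) `^ (a / 2)) *
  (4 * (E1 * E2) / (x * N * y))); last first.
  by rewrite /y subr_sqr; field; rewrite nz1 nz2 !gt_eqF.
rewrite [leRHS](_ : _ = (4 `^ a * N `^ a * y) * (4 * (E1 * E2) / (x * N * y))); last first.
  by rewrite EE; field; rewrite !gt_eqF.
rewrite ler_wpM2r// mulr_ge0 ?invr_ge0 ?mulr_ge0 ?expR_ge0 ?(ltW x0) ?(ltW N0) ?(ltW y0)//.
Qed.

(** The angular integral has exponent a / 2 < 1 and costs a constant uniform in [p] and [q]; what
    remains in [q] is |q|^a times the weight, a moment of order below 2. *)
Lemma gain_wt : exists2 G : R, 0 < G & forall dl p, 2^-1 <= dl ->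
  (\int[collision_measure]_z
     (kern p z * (wt dl (out_p p z) * wt dl (out_q p z)))%:E <=
   (G * wt dl p)%:E)%E.
Proof.
have a0' := a0; have a2' := a2.
have th1 : 0 <= a / 2 < 1 by apply/andP; split; lra.
have [S S0 HS] := @sphere_bound R (a / 2) th1.
pose k0 : R := 4 * 4 `^ a * S.
have k00 : 0 < k0 by rewrite !mulr_gt0 ?powR_gt0.
exists (k0 * moment_bound R) => [|dl p dl0]; first by rewrite mulr_gt0 ?moment_bound_gt0.
pose F z := kern p z * (wt dl (out_p p z) * wt dl (out_q p z)).
have mF : measurable_fun setT F.
  have mp : measurable_fun setT (fun z : vec3 R * vec3 R => (p, z)) by exact: measurable_pair1.
  apply: measurable_funM; first exact: (measurableT_comp measurable_kern mp).
  apply: measurable_funM; apply: measurableT_comp (measurable_wt dl) _.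
    exact: (measurableT_comp measurable_out_p mp).
  exact: (measurableT_comp measurable_out_q mp).
have kw : 0 <= k0 * wt dl p by apply: mulr_ge0; [exact: ltW|exact: wt_ge0].
have F0 z : 0 <= F z.
  exact: mulr_ge0 (kern_ge0 _ _) (mulr_ge0 (wt_ge0 _ _) (wt_ge0 _ _)).
have mG : measurable_fun setT (fun q => (k0 * wt dl p * ((1 + enorm q) ^+ 2 * wt dl q))%:E).
  apply/measurable_EFinP; apply: measurable_funM => //.
  apply: measurable_funM; last exact: measurable_wt.
  by apply: measurable_funX; apply: measurable_funD => //; exact: measurable_enorm.
rewrite (fubini_tonelli1 (m1 := leb3) (m2 := sphere_measure) (EFin \o F)).
- apply: (@le_trans _ _ (\int[leb3]_q (k0 * wt dl p * ((1 + enorm q) ^+ 2 * wt dl q))%:E)%E).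
    apply: ge0_le_integral => //.
    - by move=> q _; apply: integral_ge0 => w _; rewrite lee_fin.
    - apply: measurable_fun_fubini_tonelli_F => //; exact/measurable_EFinP.
    move=> q _; rewrite /fubini_F.
    have [r0|r0] := boolP (0 < varrho p q).
      have [e e1 He] := gain_pointwise dl r0.
      have [p0 q0] := varrho_gt0 r0.
      have mFq : measurable_fun setT (fun w : vec3 R => F (q, w)).
        by apply: (measurableT_comp mF); exact: measurable_pair1.
      apply: (le_trans (HS e _ _ e1 _ mFq (fun w => F0 _) He)).
        by rewrite !mulr_gt0 ?powR_gt0 ?invr_gt0 ?expR_gt0.
      rewrite lee_fin [leLHS](_ : _ = k0 * wt dl p * (enorm q `^ a * wt dl q)); last by rewrite /k0; ring.
      rewrite (ler_wpM2l kw)// ler_wpM2r ?wt_ge0//.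
      by apply: powR_le_1D; rewrite ?enorm_ge0// a0 ltW.
    rewrite integral0_eq; first by rewrite lee_fin (mulr_ge0 kw)// mulr_ge0 ?wt_ge0 ?sqr_ge0.
    move=> w _ /=.
    by rewrite /F /kern /colliding/= (negbTE r0) mul0r.
  under eq_integral do rewrite EFinM.
  rewrite ge0_integralZl_EFin//.
  - rewrite (_ : k0 * _ * _ = k0 * wt dl p * moment_bound R); last by ring.
    by rewrite [leRHS]EFinM lee_wpmul2l//; exact: wt_moment.
  - by move=> q _; rewrite lee_fin mulr_ge0 ?wt_ge0 ?sqr_ge0.
  - apply/measurable_EFinP.
    apply: measurable_funM; last exact: measurable_wt.
    by apply: measurable_funX; apply: measurable_funD => //; exact: measurable_enorm.
- exact/measurable_EFinP.
- by move=> z; rewrite lee_fin.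
Qed.

(** By varrho^2 <= 4 |p| |q|, division by |p| |q| leaves a power a / 2 of |p| |q|; as a < 2, the
    growth in [p] is at most linear. *)
Let kern_le p z : kern p z <= 16 * (1 + enorm p) * (1 + enorm z.1) ^+ 2.
Proof.
have a0' := a0; have a2' := a2.
rewrite /kern; case: ifPn => [/andP[r0 _]|_]; last first.
  by rewrite !mulr_ge0 ?sqr_ge0// addr_ge0 ?enorm_ge0.
have [p0 q0] := varrho_gt0 r0.
have := varrho_le p z.1; move: r0 p0 q0.
move: (varrho p z.1) (enorm p) (enorm z.1) => r x N r0 x0 N0 rx.
rewrite ler_pdivrMr ?mulr_gt0//.
have X0 : 0 <= 4 * (x * N) by rewrite !mulr_ge0 ?ltW.
have -> : r `^ (2 + a) = (r ^+ 2) `^ (1 + a / 2).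
  by rewrite -powR_mulrn ?(ltW r0)// -powRrM; congr (_ `^ _); field.
apply: (@le_trans _ _ ((4 * (x * N)) `^ (1 + a / 2))).
  by apply: ge0_ler_powR; rewrite ?nnegrE ?sqr_ge0//; lra.
rewrite powRD ?(gt_eqF (mulr_gt0 _ (mulr_gt0 x0 N0))) ?implybT// powRr1// !powRM ?(ltW x0) ?(ltW N0) ?mulr_ge0 ?(ltW x0) ?(ltW N0)//.
have h1 : 4 `^ (a / 2) <= 4 :> R.
  by rewrite -[leRHS]powRr1//; apply: ler_powR; lra.
have h2 : x `^ (a / 2) <= 1 + x.
  by rewrite -[leRHS]expr1; apply: powR_le_1D; rewrite ?(ltW x0) ?(ltW N0)//; apply/andP; split; lra.
have h3 : N `^ (a / 2) <= (1 + N) ^+ 2.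
  by apply: powR_le_1D; rewrite ?(ltW x0) ?(ltW N0)//; apply/andP; split; lra.
rewrite [leRHS](_ : _ = 4 * (x * N) * (4 * ((1 + x) * (1 + N) ^+ 2))); last by ring.
rewrite ler_wpM2l//; apply: ler_pM; rewrite ?mulr_ge0 ?powR_ge0//.
by apply: ler_pM; rewrite ?powR_ge0.
Qed.

Lemma loss_wt dl p : 2^-1 <= dl ->
  (\int[collision_measure]_z (kern p z * wt dl z.1)%:E <=
   (64 * pi * moment_bound R * (1 + enorm p))%:E)%E.
Proof.
move=> dl0.
have mG : measurable_fun setT (fun q : vec3 R => (1 + enorm q) ^+ 2 * wt dl q).
  apply: measurable_funM; last exact: measurable_wt.
  by apply: measurable_funX; apply: measurable_funD => //; exact: measurable_enorm.
have mG2 : measurable_fun setT (fun z : vec3 R * vec3 R => (1 + enorm z.1) ^+ 2 * wt dl z.1).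
  exact: (measurableT_comp mG).
have p0 : 0 <= 1 + enorm p by rewrite addr_ge0 ?enorm_ge0.
have G0 q : 0 <= (1 + enorm q) ^+ 2 * wt dl q by rewrite mulr_ge0 ?wt_ge0 ?sqr_ge0.
apply: (@le_trans _ _ (\int[collision_measure]_z ((16 * (1 + enorm p))%:E *
    ((1 + enorm z.1) ^+ 2 * wt dl z.1)%:E))%E).
  apply: ge0_le_integral => //.
  - by move=> z _; rewrite lee_fin mulr_ge0 ?kern_ge0 ?wt_ge0.
  - apply/measurable_EFinP; apply: measurable_funM.
      exact: (measurableT_comp measurable_kern (measurable_pair1 _)).
    exact: (measurableT_comp (measurable_wt dl)).
  - by apply: measurable_funeM; exact/measurable_EFinP.
  - by move=> z _; rewrite -EFinM lee_fin [leRHS]mulrA ler_wpM2r ?wt_ge0 ?kern_le.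
rewrite ge0_integralZl_EFin//; last 3 first.
- by move=> z _; rewrite lee_fin.
- exact/measurable_EFinP.
- by rewrite mulr_ge0.
rewrite (fubini_tonelli1 (m1 := leb3) (m2 := sphere_measure)
  (fun z => ((1 + enorm z.1) ^+ 2 * wt dl z.1)%:E))//=; last 2 first.
- exact/measurable_EFinP.
- by move=> z; rewrite lee_fin.
rewrite /fubini_F/=; under eq_integral do rewrite integral_cst// [X in (_ * X)%E]sphere_measureT.
rewrite ge0_integralZr//; last 3 first.
- exact/measurable_EFinP.
- by move=> q _; rewrite lee_fin.
- by rewrite lee_fin mulr_ge0// pi_ge0.
rewrite (_ : 64 * pi * _ * _ = 16 * (1 + enorm p) * (moment_bound R * (4 * pi))); last by ring.
rewrite [leRHS]EFinM lee_wpmul2l ?lee_fin ?mulr_ge0//.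
rewrite (EFinM (moment_bound R)) lee_wpmul2r ?lee_fin ?mulr_ge0 ?pi_ge0//.
exact: wt_moment.
Qed.

Lemma kinetic_kern : exists2 C : R, 1 <= C &
  kinetic collision_measure kern out_p out_q fst (wt 1) (wt 2^-1)
    (fun p => 1 + enorm p) C.
Proof.
have [G G0 HG] := gain_wt.
pose L : R := 64 * pi * moment_bound R.
have L0 : 0 <= L.
  apply: mulr_ge0; last exact: ltW (moment_bound_gt0 R).
  by rewrite mulr_ge0 ?pi_ge0.
exists (2 + G + L) => [|]; first by lra.
split.
- exact: measurable_kern.
- exact: measurable_out_p.
- exact: measurable_out_q.
- exact: measurable_fst.
- exact: measurable_wt.
- exact: measurable_wt.
- exact: kern_ge0.
- by move=> p; exact: wt_ge0.
- move=> p; rewrite ler_wpM2l ?invr_ge0 ?enorm_ge0// ler_expR.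
  by have := enorm_ge0 p; lra.
- by move=> p; rewrite addr_ge0 ?enorm_ge0.
- move=> p; apply: (@le_trans _ _ (2 * wt 2^-1 p)); last by rewrite ler_wpM2r ?wt_ge0//; lra.
  rewrite /wt -[leLHS]mulrA [leRHS]mulrCA ler_wpM2l ?invr_ge0 ?enorm_ge0//.
  have := expR_ge1Dx (2^-1 * enorm p); have := enorm_ge0 p.
  move: (enorm p) => x x0 h.
  have -> : - (1 * x) = - (2^-1 * x) - 2^-1 * x by field.
  rewrite expRD -mulrA mulrC ler_wpM2r ?expR_ge0//.
  by rewrite expRN mulrC ler_pdivrMr ?expR_gt0//; lra.
- move=> p; apply: le_trans (HG 1 p _) _; first by rewrite invf_le1//; lra.
  by rewrite lee_fin ler_wpM2r ?wt_ge0//; lra.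
- move=> p; apply: le_trans (HG _ p (lexx _)) _.
  by rewrite lee_fin ler_wpM2r ?wt_ge0//; lra.
- move=> p; apply: le_trans (@loss_wt _ p (lexx _)) _.
  by rewrite lee_fin ler_wpM2r ?addr_ge0 ?enorm_ge0// -/L; lra.
Qed.

(** Colliding pairs are covered by the nonsingularity of p' and q'. For the others the cut-off maps
    return the partner momentum, which avoids a null set for almost every collision parameter. *)
Lemma seen_ae (A : vec3 R -> Prop) : (\forall p \ae leb3, A p) ->
  \forall p \ae leb3, seen collision_measure out_p out_q fst p A.
Proof.
move=> [N [mN N0 AN]].
have N1 : \forall z \ae collision_measure, ~ N z.1.
  exists (N `*` setT); split.
  - exact: measurableX.
  - apply: product_null; first exact: measurableX.
    by apply: aeW => y; rewrite -[RHS]N0; congr leb3; apply/seteqP; split=> x //=; case.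
  - by move=> z /= /contrapT.
have sub x : ~ N x -> A x by move=> Nx; apply: contrapT => /AN.
apply: filterS (post_nonsingular mN N0) => p h.
split.
- apply: filterS2 h N1 => z h h1; apply: sub.
  by rewrite /out_p; case: ifPn => // /andP[r0 /eqP w1]; case: (h r0 w1).
- apply: filterS2 h N1 => z h h1; apply: sub.
  by rewrite /out_q; case: ifPn => // /andP[r0 /eqP w1]; case: (h r0 w1).
- by apply: filterS N1 => z; exact: sub.
Qed.

Lemma unit_direction_ae : \forall z \ae (@collision_measure R), dot z.2 z.2 = 1.
Proof.
pose D : set (vec3 R * vec3 R) := (fun z : vec3 R * vec3 R => dot z.2 z.2) @^-1` (~` [set 1]).
have md : measurable D.
  by apply: measurable_preimageT; [exact: measurable_dot|exact: measurableC].
have D0 : collision_measure D = 0%E.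
  apply: product_null => //; apply: filterS sphere_unit_ae => w w1.
  by rewrite (_ : [set _ | _] = set0) ?measure0//; apply/seteqP; split.
by exists D; split => // z /= /eqP.
Qed.

(** The cut-off alters the integrand nowhere on the sphere: it acts only where varrho = 0, and there
    the kernel vanishes as 2 + a > 0. Directions off the sphere form a null set. Integrability of
    gain and loss separately allows their splitting. *)
Lemma collisionE f p : measurable_fun setT f ->
    collision_measure.-integrable setT
      (EFin \o (fun z => kern p z * (f (out_p p z) * f (out_q p z)))) ->
    collision_measure.-integrable setT (EFin \o (fun z => kern p z * f z.1)) ->
  collision_converges a f p /\
  collision a f p = collide collision_measure kern out_p out_q fst f p.
Proof.
move=> mf i1 i2.
pose k z := kern p z * (f (out_p p z) * f (out_q p z)) - f p * (kern p z * f z.1).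
pose c z := collision_integrand a f p z.1 z.2.
have ik : collision_measure.-integrable setT (EFin \o k).
  have := integrableB (measurableT) i1 (integrableZl measurableT (f p) i2).
  exact.
have mc : measurable_fun setT c.
  have mp := measurable_cst (T1 := (vec3 R * vec3 R)%type) p.
  have mv : measurable_fun setT (fun z : vec3 R * vec3 R => varrho p z.1).
    exact: measurable_varrho.
  rewrite /c /collision_integrand; apply: measurable_funM.
    apply: measurable_funM; last first.
      by apply: measurable_inv; apply: measurable_funM => //; exact: measurable_enorm.
    exact: (measurableT_comp (@measurable_powR R (2 + a)) mv).
  apply: measurable_funB; last by apply: measurable_funM => //; exact: measurableT_comp.
  apply: measurable_funM; apply: (measurableT_comp mf); first exact: measurable_post_p.
  under eq_fun do rewrite post_qE.
  by apply: measurable_post_p => //; exact: measurable_vecN.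
have ck : \forall z \ae collision_measure, (c z)%:E = (k z)%:E.
  have w1 := unit_direction_ae.
  apply: filterS w1 => z w1; congr EFin.
  rewrite /c /k /collision_integrand /kern /out_p /out_q /colliding w1 eqxx andbT.
  case: ifPn => r0; first by ring.
  have -> : varrho p z.1 = 0 by apply/eqP; rewrite eq_le varrho_ge0 andbT leNgt.
  by rewrite powR0 ?gt_eqF ?(ltr_wpDr a0)//; ring.
have mE : measurable_fun setT (EFin \o c) by exact/measurable_EFinP.
have mEk : measurable_fun setT (EFin \o k) by case/integrableP: ik.
have ic : collision_measure.-integrable setT (EFin \o c).
  apply/integrableP; split => //.
  rewrite (ae_eq_integral (abse \o (EFin \o k))) //; last 3 first.
  - exact: measurableT_comp.
  - exact: measurableT_comp.
  - by apply: filterS ck => z h _; rewrite /comp h.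
  by case/integrableP: ik.
split; first exact: ic.
have -> : collide collision_measure kern out_p out_q fst f p = \int[collision_measure]_z k z.
  rewrite /collide /gain /loss /k RintegralB//; last first.
    exact: (integrableZl measurableT (f p) i2).
  by rewrite RintegralZl.
rewrite /collision /Rintegral.
have -> : (\int[collision_measure]_z (k z)%:E = \int[collision_measure]_z (c z)%:E)%E.
  by apply: ae_eq_integral => //; apply: filterS ck => z /esym.
(* The inner integral over the sphere is finite only for almost every [q], so passing to its real
   value alters it at most on a null set. *)
congr fine.
rewrite -(integral12_prod_meas1 (m1 := leb3) (m2 := sphere_measure) ic).
have iF := integrable_fubini_F (m1 := leb3) (m2 := sphere_measure) ic.
apply: ae_eq_integral => //.
- apply/measurable_EFinP/measurableT_comp => //.
  by case/integrableP: iF.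
- by case/integrableP: iF.
- apply: filterS (integrable_ae measurableT iF) => q /(_ I) + _.
  by rewrite /fubini_F/= => /fineK.
Qed.

End CollisionKernel.

(** * Uniqueness *)

Section LeftDerivative.
Context (R : realType).

(* A Dini-derivative argument: above any slope [k] the first time at which
   [F] exceeds the line has no admissible left neighbour. *)
Lemma nonincreasing_left_diff (F : R -> R) :
    (forall t, 0 <= t -> forall k, 0 < k -> exists2 h, 0 < h &
      forall s, 0 <= s -> t - h < s < t -> F t <= F s + k * (t - s)) ->
    (forall t, 0 <= t -> forall k, 0 < k -> exists2 h, 0 < h &
      forall s, t < s < t + h -> F s <= F t + k) ->
  forall t, 0 <= t -> F t <= F 0.
Proof.
move=> left right T; rewrite le_eqVlt => /orP[/eqP<-//|T0].
rewrite leNgt; apply/negP => FT.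
(* A third of the mean slope: the line of slope 2k still leaves a gap k T at time [T], and 2k
   exceeds the slope k allowed from the left. *)
pose k := (F T - F 0) / (3 * T).
have k0 : 0 < k by rewrite divr_gt0 ?mulr_gt0 ?subr_gt0.
have kT : 3 * (k * T) = F T - F 0 by rewrite /k; field; rewrite gt_eqF.
pose x t := F t - 2 * k * t.
have kT0 : 0 < k * T by rewrite mulr_gt0.
have x0 : x 0 < x T by rewrite /x mulr0 subr0; lra.
pose A := [set t | 0 <= t <= T /\ x T <= x t].
have AT : A T by split => //; rewrite lexx ltW.
have lA : has_inf A by split; [exists T|exists 0 => t [/andP[]]].
pose s := inf A.
have s0 : 0 <= s by apply: lb_le_inf; [exists T|move=> t [/andP[]]].
have sT : s <= T by apply: ge_inf => //; case: lA.
(* Otherwise semicontinuity from the right would keep [x] below [x T] just after [s], against the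
   choice of [s] as an infimum. *)
have As : x T <= x s.
  rewrite leNgt; apply/negP => xs.
  have xs2 : 0 < (x T - x s) / 2 by rewrite divr_gt0// subr_gt0.
  have [h h0 hs] := right s s0 _ xs2.
  have [t At ts] : exists2 t, A t & t < s + h by apply: inf_adherent.
  have st : s <= t by apply: ge_inf => //; case: lA.
  case: At => _; move: st; rewrite le_eqVlt => /orP[/eqP<-|st]; first by rewrite leNgt xs.
  have := hs t; rewrite st ts => /(_ isT).
  have : k * s < k * t by rewrite ltr_pM2l.
  by move: xs; rewrite /x; lra.
have {}s0 : 0 < s.
  rewrite lt_neqAle s0 andbT; apply/negP => /eqP s0'.
  by move: As; rewrite -s0' leNgt x0.
have [h h0 hs] := left s (ltW s0) k k0.
pose t := s - Num.min (h / 2) (s / 2).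
have m0 : 0 < Num.min (h / 2) (s / 2) by rewrite lt_min !divr_gt0.
have m1 : Num.min (h / 2) (s / 2) <= h / 2 by rewrite ge_min lexx.
have m2 : Num.min (h / 2) (s / 2) <= s / 2 by rewrite ge_min lexx orbT.
have ts : t < s by rewrite /t; lra.
have t0 : 0 <= t by rewrite /t; lra.
have th : s - h < t by rewrite /t; lra.
clearbody t; have Fs : F s <= F t + k * (s - t) by apply: hs => //; rewrite th.
have At : A t.
  split; first by rewrite t0 (le_trans (ltW ts)).
  have : 0 < k * (s - t) by rewrite mulr_gt0// subr_gt0.
  move: As Fs; rewrite /x; clear; lra.
have : s <= t by apply: ge_inf => //; case: lA.
by rewrite leNgt ts.
Qed.

End LeftDerivative.

Section MeanDerivative.
Context d (X : measurableType d) (R : realType) (nu : {measure set X -> \bar R}).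

(** Differentiability in L^1 for nonnegative times, written without division so that s = t needs no
    exception. *)
Definition mean_derivative (u v : R -> X -> R) := forall t, 0 <= t ->
  forall k, 0 < k -> exists2 h, 0 < h & forall s, 0 <= s -> `|s - t| < h ->
    (\int[nu]_p (`|u s p - u t p - (s - t) * v t p|)%:E <= (k * `|s - t|)%:E)%E.

(** The integral of the positive part of [y] starts at 0 and is nonincreasing, since [y] cannot grow
    where it is positive. *)
Lemma positive_part_vanishes (y z : R -> X -> R) :
    (forall t, 0 <= t -> nu.-integrable setT (EFin \o y t)) ->
    (forall t, 0 <= t -> nu.-integrable setT (EFin \o z t)) ->
    mean_derivative y z -> (\forall p \ae nu, y 0 p <= 0) ->
    (forall t, 0 <= t -> \forall p \ae nu, 0 < y t p -> z t p <= 0) ->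
  forall t, 0 <= t -> \forall p \ae nu, y t p <= 0.
Proof.
move=> iy iz dyz y0 yz.
pose pos (x : R) := Num.max x 0.
have pos0 x : 0 <= pos x by rewrite /pos le_max lexx orbT.
have my t : 0 <= t -> measurable_fun setT (y t).
  by move=> /iy /integrableP[/measurable_EFinP].
have mz t : 0 <= t -> measurable_fun setT (z t).
  by move=> /iz /integrableP[/measurable_EFinP].
have mpos t : 0 <= t -> measurable_fun setT (fun p => pos (y t p)).
  by move=> /my ?; apply: measurable_funD || exact: measurable_maxr.
have mposE t : 0 <= t -> measurable_fun setT (fun p => (pos (y t p))%:E).
  by move=> /mpos ?; exact/measurable_EFinP.
pose I t := (\int[nu]_p (pos (y t p))%:E)%E.
have I0 t : (0 <= I t)%E by apply: integral_ge0 => p _; rewrite lee_fin.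
have Ioo t : 0 <= t -> (I t < +oo)%E.
  move=> t0; have /integrableP[m] := iy t t0; apply: le_lt_trans.
  apply: ge0_le_integral => //; [by move=> p _; rewrite lee_fin|exact: mposE|
    exact: measurableT_comp|].
  by move=> p _; rewrite lee_fin /pos ge_max ler_norm normr_ge0.
have Ifin t : 0 <= t -> (fine (I t))%:E = I t.
  by move=> t0; rewrite fineK// ge0_fin_numE// Ioo.
pose r s t p := y s p - y t p - (s - t) * z t p.
have mr s t : 0 <= s -> 0 <= t -> measurable_fun setT (fun p => (`|r s t p|)%:E).
  move=> s0 t0; apply/measurable_EFinP; apply: measurableT_comp => //.
  apply: measurable_funB; first by apply: measurable_funB; exact: my.
  by apply: measurable_funM => //; exact: mz.
have Ile s t (g : X -> R) (c : R) : 0 <= s -> 0 <= t -> 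
    measurable_fun setT (fun p => (g p)%:E) -> (forall p, 0 <= g p) ->
    (\int[nu]_p (g p)%:E <= c%:E)%E ->
    (\forall p \ae nu, pos (y s p) <= pos (y t p) + g p) ->
    fine (I s) <= fine (I t) + c.
  move=> s0 t0 mg g0 gc h; rewrite -lee_fin EFinD !Ifin//.
  apply: (@le_trans _ _ (I t + \int[nu]_p (g p)%:E)%E); last exact: leeD2l.
  rewrite -ge0_integralD; last 5 first.
  - exact: measurableT.
  - by move=> p _; rewrite lee_fin.
  - exact: mposE.
  - by move=> p _; rewrite lee_fin.
  - exact: mg.
  apply: ae_ge0_le_integral => //.
  - by move=> p _; rewrite lee_fin.
  - exact: mposE.
  - by move=> p _; rewrite -EFinD lee_fin addr_ge0.
  - by apply: emeasurable_funD => //; exact: mposE.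
  - by apply: filterS h => p h _; rewrite -EFinD lee_fin.
have F0 : I 0 = 0%E.
  apply/ae_integral0; [exact: mposE|by move=> p; rewrite lee_fin|].
  by apply: filterS y0 => p y0; rewrite /pos max_r.
have main : forall t, 0 <= t -> fine (I t) <= fine (I 0).
  apply: nonincreasing_left_diff => t t0 k k0.
    (* The comparison runs backwards in time because the sign of [z] is known at [t] where [y t] is
       positive: there y t <= y s plus the remainder, and elsewhere the positive part at [t] is
       zero. *)
    have [h h0 hs] := dyz t t0 k k0; exists h => // s s0 /andP[s1 s2].
    have st : `|s - t| = t - s by rewrite distrC gtr0_norm// subr_gt0.
    have hr := hs s s0; rewrite st in hr; have {}hr := hr ltac:(lra).
    apply: (Ile t s (fun p => `|r s t p|)) => //; first exact: mr.
    apply: filterS (yz t t0) => p zp; rewrite {1}/pos ge_max addr_ge0// andbT.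
    have [yt|yt] := ltP 0 (y t p); last by rewrite (le_trans yt)// addr_ge0.
    have := ler_norm (- r s t p); rewrite normrN.
    have : y s p <= pos (y s p) by rewrite /pos le_max lexx.
    have : (t - s) * z t p <= 0 by rewrite mulr_ge0_le0 ?zp//; lra.
    by rewrite /r; lra.
  (* To the right closeness suffices: remainder and derivative together contribute at most (s - t)(1
     + Z). *)
  have [h h0 hs] := dyz t t0 1 ltr01.
  pose Z := fine (\int[nu]_p (`|z t p|)%:E)%E.
  have Zoo : (\int[nu]_p (`|z t p|)%:E < +oo)%E by have /integrableP[] := iz t t0.
  have Z0 : (0 <= \int[nu]_p (`|z t p|)%:E)%E by apply: integral_ge0 => p _; rewrite lee_fin.
  have ZE : Z%:E = (\int[nu]_p (`|z t p|)%:E)%E by rewrite fineK// ge0_fin_numE.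
  have Zp : 0 <= Z by rewrite fine_ge0.
  have k1 : 0 < k / (1 + Z) by rewrite divr_gt0// ltr_wpDr.
  exists (Num.min h (k / (1 + Z))) => [|s]; first by rewrite lt_min h0.
  rewrite -ltrBlDl lt_min => /andP[s1 /andP[s2 s3]].
  have s0 : 0 <= s by rewrite (le_trans t0)// ltW.
  have st : `|s - t| = s - t by rewrite gtr0_norm// subr_gt0.
  have := hs s s0; rewrite st mul1r => /(_ s2) hr.
  have mg : measurable_fun setT (fun p => ((s - t) * `|z t p|)%:E).
    apply/measurable_EFinP; apply: measurable_funM => //.
    by apply: measurableT_comp => //; exact: mz.
  have st0 : 0 <= s - t by rewrite subr_ge0 ltW.
  apply: (Ile s t (fun p => `|r s t p| + (s - t) * `|z t p|)) => //.
  - under eq_fun do rewrite EFinD.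
    by apply: emeasurable_funD => //; exact: mr.
  - by move=> p; rewrite addr_ge0// mulr_ge0.
  - under eq_integral do rewrite EFinD.
    rewrite ge0_integralD; last 5 first.
    + exact: measurableT.
    + by move=> p _; rewrite lee_fin.
    + exact: mr.
    + by move=> p _; rewrite lee_fin mulr_ge0.
    + exact: mg.
    under [X in (_ + X)%E]eq_integral do rewrite EFinM.
    rewrite ge0_integralZl_EFin; last 4 first.
    + exact: measurableT.
    + by move=> p _; rewrite lee_fin.
    + by apply/measurable_EFinP; apply: measurableT_comp => //; exact: mz.
    + exact: st0.
    rewrite -ZE -EFinM; apply: (@le_trans _ _ ((s - t) + (s - t) * Z)%:E).
      by rewrite EFinD; exact: leeD2r.
    rewrite lee_fin -[X in X + _]mulr1 -mulrDr.
    by rewrite -ler_pdivlMr ?ltr_wpDr// ltW.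
  - apply: aeW => p; rewrite {1}/pos ge_max; apply/andP; split; last first.
      by rewrite !addr_ge0// mulr_ge0.
    have h1 := ler_norm (r s t p).
    have h2 : (s - t) * z t p <= (s - t) * `|z t p| by rewrite ler_wpM2l ?ler_norm.
    have h3 : y t p <= pos (y t p) by rewrite /pos le_max lexx.
    by move: h1; rewrite /r; lra.
move=> t t0; have It : I t = 0%E.
  apply/eqP; rewrite eq_le I0 andbT -Ifin// lee_fin.
  by rewrite (le_trans (main t t0))// F0.
have /ae_integral0 h : I t = 0%E by [].
apply: filterS (h (mposE t t0) _) => [p [pE]|p]; last by rewrite lee_fin.
by rewrite -pE /pos le_max lexx.
Qed.

End MeanDerivative.

Section Uniqueness.
Context dX dZ (X : measurableType dX) (Z : measurableType dZ) (R : realType).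
Context (nu : {measure set X -> \bar R}) (mu : {sigma_finite_measure set Z -> \bar R}).
Context (b : X -> Z -> R) (P' Q' : X -> Z -> X) (r : Z -> X).
Context (m n h : X -> R) (C : R) (K : kinetic mu b P' Q' r m n h C).
Context (C1 : 1 <= C).
Context (ns : forall A : X -> Prop, (\forall p \ae nu, A p) ->
  \forall p \ae nu, seen mu P' Q' r p A).
Context (intn : nu.-integrable setT (EFin \o n)).

Local Notation Q := (collide mu b P' Q' r).

Lemma loss_ae_ge0 (g : X -> R) p : measurable_fun setT g -> (\forall z \ae mu, 0 <= g (r z)) ->
  0 <= loss mu b r g p.
Proof.
move=> mg g0; rewrite /loss /Rintegral fine_ge0//.
have mk : measurable_fun setT (fun z => b p z * g (r z)).
  apply: measurable_funM; last exact: measurableT_comp mg (kin_mr K).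
  exact: (measurableT_comp (kin_mb K) (measurable_pair1 _)).
rewrite (ae_eq_integral (fun z => `|b p z * g (r z)|%:E))//.
- by apply: integral_ge0 => z _; rewrite lee_fin.
- exact/measurable_EFinP.
- by apply/measurable_EFinP; exact: measurableT_comp.
- by apply: filterS g0 => z g0 _; rewrite ger0_norm// mulr_ge0// (kin_b0 K).
Qed.

(* Splitting the difference of two collision terms: the damping part has the
   sign of the difference, the rest is controlled by its size. *)
Lemma collide_dist_sign (M D : R) p (f g : X -> R) (k : R) : measurable_fun setT f ->
    measurable_fun setT g -> 0 <= M -> 0 <= D -> k = 1 \/ k = - 1 ->
    seen mu P' Q' r p (between m M f) -> seen mu P' Q' r p (between m M g) ->
    between m M g p ->
    seen mu P' Q' r p (fun x => `|f x - g x| <= D * n x) ->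
    0 < k * (f p - g p) ->
  k * (Q f p - Q g p) <= 3 * M * C * C * D * n p.
Proof.
move=> mf mg M0 D0 k1 sf sg gp sfg fg.
have hG := gain_dist K mf mg M0 D0 sf sg sfg.
have hL := loss_dist K mf mg M0 D0 sf sg sfg.
have L0 : 0 <= loss mu b r f p.
  apply: loss_ae_ge0 => //; have [_ _] := sf.
  by apply: filterS => z /andP[].
rewrite /collide.
set A := gain _ _ _ _ f f p - _ in hG; set B := loss _ _ _ f p - loss _ _ _ g p in hL.
have n0 : 0 <= n p by apply: le_trans (kin_m0 K p) (kin_mn_le K p).
have kn x : k * x <= `|x|.
  case: k1 => ->; first by rewrite mul1r ler_norm.
  by rewrite mulN1r -normrN ler_norm.
have h1 : k * A <= 2 * M * D * (C * n p) by exact: le_trans (kn _) hG.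
have h2 : k * - (g p * B) <= M * D * C * C * n p.
  apply: le_trans (kn _) _; rewrite normrN normrM.
  have /andP[g0 gM] := gp; rewrite (ger0_norm g0).
  apply: (@le_trans _ _ (M * m p * (D * (C * h p)))); first exact: ler_pM.
  rewrite [leLHS](_ : _ = M * D * C * (m p * h p)); last by ring.
  rewrite [leRHS](_ : _ = M * D * C * (C * n p)); last by ring.
  have C0 : 0 <= C by exact: le_trans ler01 C1.
  by rewrite ler_wpM2l ?(kin_mh K)// !mulr_ge0.
have h3 : 0 <= k * (f p - g p) * loss mu b r f p by rewrite mulr_ge0// ltW.
have E : k * (gain mu b P' Q' f f p - f p * loss mu b r f p -
    (gain mu b P' Q' g g p - g p * loss mu b r g p)) =
    k * A + k * - (g p * B) - k * (f p - g p) * loss mu b r f p.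
  by rewrite /A /B; ring.
rewrite E.
have h4 : 2 * M * D * (C * n p) <= 2 * M * D * (C * C * n p).
  have C0 : 0 <= C by exact: le_trans ler01 C1.
  by rewrite ler_wpM2l ?mulr_ge0// -mulrA ler_peMl// mulr_ge0.
rewrite [leRHS](_ : _ = 2 * M * D * (C * C * n p) + M * D * C * C * n p); last by ring.
by lra.
Qed.

Definition kinetic_solution (ka : R -> R) (M : R) (u v : R -> X -> R) :=
  [/\ forall t, 0 <= t -> nu.-integrable setT (EFin \o u t),
      forall t, 0 <= t -> nu.-integrable setT (EFin \o v t),
      mean_derivative nu u v,
      forall t, 0 <= t -> \forall p \ae nu, between m M (u t) p &
      forall t, 0 <= t -> \forall p \ae nu, v t p = ka t * Q (u t) p].

Context (ka tau : R -> R) (M T : R).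
Context (ka0 : forall t, 0 <= t -> 0 <= ka t).
Context (tau0 : tau 0 = 0) (tauT : forall t, 0 <= t -> 0 <= tau t <= T).
Context (dtau : forall t, 0 <= t -> forall k, 0 < k -> exists2 e, 0 < e &
  forall s, 0 <= s -> `|s - t| < e ->
    `|tau s - tau t - (s - t) * ka t| <= k * `|s - t|).
Context (M0 : 0 <= M) (small : 6 * (T * M * C * C) <= 1).

Let mean_derivative_comb u1 v1 u2 v2 (k D : R) : k = 1 \/ k = - 1 -> 0 <= D ->
  kinetic_solution ka M u1 v1 -> kinetic_solution ka M u2 v2 ->
  mean_derivative nu (fun t p => k * (u1 t p - u2 t p) - tau t * D * n p)
    (fun t p => k * (v1 t p - v2 t p) - ka t * D * n p).
Proof.
move=> k1 D0 [iu1 iv1 d1 _ _] [iu2 iv2 d2 _ _] t t0 e e0.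
have mn : measurable_fun setT n := kin_mn K.
have n0 p : 0 <= n p by apply: le_trans (kin_m0 K p) (kin_mn_le K p).
have mE (f : X -> R) : nu.-integrable setT (EFin \o f) -> measurable_fun setT f.
  by move=> /integrableP[/measurable_EFinP].
pose N := fine (\int[nu]_p (n p)%:E)%E.
have N0 : (0 <= \int[nu]_p (n p)%:E)%E by apply: integral_ge0 => p _; rewrite lee_fin.
have NE : N%:E = (\int[nu]_p (n p)%:E)%E.
  rewrite fineK// ge0_fin_numE//; have /integrableP[_] := intn.
  by congr (_ < _)%E; apply: eq_integral => p _; rewrite /= ger0_norm.
have Np : 0 <= N by rewrite fine_ge0.
have DN : 0 < 1 + D * N by rewrite ltr_wpDr// mulr_ge0.
have e3 : 0 < e / 3 by rewrite divr_gt0.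
have [h1 h10 hs1] := d1 t t0 (e / 3) e3.
have [h2 h20 hs2] := d2 t t0 (e / 3) e3.
(* The error of the clock is later multiplied by D times the integral of [n]; the added 1 keeps the
   divisor positive. *)
have [h3 h30 hs3] := dtau t0 (divr_gt0 e3 DN).
exists (Num.min h1 (Num.min h2 h3)) => [|s s0]; first by rewrite !lt_min h10 h20.
rewrite !lt_min => /andP[sh1 /andP[sh2 sh3]].
pose r1 p := u1 s p - u1 t p - (s - t) * v1 t p.
pose r2 p := u2 s p - u2 t p - (s - t) * v2 t p.
pose c : R := `|tau s - tau t - (s - t) * ka t| * D.
have c0 : 0 <= c by rewrite mulr_ge0.
have mr1 : measurable_fun setT (fun p => `|r1 p|%:E).
  apply/measurable_EFinP; apply: measurableT_comp => //.
  apply: measurable_funB; first by apply: measurable_funB; apply: mE; exact: iu1.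
  by apply: measurable_funM => //; apply: mE; exact: iv1.
have mr2 : measurable_fun setT (fun p => `|r2 p|%:E).
  apply/measurable_EFinP; apply: measurableT_comp => //.
  apply: measurable_funB; first by apply: measurable_funB; apply: mE; exact: iu2.
  by apply: measurable_funM => //; apply: mE; exact: iv2.
have mcn : measurable_fun setT (fun p => (c * n p)%:E).
  by apply/measurable_EFinP; exact: measurable_funM.
apply: (@le_trans _ _ (\int[nu]_p (`|r1 p|%:E + `|r2 p|%:E + (c * n p)%:E))%E).
  apply: ge0_le_integral => //.
  - apply/measurable_EFinP; apply: measurableT_comp => //.
    have mb x y (f g : X -> R) : measurable_fun setT f -> measurable_fun setT g ->
        measurable_fun setT (fun p => k * (f p - g p) - x * y * n p).
      by move=> mf mg; apply: measurable_funB; apply: measurable_funM => //;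
        exact: measurable_funB.
    apply: measurable_funB; first by apply: measurable_funB; apply: mb; apply: mE; [exact: iu1|exact: iu2|exact: iu1|exact: iu2].
    by apply: measurable_funM => //; apply: mb; apply: mE; [exact: iv1|exact: iv2].
  - by apply: emeasurable_funD => //; exact: emeasurable_funD.
  move=> p _; rewrite -!EFinD lee_fin.
  have -> : k * (u1 s p - u2 s p) - tau s * D * n p -
     (k * (u1 t p - u2 t p) - tau t * D * n p) -
     (s - t) * (k * (v1 t p - v2 t p) - ka t * D * n p) =
     k * r1 p - k * r2 p - (tau s - tau t - (s - t) * ka t) * D * n p.
    by rewrite /r1 /r2; ring.
  rewrite (le_trans (ler_normB _ _))// lerD//; last by rewrite !normrM (ger0_norm D0) (ger0_norm (n0 p)).
  rewrite (le_trans (ler_normB _ _))// !normrM.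
  by case: k1 => ->; rewrite ?normrN normr1 !mul1r.
rewrite ge0_integralD; last 5 first.
- exact: measurableT.
- by move=> p _; rewrite adde_ge0// lee_fin.
- exact: emeasurable_funD.
- by move=> p _; rewrite lee_fin mulr_ge0.
- exact: mcn.
rewrite ge0_integralD; last 5 first.
- exact: measurableT.
- by move=> p _; rewrite lee_fin.
- exact: mr1.
- by move=> p _; rewrite lee_fin.
- exact: mr2.
under [X in (_ + _ + X)%E]eq_integral do rewrite EFinM.
rewrite ge0_integralZl_EFin; last 4 first.
- exact: measurableT.
- by move=> p _; rewrite lee_fin.
- exact/measurable_EFinP.
- exact: c0.
rewrite -NE -EFinM.
have cN : c * N <= e / 3 * `|s - t|.
  have hs3' := hs3 s s0 sh3; rewrite /c.
  apply: (@le_trans _ _ (e / 3 / (1 + D * N) * `|s - t| * D * N)).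
    by rewrite !ler_wpM2r.
  rewrite [leLHS](_ : _ = e / 3 * `|s - t| * (D * N / (1 + D * N))); last first.
    by field; rewrite gt_eqF.
  have e3s : 0 <= e / 3 * `|s - t| by exact: mulr_ge0 (ltW e3) (normr_ge0 _).
  by rewrite (ler_piMr e3s)// ler_pdivrMr// mul1r lerDr.
rewrite (_ : e * `|s - t| = e / 3 * `|s - t| + e / 3 * `|s - t| + e / 3 * `|s - t|);
  last by field.
rewrite !EFinD; apply: leeD; last by rewrite lee_fin.
by apply: leeD; [exact: hs1|exact: hs2].
Qed.

(** The slope 3 M C^2 D of [collide_dist_sign], accumulated over a clock that never exceeds [T],
    gives at most D / 2 by the smallness condition. *)
Let halving u1 v1 u2 v2 D : 0 <= D ->
  kinetic_solution ka M u1 v1 -> kinetic_solution ka M u2 v2 ->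
  (\forall p \ae nu, u1 0 p = u2 0 p) ->
  (forall t, 0 <= t -> \forall p \ae nu, `|u1 t p - u2 t p| <= D * n p) ->
  forall t, 0 <= t -> \forall p \ae nu, `|u1 t p - u2 t p| <= D / 2 * n p.
Proof.
move=> D0 S1 S2 E0 hD.
have [iu1 iv1 _ b1 e1] := S1; have [iu2 iv2 _ b2 e2] := S2.
pose D' := 3 * M * C * C * D.
have C0 : 0 <= C by exact: le_trans ler01 C1.
have D'0 : 0 <= D' by rewrite /D' !mulr_ge0.
have n0 p : 0 <= n p by apply: le_trans (kin_m0 K p) (kin_mn_le K p).
have mE (f : X -> R) : nu.-integrable setT (EFin \o f) -> measurable_fun setT f.
  by move=> /integrableP[/measurable_EFinP].
have comb (f g : X -> R) x y : nu.-integrable setT (EFin \o f) ->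
   nu.-integrable setT (EFin \o g) ->
   nu.-integrable setT (EFin \o (fun p => x * (f p - g p) - y * D' * n p)).
  move=> If Ig.
  have := integrableB measurableT
    (integrableZl measurableT x (integrableB measurableT If Ig))
    (integrableZl measurableT (y * D') intn).
  by apply: eq_integrable => // p _ /=; rewrite -?EFinB -?EFinM -?EFinB.
have half k t : k = 1 \/ k = - 1 -> 0 <= t ->
    \forall p \ae nu, k * (u1 t p - u2 t p) - tau t * D' * n p <= 0.
  move=> k1; move: t; apply: (positive_part_vanishes
     (y := fun t p => k * (u1 t p - u2 t p) - tau t * D' * n p)
     (z := fun t p => k * (v1 t p - v2 t p) - ka t * D' * n p)).
  - by move=> t t0; apply: comb; [exact: iu1|exact: iu2].
  - by move=> t t0; apply: comb; [exact: iv1|exact: iv2].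
  - exact: mean_derivative_comb.
  - by apply: filterS E0 => p ->; rewrite subrr tau0 mulr0 !mul0r subrr.
  - move=> t t0.
    have s1 := ns (b1 t t0); have s2 := ns (b2 t t0); have s3 := ns (hD t t0).
    near=> p => ypos.
    have v1p : v1 t p = ka t * Q (u1 t) p by near: p; exact: e1.
    have v2p : v2 t p = ka t * Q (u2 t) p by near: p; exact: e2.
    rewrite v1p v2p -mulrBr mulrCA -mulrA -mulrBr.
    rewrite mulr_ge0_le0 ?ka0// subr_le0.
    apply: collide_dist_sign => //; [exact/mE/iu1|exact/mE/iu2|near: p|near: p|near: p|near: p|].
    + exact: s1.
    + exact: s2.
    + exact: b2.
    + exact: s3.
    (* The comparison function is nonnegative, so where the combination is positive the signed
       difference itself is. *)
    apply: lt_le_trans ypos _; rewrite gerBl !mulr_ge0//.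
    by case/andP: (tauT t0).
move=> t t0.
have h1 := half 1 t (or_introl erefl) t0; have h2 := half (- 1) t (or_intror erefl) t0.
apply: filterS2 h1 h2 => p; rewrite mul1r mulN1r => h1 h2.
have tD : tau t * D' * n p <= D / 2 * n p.
  rewrite ler_wpM2r//; have /andP[t1 t2] := tauT t0.
  apply: (@le_trans _ _ (T * D')); first by rewrite ler_wpM2r.
  have := ler_wpM2l D0 small; rewrite /D'; lra.
by rewrite ler_norml; apply/andP; split; lra.
Unshelve. all: by end_near. Qed.

Lemma kinetic_unique u1 v1 u2 v2 :
  kinetic_solution ka M u1 v1 -> kinetic_solution ka M u2 v2 ->
  (\forall p \ae nu, u1 0 p = u2 0 p) ->
  forall t, 0 <= t -> \forall p \ae nu, u1 t p = u2 t p.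
Proof.
move=> S1 S2 E0.
have [_ _ _ b1 _] := S1; have [_ _ _ b2 _] := S2.
have n0 p : 0 <= n p by apply: le_trans (kin_m0 K p) (kin_mn_le K p).
have H k t : 0 <= t -> \forall p \ae nu, `|u1 t p - u2 t p| <= M / 2 ^+ k * n p.
  elim: k t => [|k IH] t t0.
    apply: filterS2 (b1 t t0) (b2 t t0) => p /andP[x1 x2] /andP[y1 y2].
    rewrite expr0 divr1; have := ler_wpM2l M0 (kin_mn_le K p).
    by rewrite ler_norml => ?; apply/andP; split; lra.
  have Mk : 0 <= M / 2 ^+ k by rewrite divr_ge0// exprn_ge0.
  have := halving Mk S1 S2 E0 IH t0; apply: filterS => p.
  by rewrite exprSr invfM mulrA.
move=> t t0; have /ae_foralln Ht := fun k => H k t t0.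
apply: filterS Ht => p Hp; apply/eqP; rewrite -subr_eq0 -normr_le0.
apply/ler_addgt0Pl => e e0; rewrite addr0.
have B0 : 0 < M * n p + 1 by rewrite ltr_wpDl// mulr_ge0.
have [k _ /(_ k (leqnn k))/= ke] := near_infty_natSinv_expn_lt (PosNum (divr_gt0 e0 B0)).
apply: le_trans (Hp k) _.
rewrite mulrAC -mulrA [leLHS]mulrC.
move: ke; rewrite /= ltr_pdivlMr// => ke.
apply: ltW; apply: le_lt_trans ke.
have : 0 <= (2 ^+ k)^-1 :> R by rewrite invr_ge0 exprn_ge0.
move: (2 ^+ k)^-1 => x x0.
by rewrite [leRHS](_ : _ = n p * x * M + x) ?lerDl//; ring.
Qed.

End Uniqueness.

(** * Change of time and norms *)

(** The derivative is required at positive times and only continuity at 0, which covers the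
    one-sided situation at the initial time. *)
Lemma mean_value_between (R : realType) (f df : R -> R) (s t : R) : 0 <= s -> 0 <= t ->
    (forall x : R, 0 < x -> is_derive x 1 f (df x)) ->
    (forall x : R, 0 <= x -> {for x, continuous f}) ->
  exists c, [/\ 0 <= c, `|c - t| <= `|s - t| & f s - f t = df c * (s - t)].
Proof.
move=> s0 t1 fd fc.
have H x y : 0 <= x -> x < y -> exists2 c, x < c < y & f y - f x = df c * (y - x).
  move=> x0 xy; have [|c|c + E] := @MVT R f df x y xy.
  - by move=> z; rewrite in_itv/= => /andP[xz _]; apply: fd; exact: le_lt_trans xz.
  - apply: continuous_in_subspaceT => z; rewrite inE/= in_itv/= => /andP[xz _].
    by apply: fc; exact: le_trans xz.
  - by rewrite in_itv/= => cxy; exists c.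
have [st|st|->] := ltgtP s t; last by exists t; rewrite !subrr mulr0.
- have [c /andP[c1 c2] E] := H s t s0 st; exists c; split.
  + by rewrite (le_trans s0)// ltW.
  + by rewrite !(ltr0_norm (_ : _ - t < 0)) ?subr_lt0// lerN2 lerB// ltW.
  + by rewrite -opprB E -mulrN opprB.
- have [c /andP[c1 c2] E] := H t s t1 st; exists c; split => //.
  + by rewrite (le_trans t1)// ltW.
  + by rewrite !gtr0_norm ?subr_gt0// lerB// ltW.
Qed.

Section TimeChange.
Context (R : realType) (a cR t0 : R) (ha : 0 <= a) (hcR : 0 < cR) (ht0 : 0 < t0).
Implicit Types s t : R.

Definition rate t := scale_factor cR t0 t `^ (- 3 - a).

(** The primitive of the rate that vanishes at 0: R(t)^(-3-a) is a constant times (t + t0)^(-1 -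
    (1+a)/2), whose integral converges, and [clock_end] is the limit at infinity. *)
Definition clock t := cR `^ (- 3 - a) / ((1 + a) / 2) *
  (t0 `^ (- ((1 + a) / 2)) - (t + t0) `^ (- ((1 + a) / 2))).

Definition clock_end := cR `^ (- 3 - a) / ((1 + a) / 2) * t0 `^ (- ((1 + a) / 2)).

Let be := (1 + a) / 2.
Let be0 : 0 < be. Proof. by rewrite divr_gt0// ltr_pwDl. Qed.
Let c0 : 0 < cR `^ (- 3 - a) / be. Proof. by rewrite divr_gt0// powR_gt0. Qed.
Let tt0 t : 0 <= t -> 0 < t + t0. Proof. by move=> ?; rewrite ltr_wpDl. Qed.

Lemma rate_ge0 t : 0 <= rate t. Proof. exact: powR_ge0. Qed.

Let rateE t : 0 <= t -> rate t = cR `^ (- 3 - a) * (t + t0) `^ (- be - 1).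
Proof.
move=> t1; rewrite /rate /scale_factor powRM ?powR_ge0 ?(ltW hcR)//.
by rewrite -powRrM; congr (_ * _ `^ _); rewrite /be; field.
Qed.

Let dshift (c t : R) : 0 <= t -> is_derive t 1 (fun t => (t + t0) `^ c) (c * (t + t0) `^ (c - 1)).
Proof.
move=> t1; have h1 : is_derive t 1 (fun t : R => t + t0) 1.
  by apply: is_derive_eq; rewrite addr0.
have h2 := @is_derive1_powR R c (t + t0) (tt0 t1).
have := @is_derive1_comp R (fun x => x `^ c) (fun t : R => t + t0) t _ _ h2 h1.
by rewrite mulr1.
Qed.

Lemma clock_derive t : 0 <= t -> is_derive t 1 clock (rate t).
Proof.
move=> t1; have h1 := dshift (- be) t1; rewrite /clock -/be.
apply: is_derive_eq; rewrite rateE// /GRing.scale/=.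
by field; rewrite gt_eqF.
Qed.

Let cont_of (f : R -> R) (t df : R) : is_derive t 1 f df -> {for t, continuous f}.
Proof.
by move=> h; apply: differentiable_continuous; apply/derivable1_diffP.
Qed.

Lemma clock_continuous t : 0 <= t -> {for t, continuous clock}.
Proof. by move=> t1; exact: cont_of (clock_derive t1). Qed.

Lemma clock0 : clock 0 = 0.
Proof. by rewrite /clock add0r subrr mulr0. Qed.

Lemma clock_gt0 t : 0 < t -> 0 < clock t.
Proof.
move=> t1; rewrite /clock mulr_gt0// subr_gt0 !powRN ltf_pV2 ?posrE ?powR_gt0 ?tt0 ?(ltW t1)//.
by apply: gt0_ltr_powR => //; rewrite ?nnegrE ?ltW ?tt0 ?(ltW t1)// ltrDr.
Qed.

Lemma clock_lt_end t : 0 <= t -> clock t < clock_end.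
Proof.
by move=> t1; rewrite /clock /clock_end ltr_pM2l// gtrBl powR_gt0// tt0.
Qed.

Lemma clock_end_gt0 : 0 < clock_end.
Proof. by rewrite -clock0 clock_lt_end. Qed.

Lemma clock_ge0 t : 0 <= t -> 0 <= clock t.
Proof. by rewrite le_eqVlt => /orP[/eqP<-|/clock_gt0/ltW//]; rewrite clock0. Qed.

Lemma time_modulus t : 0 <= t -> forall k, 0 < k -> exists2 e, 0 < e &
  forall s, 0 <= s -> `|s - t| < e ->
    `|rate s - rate t| <= k /\ `|clock s - clock t| <= k.
Proof.
move=> t1 k k0.
pose g s := cR `^ (- 3 - a) * (s + t0) `^ (- be - 1).
have cg : {for t, continuous g}.
  by apply: (@cont_of g t _); exact: is_deriveZ (dshift _ t1).
have /cvgrPdist_le/(_ k k0)/nbhs_ballP[e1 e10 h1] := cg.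
have /cvgrPdist_le/(_ k k0)/nbhs_ballP[e2 e20 h2] := clock_continuous t1.
exists (Num.min e1 e2) => [|s s0]; first by rewrite lt_min e10.
rewrite lt_min => /andP[s1 s2].
rewrite !rateE//; split.
  by rewrite distrC; apply: h1; rewrite /ball/= distrC.
by rewrite distrC; apply: h2; rewrite /ball/= distrC.
Qed.

Lemma clock_diff t : 0 <= t -> forall k, 0 < k -> exists2 e, 0 < e &
  forall s, 0 <= s -> `|s - t| < e ->
    `|clock s - clock t - (s - t) * rate t| <= k * `|s - t|.
Proof.
move=> t1 k k0; have [e e0 he] := time_modulus t1 k0; exists e => // s s0 st.
have [c [c1 ct ->]] := mean_value_between s0 t1
  (fun x x0 => clock_derive (ltW x0)) clock_continuous.
rewrite mulrC -mulrBr normrM mulrC ler_wpM2r//.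
by have [] := he c c1 (le_lt_trans ct st).
Qed.

End TimeChange.

Section Norms.
Context (R : realType).
Implicit Types (f : vec3 R -> R) (p : vec3 R).

Lemma enorm_neq0_ae : \forall p \ae (@leb3 R), enorm p != 0.
Proof.
exists (setT `*` [set 0]); split.
- exact: measurableX.
- by rewrite [LHS]product_measure1E// [X in (_ * X)%E]lebesgue_measure_set1 mule0.
- move=> p /= /negP; rewrite negbK => /eqP p0; split => //.
  have [_ _] := abs_le_enorm p; rewrite p0 normr_le0 => /eqP; exact.
Qed.

Let nrm0 p : enorm p `^ 0 = 1. Proof. exact: powRr0. Qed.
Let nrm1 p : enorm p `^ 1 = enorm p. Proof. by rewrite powRr1// enorm_ge0. Qed.

Lemma L1_normE0 f : L1_norm 0 f = (\int[leb3]_p `|f p|%:E)%E.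
Proof. by apply: eq_integral => p _; rewrite nrm0 mulr1. Qed.

Lemma L1_norm_ge0 r f : (0 <= L1_norm r f)%E.
Proof. by apply: integral_ge0 => p _; rewrite lee_fin mulr_ge0 ?powR_ge0. Qed.

Lemma X_norm_ge0 f : (0 <= X_norm f)%E.
Proof. by rewrite adde_ge0 ?L1_norm_ge0. Qed.

Lemma L1_le_X f : (\int[leb3]_p `|f p|%:E <= X_norm f)%E.
Proof. by rewrite -L1_normE0 leeDl ?L1_norm_ge0. Qed.

Lemma in_X_integrable f : in_X f -> leb3.-integrable setT (EFin \o f).
Proof.
move=> [mf fX]; apply/integrableP; split; first exact/measurable_EFinP.
exact: le_lt_trans (L1_le_X f) fX.
Qed.

(** The moment bound offers two factors 1 + |p|: one is used by the majorant of [f], the other by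
    the weight of L^1_1. *)
Lemma X_norm_le f (k : R) : measurable_fun setT f -> 0 <= k ->
    (forall p, `|f p| <= k * ((1 + enorm p) * wt 2^-1 p)) ->
  (X_norm f <= (2 * k * moment_bound R)%:E)%E.
Proof.
move=> mf k0 fk.
have mG : measurable_fun setT (fun q : vec3 R => (1 + enorm q) ^+ 2 * wt 2^-1 q).
  apply: measurable_funM; last exact: measurable_wt.
  by apply: measurable_funX; apply: measurable_funD => //; exact: measurable_enorm.
have L (g : vec3 R -> R) : measurable_fun setT g -> (forall p, 0 <= g p <= 1 + enorm p) ->
    (\int[leb3]_p (`|f p| * g p)%:E <= (k * moment_bound R)%:E)%E.
  move=> mg gle.
  apply: (@le_trans _ _ (\int[leb3]_p (k%:E * ((1 + enorm p) ^+ 2 * wt 2^-1 p)%:E))%E).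
    apply: ge0_le_integral => //.
    - by move=> p _; rewrite lee_fin mulr_ge0//; case/andP: (gle p).
    - by apply/measurable_EFinP; apply: measurable_funM => //; exact: measurableT_comp.
    - by apply: measurable_funeM; exact/measurable_EFinP.
    move=> p _; rewrite -EFinM lee_fin; have /andP[g0 g1] := gle p.
    apply: (le_trans (ler_pM (normr_ge0 _) g0 (fk p) g1)).
    by rewrite le_eqVlt; apply/orP; left; apply/eqP; ring.
  rewrite ge0_integralZl_EFin; last 4 first.
  - exact: measurableT.
  - by move=> p _; rewrite lee_fin mulr_ge0 ?wt_ge0 ?sqr_ge0.
  - exact/measurable_EFinP.
  - exact: k0.
  by rewrite EFinM lee_wpmul2l ?lee_fin//; exact: wt_moment.
rewrite (_ : 2 * k * _ = k * moment_bound R + k * moment_bound R); last by ring.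
rewrite EFinD; apply: leeD.
  have := L (fun=> 1) (measurable_cst _); rewrite /L1_norm.
  under [in X in _ -> X]eq_integral do rewrite nrm0.
  by apply => p; rewrite ler01 lerDl enorm_ge0.
have mN : measurable_fun setT (@enorm R) by exact: measurable_enorm.
have := L _ mN; rewrite /L1_norm.
under [in X in _ -> X]eq_integral do rewrite nrm1.
by apply => p; rewrite enorm_ge0/= lerDr.
Qed.

Lemma in_X_le f (k : R) : measurable_fun setT f -> 0 <= k ->
    (forall p, `|f p| <= k * ((1 + enorm p) * wt 2^-1 p)) -> in_X f.
Proof.
by move=> mf k0 fk; split => //; apply: le_lt_trans (X_norm_le mf k0 fk) _; rewrite ltry.
Qed.

Lemma weight_wt p : enorm p != 0 -> weight p * wt 1 p = 1.
Proof.
move=> p0; rewrite /weight /wt mul1r mulrACA divff// mul1r -expRD subrr.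
exact: expR0.
Qed.

Lemma weight_ge0 p : 0 <= weight p.
Proof. by rewrite mulr_ge0 ?enorm_ge0 ?expR_ge0. Qed.

Lemma Linfw_le f (M : R) : 0 <= M ->
  (\forall p \ae leb3, between (wt 1) M f p) -> (Linfw_norm f <= M%:E)%E.
Proof.
(* The essential supremum norm is 0 by definition on a null space, hence the second branch. *)
move=> M0 fM; rewrite /Linfw_norm unlock/=; case: ifPn => _; last by rewrite -[0%E]/(0%R%:E) lee_fin.
apply/ess_supP; apply: filterS fM => p /andP[f0 fM] /=.
rewrite lee_fin (ger0_norm (mulr_ge0 (weight_ge0 p) f0)).
apply: (le_trans (ler_wpM2l (weight_ge0 p) fM)); rewrite mulrCA.
have [p0|p0] := eqVneq (enorm p) 0; first by rewrite /weight p0 !mul0r mulr0.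
by rewrite weight_wt// mulr1.
Qed.

Lemma Linfw_ge f (M : R) : 0 <= M -> (Linfw_norm f <= M%:E)%E -> ae_nonneg f ->
  \forall p \ae leb3, between (wt 1) M f p.
Proof.
move=> M0; rewrite /Linfw_norm unlock/=; case: ifPn => [_|]; last first.
  rewrite -leNgt => T0 _ _; exists setT; split => //.
  by apply/eqP; rewrite eq_le T0 measure_ge0.
move=> /ess_supP fM f0.
apply: filterS3 fM f0 enorm_neq0_ae => p /=; rewrite lee_fin => fM f0 p0.
rewrite /between f0/= [leLHS](_ : _ = weight p * f p * wt 1 p); last first.
  by rewrite mulrAC weight_wt// mul1r.
by rewrite ler_wpM2r ?wt_ge0// (le_trans (ler_norm _)).
Qed.

End Norms.

Section EreaLimits.
Context (R : realType).

Lemma cvg0_ereal T (F : set_system T) (FF : Filter F) (g : T -> \bar R) :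
    (forall x, (0 <= g x)%E) ->
  g x @[x --> F] --> 0%E <->
    forall e : R, 0 < e -> \forall x \near F, (g x <= e%:E)%E.
Proof.
move=> g0; split=> [/fine_cvgP[gf /cvgr0Pnorm_le h] e /h he|h].
  near=> x; have gx : g x \is a fin_num by near: x.
  rewrite -(fineK gx) lee_fin (le_trans (ler_norm _))//.
  by near: x.
apply/fine_cvgP; split.
  by apply: filterS (h 1 ltr01) => x gx; rewrite ge0_fin_numE// (le_lt_trans gx)// ltry.
apply/cvgr0Pnorm_le => e /h; apply: filterS => x gx /=.
rewrite ger0_norm ?fine_ge0// -lee_fin fineK// ge0_fin_numE// (le_lt_trans gx)//.
exact: ltry.
Unshelve. all: by end_near. Qed.

Lemma near_half_line (t : R) (P : R -> Prop) :
  (\forall s \near within [set s : R | 0 <= s] (nbhs t), P s) <->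
  exists2 e, 0 < e & forall s, 0 <= s -> `|s - t| < e -> P s.
Proof.
split=> [/nbhs_ballP[e e0 he]|[e e0 he]].
  exists e => // s s0 st; apply: (he s) => //; by rewrite /ball/= distrC.
apply/nbhs_ballP; exists e => // s; rewrite /ball/= distrC => st s0.
exact: he.
Qed.

Lemma near_half_line_punctured (t : R) (P : R -> Prop) :
  (\forall s \near within [set s : R | 0 <= s] t^', P s) <->
  exists2 e, 0 < e & forall s, 0 <= s -> s != t -> `|s - t| < e -> P s.
Proof.
split=> [/nbhs_ballP[e e0 he]|[e e0 he]].
  exists e => // s s0 nst st; apply: (he s) => //; by rewrite /ball/= distrC.
apply/nbhs_ballP; exists e => // s; rewrite /ball/= distrC => st nst s0.
exact: he.
Qed.

End EreaLimits.

(** * The Cauchy problem *)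

Section Boltzmann.
Context (R : realType) (a cR t0 : R) (ha : 0 <= a < 2) (hcR : 0 < cR) (ht0 : 0 < t0).
Context (C : R) (K : kinetic collision_measure (kern a) (@out_p R) (@out_q R)
  fst (wt 1) (wt 2^-1) (fun p => 1 + enorm p) C).
Implicit Types (f : vec3 R -> R) (u v : R -> vec3 R -> R) (t s M : R).

Let a0 : 0 <= a. Proof. by case/andP: ha. Qed.

Local Notation ka := (rate a cR t0).
Local Notation tau := (clock a cR t0).
Local Notation T := (clock_end a cR t0).
Local Notation Q := (collide collision_measure (kern a) (@out_p R) (@out_q R) fst).
Local Notation n := (@wt R 2^-1).
Local Notation between := (between (wt 1)).

Lemma collision_between f M : measurable_fun setT f -> 0 <= M ->
    (\forall p \ae leb3, between M f p) ->
  \forall p \ae leb3, collision_converges a f p /\ collision a f p = Q f p.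
Proof.
move=> mf M0 fM; apply: filterS (seen_ae fM) => p sp.
apply: (collisionE ha mf).
  by have [] := gain_m_bound K mf M0 sp.
by have [] := loss_m_bound K mf M0 sp.
Qed.

(** Convergence of the difference quotients in X, multiplied by |s - t|, is differentiability in
    mean, because the norm of X dominates that of L^1. *)
Lemma admissible_kinetic M f0 u : 0 <= M -> admissible_solution a cR t0 M f0 u ->
  exists v, kinetic_solution leb3 collision_measure (kern a) (@out_p R) (@out_q R)
    fst (wt 1) ka M u v.
Proof.
move=> M0 [[u0 [v C1v hv]] upos usup]; exists v.
have bet t : 0 <= t -> \forall p \ae leb3, between M (u t) p.
  move=> t1; apply: Linfw_ge => //; last exact: upos.
  by apply: le_trans usup; apply: ereal_sup_ubound; exists t.
have iu t : 0 <= t -> leb3.-integrable setT (EFin \o u t).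
  by move=> t1; have [/in_X_integrable] := C1v t t1.
have iv t : 0 <= t -> leb3.-integrable setT (EFin \o v t).
  by move=> t1; have [_ /in_X_integrable] := C1v t t1.
have mu t : 0 <= t -> measurable_fun setT (u t).
  by move=> t1; have [[]] := C1v t t1.
have mv t : 0 <= t -> measurable_fun setT (v t).
  by move=> t1; have [_ []] := C1v t t1.
split=> //; last first.
  move=> t t1.
  apply: filterS2 (hv t t1) (collision_between (mu t t1) M0 (bet t t1)) => p [_ ->].
  by move=> [_ ->].
move=> t t1 k k0; have [_ _ + _] := C1v t t1.
move=> /cvg0_ereal-/(_ _) h.
have /near_half_line_punctured[e e0 he] := h (fun s => X_norm_ge0 _) k k0.
exists e => // s s0 st.
have [->|nst] := eqVneq s t.
  rewrite subrr normr0 mulr0 integral0_eq// => p _.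
  by rewrite !subrr mul0r subr0 normr0.
have st0 : s - t != 0 by rewrite subr_eq0.
pose g p := (u s p - u t p) / (s - t) - v t p.
have mg : measurable_fun setT g.
  apply: measurable_funB; last exact: mv.
  by apply: measurable_funM => //; apply: measurable_funB; exact: mu.
rewrite (_ : (fun p => _) = (fun p => (`|s - t|%:E * `|g p|%:E)%E)); last first.
  apply/funext => p; rewrite -EFinM -normrM; congr (`|_|%:E).
  by rewrite /g; field.
rewrite ge0_integralZl_EFin; last 4 first.
- exact: measurableT.
- by move=> p _; rewrite lee_fin.
- by apply/measurable_EFinP; exact: measurableT_comp.
- exact: normr_ge0.
rewrite mulrC EFinM lee_wpmul2l ?lee_fin//.
exact: le_trans (L1_le_X g) (he s s0 nst st).
Qed.

Section Construction.
Context (M : R) (M0 : 0 <= M) (f0 : vec3 R -> R).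
Context (F : R -> vec3 R -> R) (B : R) (B0 : 0 <= B).
Context (F0 : forall p, F 0 p = f0 p).
Context (mF : forall t, measurable_fun setT (F t)).
Context (bF : forall t p, between M (F t) p).
Context (dF : forall t p, 0 < t < T -> is_derive t 1 (F ^~ p) (Q (F t) p)).
Context (lF : forall s t p, `|F t p - F s p| <= B * n p * `|t - s|).
Context (bQ : forall t p, `|Q (F t) p| <= B * n p).
Context (lQ : forall s t p, `|Q (F t) p - Q (F s) p| <=
  B * (n p * (1 + (1 + enorm p))) * `|t - s|).

Let u t p := F (tau t) p.
Let v t p := ka t * Q (F (tau t)) p.

(** All limits in time are shown pointwise with error k W, uniformly in [p]; [X_norm_le] converts
    this into convergence in X. *)
Let W p := (1 + enorm p) * n p.

Let n_le p : n p <= W p.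
Proof. by rewrite /W ler_peMl ?wt_ge0// lerDl enorm_ge0. Qed.

Let mu t : measurable_fun setT (u t). Proof. exact: mF. Qed.

Let mv t : measurable_fun setT (v t).
Proof.
apply: measurable_funM => //; apply: (measurable_collide K) => // p.
by case/andP: (bF (tau t) p).
Qed.

Let in_Xu t : in_X (u t).
Proof.
apply: (@in_X_le _ _ M) => // p; have /andP[u0 uM] := bF (tau t) p.
rewrite ger0_norm//; apply: (le_trans uM); rewrite ler_wpM2l//.
exact: le_trans (kin_mn_le K p) (n_le p).
Qed.

Let in_Xv t : in_X (v t).
Proof.
have kB : 0 <= ka t * B by rewrite mulr_ge0 ?rate_ge0.
apply: (in_X_le (mv t) kB) => p.
rewrite /v normrM (ger0_norm (rate_ge0 _ _ _ _)) -mulrA ler_wpM2l ?rate_ge0//.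
by apply: (le_trans (bQ _ _)); rewrite ler_wpM2l.
Qed.

Let v_close t : 0 <= t -> forall k, 0 < k -> exists2 e, 0 < e &
  forall s, 0 <= s -> `|s - t| < e -> forall p, `|v s p - v t p| <= k * W p.
Proof.
move=> t1 k k0.
have kt := rate_ge0 a cR t0 t.
(* The variation of the rate meets the bound [B] on the collision term, and that of the clock meets
   its Lipschitz constant, at most 2 B W; the 1 avoids a zero divisor. *)
have D0 : 0 < 1 + B * (1 + 2 * ka t) by rewrite ltr_wpDr// mulr_ge0// addr_ge0// mulr_ge0.
have [e e0 he] := time_modulus a0 hcR ht0 t1 (divr_gt0 k0 D0).
exists e => // s s0 st p; have [h1 h2] := he s s0 st.
set d := k / _ in h1 h2.
have d0 : 0 <= d by rewrite /d divr_ge0// ltW.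
have W0 : 0 <= W p by apply: le_trans (n_le p); exact: wt_ge0.
have splitM (x x' y y' : R) : x * y - x' * y' = (x - x') * y + x' * (y - y') by ring.
rewrite /v splitM.
apply: (le_trans (ler_normD _ _)); rewrite !normrM (ger0_norm kt).
have e1 : `|ka s - ka t| * `|Q (F (tau s)) p| <= d * (B * W p).
  by apply: ler_pM => //; apply: (le_trans (bQ _ _)); rewrite ler_wpM2l.
have e2 : ka t * `|Q (F (tau s)) p - Q (F (tau t)) p| <= ka t * (2 * B * W p * d).
  rewrite ler_wpM2l//; apply: (le_trans (lQ _ _ _)); apply: ler_pM => //.
    by rewrite mulr_ge0// (mulr_ge0 (wt_ge0 _ _))// !addr_ge0 ?enorm_ge0.
  rewrite [leRHS](_ : _ = B * (n p * (2 * (1 + enorm p)))); last by rewrite /W; ring.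
  by rewrite ler_wpM2l// ler_wpM2l ?wt_ge0//; have := enorm_ge0 p; lra.
apply: (le_trans (lerD e1 e2)).
rewrite [leLHS](_ : _ = d * (B * (1 + 2 * ka t)) * W p); last by ring.
rewrite ler_wpM2r// /d -mulrA ler_piMr ?(ltW k0)// mulrC ler_pdivrMr// mul1r.
by rewrite lerDr.
Qed.

(** By the mean value theorem the quotient equals [v] at an intermediate time. That time depends on
    [p], but [v_close] is uniform in [p]. *)
Let u_diff t : 0 <= t -> forall k, 0 < k -> exists2 e, 0 < e &
  forall s, 0 <= s -> s != t -> `|s - t| < e ->
    forall p, `|(u s p - u t p) / (s - t) - v t p| <= k * W p.
Proof.
move=> t1 k k0; have [e e0 he] := v_close t1 k0; exists e => // s s0 nst st p.
have [c [c0 ct E]] : exists c, [/\ 0 <= c, `|c - t| <= `|s - t| &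
    u s p - u t p = v c p * (s - t)].
  apply: (@mean_value_between R (u ^~ p) (v ^~ p)) => // x x0.
    have d1 := clock_derive a0 hcR ht0 (ltW x0).
    have x1 : 0 < tau x < T by rewrite clock_gt0// clock_lt_end// ltW.
    have d2 := dF p x1.
    have := @is_derive1_comp R (F ^~ p) tau x _ _ d2 d1.
    by rewrite mulrC.
  have cF : continuous (F ^~ p).
    move=> y; apply/cvgrPdist_le => d d0.
    have Bn : 0 < B * n p + 1 by rewrite ltr_wpDl// mulr_ge0 ?wt_ge0.
    apply/nbhs_ballP; exists (d / (B * n p + 1)) => [|z]; first by rewrite /= divr_gt0.
    rewrite /ball/= => yz; apply: (le_trans (lF _ _ _)).
    apply: (@le_trans _ _ ((B * n p + 1) * (d / (B * n p + 1)))); last by rewrite mulrC divfK// gt_eqF.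
    apply: ler_pM => //; [by rewrite mulr_ge0 ?wt_ge0|by rewrite lerDl|exact: ltW].
  exact: (continuous_comp (clock_continuous a0 hcR ht0 x0) (cF _)).
rewrite E mulfK ?subr_eq0//; apply: he => //.
exact: le_lt_trans st.
Qed.

Let vanishing (G : set_system R) (FG : Filter G) (g : R -> vec3 R -> R) :
    (forall s, measurable_fun setT (g s)) ->
    (forall k, 0 < k -> \forall s \near G, forall p, `|g s p| <= k * W p) ->
  X_norm (g s) @[s --> G] --> 0%E.
Proof.
move=> mg gk; apply/cvg0_ereal => [s|e e0]; first exact: X_norm_ge0.
have mb := moment_bound_gt0 R.
have k0 : 0 < e / (2 * moment_bound R) by rewrite divr_gt0// mulr_gt0.
apply: filterS (gk _ k0) => s gs.
apply: (le_trans (X_norm_le (mg s) (ltW k0) gs)); rewrite lee_fin.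
by rewrite le_eqVlt; apply/orP; left; apply/eqP; field; rewrite gt_eqF.
Qed.

Lemma constructed_C1 : C1_with_derivative u v.
Proof.
move=> t t1; split.
- exact: in_Xu.
- exact: in_Xv.
- apply: vanishing => [s|k k0].
    apply: measurable_funB => //; apply: measurable_funM => //.
    exact: measurable_funB.
  by apply/near_half_line_punctured; exact: u_diff.
- apply: vanishing => [s|k k0]; first exact: measurable_funB.
  by apply/near_half_line; exact: v_close.
Qed.

Lemma constructed_admissible (g0 : vec3 R -> R) : f0 = g0 %[ae leb3] ->
  admissible_solution a cR t0 M g0 u.
Proof.
move=> fg; split.
- split.
    by apply: filterS fg => p /= h _; rewrite /u clock0 F0; exact: h.
  exists v; first exact: constructed_C1.
  move=> t t1; apply: filterS (collision_between (mu t) M0 _) => [p [? ->]//|].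
  by apply: aeW => p; exact: bF.
- by move=> t t1; apply: aeW => p; case/andP: (bF (tau t) p).
- apply: ge_ereal_sup => _ [t t1 <-]; apply: Linfw_le => //.
  by apply: aeW => p; exact: bF.
Qed.

End Construction.

Lemma wt_integrable : leb3.-integrable setT (EFin \o n).
Proof.
apply: in_X_integrable; apply: (@in_X_le _ _ 1) => // [|p]; first exact: measurable_wt.
by rewrite mul1r ger0_norm ?wt_ge0// ler_peMl ?wt_ge0// lerDl enorm_ge0.
Qed.

End Boltzmann.

Theorem theorem2 (R : realType) (a cR t0 : R)
  (ha : 0 <= a < 2) (hcR : 0 < cR) (ht0 : 0 < t0) :
  exists eps C : R, [/\ 0 < eps, 0 < C &
    forall f0 : vec3 R -> R,
      in_Linfw f0 -> ae_nonneg f0 -> (Linfw_norm f0 < eps%:E)%E ->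
      exists2 f : R -> vec3 R -> R,
        admissible_solution a cR t0 (C * eps) f0 f &
        forall g : R -> vec3 R -> R,
          admissible_solution a cR t0 (C * eps) f0 g ->
          forall t : R, 0 <= t -> g t = f t %[ae leb3]].
Proof.
have a0 : 0 <= a by case/andP: ha.
have [C C1 K] := kinetic_kern ha.
have C0 : 0 < C by exact: lt_le_trans C1.
have scaling x : 0 < x -> 6 * (x * (2 * (12 * (x * C * C))^-1) * C * C) = 1.
  by move=> x0; field; rewrite !gt_eqF.
pose T := clock_end a cR t0.
have T0 : 0 < T by exact: clock_end_gt0.
(* Chosen so that M = 2 eps turns the smallness condition 6 T M C^2 <= 1 into an equality. *)
pose eps := (12 * (T * C * C))^-1.
have eps0 : 0 < eps.
  rewrite /eps invr_gt0; apply: mulr_gt0 => //.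
  by apply: mulr_gt0 => //; exact: mulr_gt0.
pose M := 2 * eps; have M0 : 0 <= M by rewrite mulr_ge0// ltW.
have small : 6 * (T * M * C * C) <= 1.
  by rewrite /M /eps (scaling _ T0).
exists eps, 2; split => // f0 [mf0 _] f0pos f0eps.
(* The datum obeys its bounds only almost everywhere, while the construction works at every [p];
   this representative obeys them everywhere. *)
pose g0 p := if (0 <= f0 p) && (f0 p <= eps * wt 1 p) then f0 p else 0.
have mg0 : measurable_fun setT g0.
  apply: measurable_fun_ifT => //; apply: measurable_and.
    exact: measurable_fun_ler.
  apply: measurable_fun_ler => //; apply: measurable_funM => //.
  exact: measurable_wt.
have bg0 p : 0 <= g0 p <= M / 2 * wt 1 p.
  rewrite (_ : M / 2 = eps); last by rewrite /M; field.
  by rewrite /g0; case: ifP => // _; rewrite lexx (mulr_ge0 (ltW eps0))// wt_ge0.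
have fg : g0 = f0 %[ae leb3].
  apply: filterS (Linfw_ge (ltW eps0) (ltW f0eps) f0pos) => p h _.
  by rewrite /g0 ifT.
have [F [B [[B0 F0] mbF dF lF [bQ lQ]]]] :=
  kinetic_existence K (ltW T0) M0 C1 small mg0 bg0.
have adm := constructed_admissible ha hcR ht0 K M0 B0 F0 (fun t => proj1 (mbF t))
  (fun t => proj2 (mbF t)) dF lF bQ lQ fg.
exists (fun t p => F (clock a cR t0 t) p) => // g admg t t1.
have [v hf] := admissible_kinetic ha K M0 adm.
have [w hg] := admissible_kinetic ha K M0 admg.
have [[g00 _] _ _] := admg; have [[f00 _] _ _] := adm.
have tauT s : 0 <= s -> 0 <= clock a cR t0 s <= T.
  by move=> s0; rewrite clock_ge0// ltW// clock_lt_end.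
have E0 : \forall p \ae leb3, g 0 p = F (clock a cR t0 0) p.
  by apply: filterS2 g00 f00 => p h1 h2; rewrite h1// h2.
apply: filterS (kinetic_unique K C1 (@seen_ae R) (wt_integrable R)
  (fun s _ => rate_ge0 a cR t0 s) (clock0 a cR t0) tauT
  (clock_diff a0 hcR ht0) M0 small hg hf E0 t1) => p h _.
exact: h.
Qed.
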